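(* The system $\mathsf{ACA}_0^\omega$ proves $\mathsf{LLP}\leftrightarrow\mathsf{LLP}_{\mathsf{RM}}$ and $\mathsf{LLP}\to\mathsf{WHBU}_{\mathbf m}$.
   Context: Finite types: $0$ is the type of natural numbers, $\sigma\to\tau$ is the type of maps from type $\sigma$ objects to type $\tau$ objects; $1=0\to0$, $n+1=n\to0$. The language $L_\omega$ has variables of all finite types and constants $0,1,<_0,+_0,\times_0,=_0$, combinators and recursors; for $\tau=\tau_1\to\dots\to\tau_k\to0$, $x=_\tau y$ abbreviates $\forall z_1^{\tau_1}\dots z_k^{\tau_k}(xz_1\dots z_k=_0yz_1\dots z_k)$. $\mathsf{RCA}_0^\omega$ is the theory in classical logic with axioms: (1) $0,1,<_0,+_0,\times_0$ form an ordered semi-ring with equality $=_0$; (2) the defining axioms of the combinators $\Pi,\Sigma$ (giving $\lambda$-abstraction); (3) $\mathbf R_0(f,m,0)=m$, $\mathbf R_0(f,m,n+1)=f(n,\mathbf R_0(f,m,n))$; (4) extensionality: $x=_\rho y\to\varphi(x)=_\tau\varphi(y)$ for all $\varphi^{\rho\to\tau}$ and all types; (5) induction for quantifier-free formulas of $L_\omega$ (variables of any type allowed); (6) $\mathsf{QF\text{-}AC}^{1,0}$: $(\forall x^1)(\exists y^0)A(x,y)\to(\exists Y^{2})(\forall x^1)A(x,Y(x))$ for quantifier-free $A$. $\mathsf{ACA}_0^\omega$ is $\mathsf{RCA}_0^\omega$ plus $(\mu^2)$: there is $\mu^2$ such that for all $f^1$, if $(\exists n)(f(n)=0)$ then $\mu(f)$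 is the least such $n$, and otherwise $\mu(f)=0$. Reals are represented by sequences of rationals $(q_n)$ with $|q_n-q_{n+i}|<2^{-n}$ for all $n,i$; $(q_n)=_{\mathbb R}(r_n)$ iff $|q_n-r_n|\le2^{-n+1}$ for all $n$; functions on $\mathbb R$ or $I=[0,1]$ are type $1\to1$ objects mapping equal reals to equal reals. A subset of $\mathbb R$ is given by $Y:\mathbb R\to\mathbb R$, with $x\in Y$ iff $Y(x)>_{\mathbb R}0$. An RM-closed subset of $[0,1]$ is one given as $[0,1]\setminus\bigcup_n(a_n,b_n)$ for a sequence of open intervals with rational end-points. Measure convention: statements about Lebesgue measure $\lambda(E)=\inf\{\sum_k|J_k|:(J_k)_{k\in\mathbb N}\text{ a sequence of open intervals with }E\subset\bigcup_kJ_k\}$ are read comparatively, without assuming the infimum exists: $\lambda(E)\ge a$ means that $a\le\sum_k|J_k|$ for each such cover of $E$; $\lambda(E)\le a$ means that for each $\delta>0$ there is such a cover with $\sum_k|J_k|\le a+\delta$; and so on. $E\subseteq[0,1]$ is measurable if $\lambda(E)+\lambda([0,1]\setminus E)\le1$. $f$ is measurable if for all $t\in\mathbb R$ the set $\{x:f(x)>t\}$ is measurable. $\mathsf{LLP}$: for measurable $f:\mathbb R\to\mathbb R$ and $\varepsilon>0$, there is a measurable set $K\subseteq I$ such that $\lambda(I\setminus K)<\varepsilon$ and $f$ is bounded on $K$. $\mathsf{LLP}_{\mathsf{RM}}$: the same statement with $K$ additionally RM-closed. $\mathsf{WHBU}_{\mathbf m}$: for every measurable $\Psi:[0,1]\to\mathbb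 R^+$ and $\varepsilon>0$ there are $y_0,\dots,y_n\in[0,1]$ such that the measure of $\bigcup_{i\le n}(y_i-\Psi(y_i),y_i+\Psi(y_i))$ is at least $1-\varepsilon$. *)

(* Defs.v *)
From Stdlib Require Import List.
Import ListNotations.

Inductive ty : Set :=
| N : ty
| Arr : ty -> ty -> ty.

Notation "s ⇒ t" := (Arr s t) (at level 55, right associativity).

(** The type "1", which is also the type of codes of reals. *)
Notation R := (N ⇒ N).

(** A context [V] is an arbitrary family of sets of variables. [ext V s] has one
    more variable, of type [s]. Sentences are formulas over [empty]. *)
Inductive ext (V : ty -> Set) (s : ty) : ty -> Set :=
| new : ext V s s
| old : forall t, V t -> ext V s t.
Arguments new {V s}.
Arguments old {V s t} _.

Definition empty (t : ty) : Set := Empty_set.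

Inductive const : ty -> Set :=
| Zero : const N
| One : const N
| Plus : const (N ⇒ N ⇒ N)
| Times : const (N ⇒ N ⇒ N)
| Pi : forall s t, const (s ⇒ t ⇒ s)
| Sigma : forall r s t, const ((r ⇒ s ⇒ t) ⇒ (r ⇒ s) ⇒ r ⇒ t)
| Rec : const ((N ⇒ N ⇒ N) ⇒ N ⇒ N ⇒ N).

Inductive term (V : ty -> Set) : ty -> Set :=
| Var : forall t, V t -> term V t
| Cst : forall t, const t -> term V t
| App : forall s t, term V (s ⇒ t) -> term V s -> term V t.
Arguments Var {V t} _.
Arguments Cst {V t} _.
Arguments App {V s t} _ _.

Inductive form (V : ty -> Set) : Set :=
| Bot : form V
| Eq : term V N -> term V N -> form V
| Lt : term V N -> term V N -> form V
| And : form V -> form V -> form V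
| Or : form V -> form V -> form V
| Imp : form V -> form V -> form V
| All : forall s, form (ext V s) -> form V
| Ex : forall s, form (ext V s) -> form V.
Arguments Bot {V}.
Arguments Eq {V} _ _.
Arguments Lt {V} _ _.
Arguments And {V} _ _.
Arguments Or {V} _ _.
Arguments Imp {V} _ _.
Arguments All {V} s _.
Arguments Ex {V} s _.

Definition Not {V} (A : form V) : form V := Imp A Bot.
Definition Iff {V} (A B : form V) : form V := And (Imp A B) (Imp B A).

Definition renaming (V W : ty -> Set) := forall t, V t -> W t.
Definition substitution (V W : ty -> Set) := forall t, V t -> term W t.

Fixpoint ren {V W} (r : renaming V W) {t} (u : term V t) : term W t :=
  match u with
  | Var x => Var (r _ x)
  | Cst c => Cst c
  | App f a => App (ren r f) (ren r a)
  end.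

Definition up_ren {V W} (r : renaming V W) {s} : renaming (ext V s) (ext W s) :=
  fun t x => match x with new => new | old y => old (r _ y) end.

Fixpoint renF {V W} (r : renaming V W) (A : form V) : form W :=
  match A with
  | Bot => Bot
  | Eq a b => Eq (ren r a) (ren r b)
  | Lt a b => Lt (ren r a) (ren r b)
  | And B C => And (renF r B) (renF r C)
  | Or B C => Or (renF r B) (renF r C)
  | Imp B C => Imp (renF r B) (renF r C)
  | All s B => All s (renF (up_ren r) B)
  | Ex s B => Ex s (renF (up_ren r) B)
  end.

Fixpoint sub {V W} (r : substitution V W) {t} (u : term V t) : term W t :=
  match u with
  | Var x => r _ x
  | Cst c => Cst c
  | App f a => App (sub r f) (sub r a)
  end.

Definition up_sub {V W} (r : substitution V W) {s} :
    substitution (ext V s) (ext W s) :=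
  fun t x => match x with new => Var new | old y => ren (@old W s) (r _ y) end.

Fixpoint subF {V W} (r : substitution V W) (A : form V) : form W :=
  match A with
  | Bot => Bot
  | Eq a b => Eq (sub r a) (sub r b)
  | Lt a b => Lt (sub r a) (sub r b)
  | And B C => And (subF r B) (subF r C)
  | Or B C => Or (subF r B) (subF r C)
  | Imp B C => Imp (subF r B) (subF r C)
  | All s B => All s (subF (up_sub r) B)
  | Ex s B => Ex s (subF (up_sub r) B)
  end.

(** The substitution [a] for the newest variable, and [r] for the others. *)
Definition scons {V W s} (a : term W s) (r : substitution V W) :
    substitution (ext V s) W :=
  fun t x => match x in ext _ _ t return term W s -> term W t with
             | new => fun a => a
             | old y => fun _ => r _ y
             end a.

Definition inst {V s} (A : form (ext V s)) (a : term V s) : form V :=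
  subF (scons a (@Var V)) A.

(** In [ALL x : s, A] the name [x] stands for the newest variable of the context
    of [A]. Under further binders it is used as [↑x]; [↑] inserts the inclusion
    of the context of [x] in the current one, found by instance resolution.
    [⇑E] does the same for a formula [E] with one distinguished variable. *)

Class Incl (V W : ty -> Set) := weaken : renaming V W.
#[export] Instance weaken_refl V : Incl V V | 0 := fun t x => x.
#[export] Instance weaken_ext V W s (i : Incl V W) : Incl V (ext W s) | 1 :=
  fun t x => old (weaken t x).

Declare Scope syn_scope.
Delimit Scope syn_scope with syn.
Open Scope syn_scope.

Definition allB {V} s (A : term (ext V s) s -> form (ext V s)) : form V :=
  All s (A (Var new)).
Definition exB {V} s (A : term (ext V s) s -> form (ext V s)) : form V :=
  Ex s (A (Var new)).

Notation "'ALL' x : s , A" := (allB s (fun x => A))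
  (at level 99, x name, s at level 60, A at level 99) : syn_scope.
Notation "'EX' x : s , A" := (exB s (fun x => A))
  (at level 99, x name, s at level 60, A at level 99) : syn_scope.
Notation "↑ u" := (ren weaken u) (at level 1, u at level 1) : syn_scope.
Notation "⇑ E" := (renF (up_ren weaken) E) (at level 1, E at level 1) : syn_scope.
Notation "f · a" := (App f a) (at level 25, left associativity) : syn_scope.
Notation "a ⊕ b" := (Cst Plus · a · b) (at level 33, left associativity) : syn_scope.
Notation "a ⊗ b" := (Cst Times · a · b) (at level 31, left associativity) : syn_scope.
Notation "𝟎" := (Cst Zero) : syn_scope.
Notation "𝟏" := (Cst One) : syn_scope.
Notation "a ≐ b" := (Eq a b) (at level 70) : syn_scope.
Notation "a ≺ b" := (Lt a b) (at level 70) : syn_scope.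
Notation "¬ A" := (Not A) (at level 75, right associativity) : syn_scope.
Notation "A ⋏ B" := (And A B) (at level 80, right associativity) : syn_scope.
Notation "A ⋎ B" := (Or A B) (at level 85, right associativity) : syn_scope.
Notation "A ⟶ B" := (Imp A B) (at level 90, right associativity) : syn_scope.
Notation "A ⟷ B" := (Iff A B) (at level 95) : syn_scope.

Fixpoint EqT {V} (t : ty) : term V t -> term V t -> form V :=
  match t with
  | N => fun a b => a ≐ b
  | s ⇒ t => fun a b => ALL z : s, EqT t (↑a · z) (↑b · z)
  end.
Arguments EqT {V t} _ _.

Definition theory := forall V : ty -> Set, form V -> Prop.

(** [Prv T V H A]: in many-sorted classical natural deduction, [A] is derivable
    from the hypotheses [H] and axioms in [T], with free variables in [V]. *)
Inductive Prv (T : theory) : forall V : ty -> Set, list (form V) -> form V -> Prop :=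
| PAx V H A : T V A -> Prv T V H A
| PHyp V H A : In A H -> Prv T V H A
| PBotC V H A : Prv T V (Not A :: H) Bot -> Prv T V H A
| PAndI V H A B : Prv T V H A -> Prv T V H B -> Prv T V H (And A B)
| PAndE1 V H A B : Prv T V H (And A B) -> Prv T V H A
| PAndE2 V H A B : Prv T V H (And A B) -> Prv T V H B
| POrI1 V H A B : Prv T V H A -> Prv T V H (Or A B)
| POrI2 V H A B : Prv T V H B -> Prv T V H (Or A B)
| POrE V H A B C : Prv T V H (Or A B) ->
    Prv T V (A :: H) C -> Prv T V (B :: H) C -> Prv T V H C
| PImpI V H A B : Prv T V (A :: H) B -> Prv T V H (Imp A B)
| PImpE V H A B : Prv T V H (Imp A B) -> Prv T V H A -> Prv T V H B
| PAllI V H s (A : form (ext V s)) :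
    Prv T (ext V s) (map (renF (@old V s)) H) A -> Prv T V H (All s A)
| PAllE V H s (A : form (ext V s)) a : Prv T V H (All s A) -> Prv T V H (inst A a)
| PExI V H s (A : form (ext V s)) a : Prv T V H (inst A a) -> Prv T V H (Ex s A)
| PExE V H s (A : form (ext V s)) B : Prv T V H (Ex s A) ->
    Prv T (ext V s) (A :: map (renF (@old V s)) H) (renF (@old V s) B) ->
    Prv T V H B.

Definition proves (T : theory) (A : form empty) : Prop := Prv T empty [] A.

Fixpoint qf {V} (A : form V) : Prop :=
  match A with
  | Bot | Eq _ _ | Lt _ _ => True
  | And B C | Or B C | Imp B C => qf B /\ qf C
  | All _ _ | Ex _ _ => False
  end.

(** Non-negativity and discreteness of the order follow by quantifier-free
    induction; congruence for addition and multiplication follows from [ext_ax]. *)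
Inductive semiring_ax {V} : form V -> Prop :=
| eq_refl_ax a : semiring_ax (a ≐ a)
| eq_sym_ax a b : semiring_ax (a ≐ b ⟶ b ≐ a)
| eq_trans_ax a b c : semiring_ax (a ≐ b ⟶ b ≐ c ⟶ a ≐ c)
| lt_cong_ax a a' b b' : semiring_ax (a ≐ a' ⟶ b ≐ b' ⟶ a ≺ b ⟶ a' ≺ b')
| add_0_ax a : semiring_ax (a ⊕ 𝟎 ≐ a)
| add_comm_ax a b : semiring_ax (a ⊕ b ≐ b ⊕ a)
| add_assoc_ax a b c : semiring_ax (a ⊕ (b ⊕ c) ≐ a ⊕ b ⊕ c)
| mul_0_ax a : semiring_ax (a ⊗ 𝟎 ≐ 𝟎)
| mul_1_ax a : semiring_ax (a ⊗ 𝟏 ≐ a)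
| mul_comm_ax a b : semiring_ax (a ⊗ b ≐ b ⊗ a)
| mul_assoc_ax a b c : semiring_ax (a ⊗ (b ⊗ c) ≐ a ⊗ b ⊗ c)
| distr_ax a b c : semiring_ax (a ⊗ (b ⊕ c) ≐ a ⊗ b ⊕ a ⊗ c)
| lt_irrefl_ax a : semiring_ax (¬ a ≺ a)
| lt_trans_ax a b c : semiring_ax (a ≺ b ⟶ b ≺ c ⟶ a ≺ c)
| lt_total_ax a b : semiring_ax (a ≺ b ⋎ a ≐ b ⋎ b ≺ a)
| lt_0_1_ax : semiring_ax (𝟎 ≺ 𝟏)
| lt_add_ax a b c : semiring_ax (a ≺ b ⟶ a ⊕ c ≺ b ⊕ c)
| lt_mul_ax a b c : semiring_ax (𝟎 ≺ c ⟶ a ≺ b ⟶ a ⊗ c ≺ b ⊗ c).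

Inductive RCA0w (V : ty -> Set) : form V -> Prop :=
| semiring A : semiring_ax A -> RCA0w V A
| Pi_ax s t (x : term V s) (y : term V t) :
    RCA0w V (EqT (Cst (Pi s t) · x · y) x)
| Sigma_ax r s t (x : term V (r ⇒ s ⇒ t)) y z :
    RCA0w V (EqT (Cst (Sigma r s t) · x · y · z) (x · z · (y · z)))
| Rec_0_ax f m : RCA0w V (Cst Rec · f · m · 𝟎 ≐ m)
| Rec_S_ax f m n :
    RCA0w V (Cst Rec · f · m · (n ⊕ 𝟏) ≐ f · n · (Cst Rec · f · m · n))
| ext_ax s t (f : term V (s ⇒ t)) x y :
    RCA0w V (EqT x y ⟶ EqT (f · x) (f · y))
| qf_ind_ax (A : form (ext V N)) : qf A ->
    RCA0w V (inst A 𝟎 ⋏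
             (ALL n : N, A ⟶ subF (scons (n ⊕ 𝟏) (fun t v => Var (old v))) A) ⟶
             All N A)
| qf_ac_ax (A : form (ext (ext V R) N)) : qf A ->
    RCA0w V (All R (Ex N A) ⟶
             EX Y : R ⇒ N, ALL x : R,
               subF (scons (↑Y · x) (scons x (fun t v => Var (weaken t v)))) A).

Definition mu_axiom {V} : form V :=
  EX mu : R ⇒ N, ALL f : R,
    ((EX n : N, ↑f · n ≐ 𝟎) ⟶
       f · (↑mu · f) ≐ 𝟎 ⋏ (ALL i : N, i ≺ ↑mu · ↑f ⟶ ¬ ↑f · i ≐ 𝟎)) ⋏
    (¬ (EX n : N, ↑f · n ≐ 𝟎) ⟶ ↑mu · f ≐ 𝟎).

Inductive ACA0w (V : ty -> Set) : form V -> Prop :=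
| ACA0w_RCA0w A : RCA0w V A -> ACA0w V A
| ACA0w_mu : ACA0w V mu_axiom.

(** [u] without the newest variable, if it does not occur in [u]. *)
Fixpoint strengthen {V s t} (u : term (ext V s) t) : option (term V t) :=
  match u with
  | Var x =>
      match x in ext _ _ t return option (term V t) with
      | new => None
      | old y => Some (Var y)
      end
  | Cst c => Some (Cst c)
  | App f a =>
      match strengthen f, strengthen a with
      | Some f, Some a => Some (f · a)
      | _, _ => None
      end
  end.

(** Bracket abstraction: [lam u · a] is provably equal to [u] at [a]. *)
Fixpoint lam {V s t} (u : term (ext V s) t) : term V (s ⇒ t) :=
  match u with
  | Var x =>
      match x in ext _ _ t return term V (s ⇒ t) with
      | new => Cst (Sigma s (s ⇒ s) s) · Cst (Pi s (s ⇒ s)) · Cst (Pi s s)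
      | old y => Cst (Pi _ s) · Var y
      end
  | Cst c => Cst (Pi _ s) · Cst c
  | App f a =>
      match strengthen f, strengthen a with
      | Some f, Some a => Cst (Pi _ s) · (f · a)
      | _, _ => Cst (Sigma s _ _) · lam f · lam a
      end
  end.

Definition lambda {V} s {t} (u : term (ext V s) s -> term (ext V s) t) :
    term V (s ⇒ t) :=
  lam (u (Var new)).

Notation "'LAM' x : s , u" := (lambda s (fun x => u))
  (at level 99, x name, s at level 60, u at level 99) : syn_scope.

(** The operations below are closed terms applied to their arguments, which keeps
    terms small: an argument is never duplicated. *)

Definition npred {V} (n : term V N) : term V N :=
  Cst Rec · (LAM i : N, LAM r : N, ↑i) · 𝟎 · n.
Definition monus {V} (m n : term V N) : term V N :=
  Cst Rec · (LAM i : N, LAM r : N, npred r) · m · n.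

(** [2 ^ n - 1] *)
Definition pow2m1 {V} (n : term V N) : term V N :=
  Cst Rec · (LAM i : N, LAM r : N, r ⊕ r ⊕ 𝟏) · 𝟎 · n.

(** The integer part of the square root: [r] is increased at step [i] iff
    [(r + 1) ^ 2 <= i + 1]. *)
Definition isqrt {V} (n : term V N) : term V N :=
  Cst Rec · (LAM i : N, LAM r : N,
    r ⊕ monus 𝟏 (monus ((r ⊕ 𝟏) ⊗ (r ⊕ 𝟏)) (↑i ⊕ 𝟏))) · 𝟎 · n.

(** The pairing [(a, b) |-> (a + b) ^ 2 + a] and its projections. *)
Definition npair {V} (a b : term V N) : term V N :=
  (LAM a : N, LAM b : N, (↑a ⊕ b) ⊗ (↑a ⊕ b) ⊕ ↑a) · a · b.
Definition pfst {V} (c : term V N) : term V N :=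
  (LAM c : N, monus c (isqrt c ⊗ isqrt c)) · c.
Definition psnd {V} (c : term V N) : term V N :=
  (LAM c : N, monus (isqrt c) (pfst c)) · c.

(** Every natural number codes a rational: [rat p m d] codes
    [(p - m) / (d + 1)]. *)
Definition rat {V} (p m d : term V N) : term V N := npair (npair p m) d.
Definition qpos {V} (q : term V N) : term V N := pfst (pfst q).
Definition qneg {V} (q : term V N) : term V N := psnd (pfst q).
Definition qden {V} (q : term V N) : term V N := psnd q ⊕ 𝟏.

Definition qnat {V} (n : term V N) : term V N := rat n 𝟎 𝟎.
Definition qopp {V} (q : term V N) : term V N :=
  (LAM q : N, rat (qneg q) (qpos q) (psnd q)) · q.
Definition qadd {V} (q r : term V N) : term V N :=
  (LAM q : N, LAM r : N,
     rat (qpos ↑q ⊗ qden r ⊕ qpos r ⊗ qden ↑q)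
         (qneg ↑q ⊗ qden r ⊕ qneg r ⊗ qden ↑q)
         (monus (qden ↑q ⊗ qden r) 𝟏)) · q · r.
Definition qsub {V} (q r : term V N) : term V N := qadd q (qopp r).

(** [2 ^ (- n)] and [2 ^ (- n + 1)]; the third argument of [rat] is the
    denominator minus one. *)
Definition qpow {V} (n : term V N) : term V N := rat 𝟏 𝟎 (pow2m1 n).
Definition qpow1 {V} (n : term V N) : term V N := rat (𝟏 ⊕ 𝟏) 𝟎 (pow2m1 n).

Definition qlt {V} (q r : term V N) : form V :=
  qpos q ⊗ qden r ⊕ qneg r ⊗ qden q ≺ qpos r ⊗ qden q ⊕ qneg q ⊗ qden r.
Definition qle {V} (q r : term V N) : form V := ¬ qlt r q.

Definition qabs_lt {V} (q r : term V N) : form V := qlt q r ⋏ qlt (qopp q) r.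
Definition qabs_le {V} (q r : term V N) : form V := qle q r ⋏ qle (qopp q) r.

Definition isReal {V} (x : term V R) : form V :=
  ALL n : N, ALL i : N,
    qabs_lt (qsub (↑x · ↑n) (↑x · (↑n ⊕ i))) (qpow ↑n).

(** As [x n] is within [2 ^ - n] of the real [x], [ltR x y] holds iff
    [x n + 2 ^ (- n + 1) < y n] for some [n]. *)
Definition eqR {V} (x y : term V R) : form V :=
  ALL n : N, qabs_le (qsub (↑x · n) (↑y · n)) (qpow1 n).
Definition ltR {V} (x y : term V R) : form V :=
  EX n : N, qlt (qadd (↑x · n) (qpow1 n)) (↑y · n).
Definition leR {V} (x y : term V R) : form V := ¬ ltR y x.

Definition rcst {V} (q : term V N) : term V R := LAM n : N, ↑q.
Definition rzero {V} : term V R := rcst (qnat 𝟎).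
Definition rone {V} : term V R := rcst (qnat 𝟏).
Definition ropp {V} (x : term V R) : term V R := LAM n : N, qopp (↑x · n).
Definition radd {V} (x y : term V R) : term V R :=
  LAM n : N, qadd (↑x · (n ⊕ 𝟏)) (↑y · (n ⊕ 𝟏)).
Definition rsub {V} (x y : term V R) : term V R := radd x (ropp y).

(** The sum of the reals [x k] for [k < n]. Its [m]-th approximation adds the
    [(m + n)]-th ones of the summands, as [n * 2 ^ - (m + n) <= 2 ^ - m]. *)
Definition rsum {V} (x : term V (N ⇒ R)) (n : term V N) : term V R :=
  LAM m : N,
    Cst Rec · (LAM k : N, LAM r : N, qadd r (↑x · ↑k · (↑m ⊕ ↑n))) ·
      qnat 𝟎 · ↑n.

(** A set of reals is a formula with one distinguished variable; those given by
    an object [Y] of type [R ⇒ R] are the [given_by Y]. *)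

Notation rset V := (form (ext V R)).
Definition set_of {V} (A : term (ext V R) R -> rset V) : rset V := A (Var new).
Notation "⦃ x | A ⦄" := (set_of (fun x => A))
  (at level 0, x name, A at level 99) : syn_scope.

Definition mem {V} (x : term V R) (Y : term V (R ⇒ R)) : form V :=
  ltR rzero (Y · x).
Definition given_by {V} (Y : term V (R ⇒ R)) : rset V := ⦃ x | mem x ↑Y ⦄.

Definition inI {V} (x : term V R) : form V :=
  isReal x ⋏ leR rzero x ⋏ leR x rone.
Definition complI {V} (E : rset V) : rset V := ⦃ x | inI x ⋏ ¬ E ⦄.

(** [f] is a function from [D] to the reals. *)
Definition funOn {V} (D : forall W, term W R -> form W)
    (f : term V (R ⇒ R)) : form V :=
  (ALL x : R, D _ x ⟶ isReal (↑f · x)) ⋏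
  (ALL x : R, ALL y : R, D _ ↑x ⟶ D _ y ⟶ eqR ↑x y ⟶
     eqR (↑f · ↑x) (↑f · y)).

Definition onR {V} (f : term V (R ⇒ R)) : form V := funOn (@isReal) f.
Definition onI {V} (f : term V (R ⇒ R)) : form V := funOn (@inI) f.

(** [a] and [b] give the sequence of (possibly empty) open intervals
    [(a k, b k)]. *)
Definition intervals {V} (a b : term V (N ⇒ R)) : form V :=
  ALL k : N, isReal (↑a · k) ⋏ isReal (↑b · k) ⋏ leR (↑a · k) (↑b · k).

Definition covers {V} (a b : term V (N ⇒ R)) (E : rset V) : form V :=
  ALL x : R, isReal x ⟶ E ⟶
    EX k : N, ltR (↑a · k) ↑x ⋏ ltR ↑x (↑b · k).

Definition psum {V} (a b : term V (N ⇒ R)) (n : term V N) : term V R :=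
  rsum (LAM k : N, rsub (↑b · k) (↑a · k)) n.

(** [λ(E) < c]: the infimum need not exist as an object, so this says that the
    total length of some cover is at most some [d < c]. *)
Definition measure_lt {V} (E : rset V) (c : term V R) : form V :=
  EX a : N ⇒ R, EX b : N ⇒ R,
    intervals ↑a b ⋏ covers ↑a b ⇑E ⋏
    EX d : R, isReal d ⋏ ltR d ↑c ⋏ ALL n : N, leR (psum ↑a ↑b n) ↑d.

(** [λ(E) >= c]: the partial sums of the lengths of each cover exceed each
    [d < c]. *)
Definition measure_ge {V} (E : rset V) (c : term V R) : form V :=
  ALL a : N ⇒ R, ALL b : N ⇒ R,
    intervals ↑a b ⟶ covers ↑a b ⇑E ⟶
    ALL d : R, isReal d ⟶ ltR d ↑c ⟶ EX n : N, ltR ↑d (psum ↑a ↑b n).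

(** [λ(E) + λ(F) <= c]: for each [d > 0] there are covers of [E] and of [F] of
    total lengths adding up to at most [c + d]. *)
Definition measure_add_le {V} (E F : rset V) (c : term V R) : form V :=
  ALL d : R, isReal d ⟶ ltR rzero d ⟶
    EX a : N ⇒ R, EX b : N ⇒ R, EX a' : N ⇒ R, EX b' : N ⇒ R,
      intervals ↑a ↑b ⋏ covers ↑a ↑b ⇑E ⋏
      intervals ↑a' b' ⋏ covers ↑a' b' ⇑F ⋏
      ALL n : N, leR (radd (psum ↑a ↑b n) (psum ↑a' ↑b' n)) (radd ↑c ↑d).

(** For [E] included in the unit interval. *)
Definition measurable {V} (E : rset V) : form V :=
  measure_add_le E (complI E) rone.

(** Measurability being defined for subsets of the unit interval, the sets
    [f > t] are taken within it, also for [f] defined on all reals. *)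
Definition measurable_fun {V} (f : term V (R ⇒ R)) : form V :=
  ALL t : R, isReal t ⟶ measurable ⦃ x | inI x ⋏ ltR ↑t (↑f · x) ⦄.

(** [K] is a measurable subset of the unit interval [I], [λ(I \ K) < e], and [f]
    is bounded on [K]. *)
Definition lusin_set {V} (f : term V (R ⇒ R)) (e : term V R)
    (K : term V (R ⇒ R)) : form V :=
  onR K ⋏ (ALL x : R, isReal x ⟶ mem x ↑K ⟶ inI x) ⋏
  measurable (given_by K) ⋏ measure_lt (complI (given_by K)) e ⋏
  EX M : R, isReal M ⋏ ALL x : R, isReal x ⟶ mem x ↑K ⟶
    leR (ropp ↑M) (↑f · x) ⋏ leR (↑f · x) ↑M.

Definition RM_closed {V} (K : term V (R ⇒ R)) : form V :=
  EX a : R, EX b : R, ALL x : R, isReal x ⟶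
    (mem x ↑K ⟷
     inI x ⋏ ALL n : N, ¬ (ltR (rcst (↑a · n)) ↑x ⋏ ltR ↑x (rcst (↑b · n)))).

Definition LLP : form empty :=
  ALL f : R ⇒ R, onR f ⟶ measurable_fun f ⟶
  ALL e : R, isReal e ⟶ ltR rzero e ⟶
  EX K : R ⇒ R, lusin_set ↑f ↑e K.

Definition LLP_RM : form empty :=
  ALL f : R ⇒ R, onR f ⟶ measurable_fun f ⟶
  ALL e : R, isReal e ⟶ ltR rzero e ⟶
  EX K : R ⇒ R, lusin_set ↑f ↑e K ⋏ RM_closed K.

Definition WHBU_m : form empty :=
  ALL psi : R ⇒ R,
    onI psi ⟶ (ALL x : R, inI x ⟶ ltR rzero (↑psi · x)) ⟶ measurable_fun psi ⟶
  ALL e : R, isReal e ⟶ ltR rzero e ⟶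
  EX n : N, EX y : N ⇒ R,
    (ALL i : N, i ≺ ↑n ⊕ 𝟏 ⟶ inI (↑y · i)) ⋏
    measure_ge
      ⦃ x | EX i : N, i ≺ ↑n ⊕ 𝟏 ⋏
              ltR (rsub (↑y · i) (↑psi · (↑y · i))) ↑x ⋏
              ltR ↑x (radd (↑y · i) (↑psi · (↑y · i))) ⦄
      (rsub rone ↑e).

(* Main.v *)
(** Provability is reduced to truth in models by a completeness theorem: the
    language is countable, so a consistent theory has a Henkin model built from
    terms, and extensionality makes provable equality a congruence, so that the
    quotient is an extensional structure. In a model, [N] is a possibly
    nonstandard discretely ordered semiring, whose rationals form an ordered
    field; a real is handled through the rationals below and above it. As [mu]
    decides number quantifiers, arithmetical induction and comprehension hold.

    Given [K] from LLP, a cover of [I \ K] may be taken with rational end-points,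
    and removing it from [I] leaves a closed subset [K'] of [K]. Up to a tail of
    small total length, this cover is finite, so on a fine grid [K'] is covered
    by the cells inside n_one of these finitely many intervals, and [I \ K'] by
    the other cells, neighbourhoods of the end-points and the tail; hence [K'] is
    measurable.

    For WHBU, apply LLP to [- log2 psi], so that [psi > 2 ^ - L] on [K]. Call a
    dyadic cell alive if every finite part of the cover of [I \ K] fills at most
    a proportion [th < 1] of it. One half of an alive cell is alive, which is a
    decidable choice, and the nested cells so obtained shrink to a point outside
    the cover. The centres [y] are the points found in the cells of level [L];
    an alive such cell lies in the interval around its point. If the measure of the
    union were less than [1 - e], bisecting [0, 1] with respect to both covers
    together would give a point in an alive cell outside the cover of the union. *)
From HB Require Import structures.
From mathcomp Require Import all_boot all_order all_algebra ring lra.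
From mathcomp Require Import boolp.
From Stdlib Require List Eqdep_dec.
Require Import Defs.
Set Implicit Arguments.
Unset Strict Implicit.
Unset Printing Implicit Defensive.
Import Order.TTheory GRing.Theory Num.Theory.

(** * Renaming and substitution *)

(** The numbers of a model may be nonstandard and its sums need not converge: of a cover one only
    knows a bound on all partial sums. So every recursion and induction is carried out inside the
    model, on predicates shown definable with parameters, and limits give way to statements about
    all finite stages; being alive is one of these. In the passage to WHBU the centres must be fixed
    before the cover of the union is known, so they come from a bisection with the content of the
    first cover alone. The second bisection adds both contents and keeps the threshold: for a
    rational [eps < e], the cover of [I \ K] has length below [eps / 2] and the supposed cover of
    the union at most [1 - eps], together less than [th = 1 - eps / 2]. Contents being nonnegative,
    a cell alive for the sum is alive for each summand, and one path serves both purposes. The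
    logarithm is rounded to the least [n] with [psi x > 2 ^ - n]: such a number depends on [x] only
    as a real, and its level sets in [I] come from level sets of [psi] by complement. *)

Lemma sub_ren V W U (r : renaming V W) (p : substitution W U) t (u : term V t) :
  sub p (ren r u) = sub (fun t x => p t (r t x)) u.
Proof. by elim: u => //= s t' f -> a ->. Qed.

Lemma ren_sub V W U (p : substitution V W) (r : renaming W U) t (u : term V t) :
  ren r (sub p u) = sub (fun t x => ren r (p t x)) u.
Proof. by elim: u => //= s t' f -> a ->. Qed.

Lemma sub_sub V W U (p : substitution V W) (q : substitution W U) t (u : term V t) :
  sub q (sub p u) = sub (fun t x => sub q (p t x)) u.
Proof. by elim: u => //= s t' f -> a ->. Qed.

Lemma up_sub_sub V W U (p : substitution V W) (q : substitution W U) s :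
  (fun t x => sub (up_sub q) (up_sub p t x)) =
  @up_sub _ _ (fun t x => sub q (p t x)) s.
Proof.
apply: functional_extensionality_dep => t; apply: funext => -[//|t' y] /=.
by rewrite sub_ren ren_sub.
Qed.

Lemma subF_subF V W U (p : substitution V W) (q : substitution W U) A :
  subF q (subF p A) = subF (fun t x => sub q (p t x)) A.
Proof.
elim: A W U p q => //= {V} V.
- by move=> a b W U p q; rewrite !sub_sub.
- by move=> a b W U p q; rewrite !sub_sub.
- by move=> A IA B IB W U p q; rewrite IA IB.
- by move=> A IA B IB W U p q; rewrite IA IB.
- by move=> A IA B IB W U p q; rewrite IA IB.
- by move=> s A IA W U p q; rewrite IA up_sub_sub.
- by move=> s A IA W U p q; rewrite IA up_sub_sub.
Qed.

Lemma up_subV V W (r : renaming V W) s :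
  @up_sub V W (fun t x => Var (r t x)) s = fun t x => Var (up_ren r t x).
Proof. by apply: functional_extensionality_dep => t; apply: funext => -[]. Qed.

Lemma ren_subV V W (r : renaming V W) t (u : term V t) :
  ren r u = sub (fun t x => Var (r t x)) u.
Proof. by elim: u => //= s t' f -> a ->. Qed.

(** Seeing a renaming as a substitution by variables reduces the mixed composition laws below to
    [subF_subF]. *)
Lemma renF_subV V W (r : renaming V W) A :
  renF r A = subF (fun t x => Var (r t x)) A.
Proof.
elim: A W r => //= {V} V.
- by move=> a b W r; rewrite !ren_subV.
- by move=> a b W r; rewrite !ren_subV.
- by move=> A IA B IB W r; rewrite IA IB.
- by move=> A IA B IB W r; rewrite IA IB.
- by move=> A IA B IB W r; rewrite IA IB.
- by move=> s A IA W r; rewrite IA up_subV.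
- by move=> s A IA W r; rewrite IA up_subV.
Qed.

Lemma sub_Var V t (u : term V t) : sub (@Var V) u = u.
Proof. by elim: u => //= s t' f -> a ->. Qed.

Lemma subF_Var V (A : form V) : subF (@Var V) A = A.
Proof.
have upV W s : @up_sub W W (@Var W) s = @Var (ext W s).
  by apply: functional_extensionality_dep => t; apply: funext => -[].
elim: A => //= {V} V.
- by move=> a b; rewrite !sub_Var.
- by move=> a b; rewrite !sub_Var.
- by move=> A -> B ->.
- by move=> A -> B ->.
- by move=> A -> B ->.
- by move=> s A; rewrite upV => ->.
- by move=> s A; rewrite upV => ->.
Qed.

Lemma renF_subF V W U (r : renaming V W) (p : substitution W U) A :
  subF p (renF r A) = subF (fun t x => p t (r t x)) A.
Proof. by rewrite renF_subV subF_subF. Qed.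

Lemma subF_renF V W U (p : substitution V W) (r : renaming W U) A :
  renF r (subF p A) = subF (fun t x => ren r (p t x)) A.
Proof.
rewrite renF_subV subF_subF; congr (subF _ A).
by apply: functional_extensionality_dep => t; apply: funext => x; rewrite ren_subV.
Qed.

Lemma sub_inst V W s (p : substitution V W) (A : form (ext V s)) a :
  subF p (inst A a) = inst (subF (up_sub p) A) (sub p a).
Proof.
rewrite /inst !subF_subF; congr (subF _ A).
apply: functional_extensionality_dep => t; apply: funext => -[//|t' y] /=.
by rewrite sub_ren /= -[LHS]sub_Var.
Qed.

Lemma inst_up V W s (p : substitution V W) (A : form (ext V s)) a :
  inst (subF (up_sub p) A) a = subF (scons a p) A.
Proof.
rewrite /inst !subF_subF; congr (subF _ A).
apply: functional_extensionality_dep => t; apply: funext => -[//|t' y] /=.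
by rewrite sub_ren /= -[RHS]sub_Var.
Qed.

Lemma sub_EqT V W (p : substitution V W) t (a b : term V t) :
  subF p (EqT a b) = EqT (sub p a) (sub p b).
Proof.
elim: t V W p a b => [|s _ t IH] V W p a b //=.
rewrite /allB IH /=.
have E c : sub (up_sub p) (ren (weaken (W := ext V s)) c) = ren (weaken (W := ext W s)) (sub p c).
  by rewrite sub_ren ren_sub.
by rewrite !E.
Qed.

Lemma inst_EqT_ext V s t (a b : term V (s ⇒ t)) u :
  inst (EqT (ren (@old V s) a · Var new) (ren (@old V s) b · Var new)) u =
  EqT (a · u) (b · u).
Proof. by rewrite /inst sub_EqT /= !sub_ren /= !sub_Var. Qed.

(** * Closure of derivations under substitution and weakening *)

Definition stable (T : theory) :=
  forall V W (p : substitution V W) A, T V A -> T W (subF p A).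

Lemma map_renF_subF V W (p : substitution V W) s H :
  List.map (renF (@old W s)) (List.map (subF p) H) =
  List.map (subF (up_sub p)) (List.map (renF (@old V s)) H).
Proof.
rewrite !List.map_map; apply: List.map_ext => A.
by rewrite subF_renF renF_subF.
Qed.

(** Serves twice: in [henkin_witness] to turn a Henkin variable back into a bound one, and in
    [completeness] to replace all Henkin variables by closed terms. *)
Lemma Prv_sub T : stable T -> forall V H A, Prv T V H A ->
  forall W (p : substitution V W), Prv T W (List.map (subF p) H) (subF p A).
Proof.
move=> sT V H A; elim=> {V H A} V H.
- by move=> A TA W p; apply/PAx/sT.
- by move=> A HA W p; apply/PHyp/List.in_map.
- by move=> A _ IH W p; apply/PBotC/IH.
- by move=> A B _ IA _ IB W p; apply/PAndI; [apply: IA|apply: IB].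
- by move=> A B _ IH W p; apply/PAndE1; apply: IH.
- by move=> A B _ IH W p; apply/PAndE2; apply: IH.
- by move=> A B _ IH W p; apply/POrI1; apply: IH.
- by move=> A B _ IH W p; apply/POrI2; apply: IH.
- by move=> A B C _ I1 _ I2 _ I3 W p; apply/POrE; [apply: I1|apply: I2|apply: I3].
- by move=> A B _ IH W p; apply/PImpI; apply: IH.
- by move=> A B _ I1 _ I2 W p; apply/PImpE; [apply: I1|apply: I2].
- by move=> s A _ IH W p; apply/PAllI; rewrite map_renF_subF; apply: IH.
- by move=> s A a _ IH W p; rewrite sub_inst; apply/PAllE; apply: IH.
- by move=> s A a _ IH W p; apply: (PExI _ _ _ _ _ (sub p a));
    rewrite -sub_inst; apply: IH.
- move=> s A B _ I1 _ I2 W p; apply: PExE; first exact: I1.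
  rewrite map_renF_subF.
  have -> : renF (@old W s) (subF p B) = subF (up_sub p) (renF (@old V s) B).
    by rewrite subF_renF renF_subF.
  exact: I2.
Qed.

Lemma incl_cons X (a : X) l l' : List.incl l l' -> List.incl (a :: l) (a :: l').
Proof. by move=> h x /= [->|/h]; [left|right]. Qed.

Lemma Prv_weak T V H A : Prv T V H A -> forall H', List.incl H H' -> Prv T V H' A.
Proof.
elim=> {V H A} V H.
- by move=> A TA H' i; apply: PAx.
- by move=> A HA H' i; apply: PHyp; apply: i.
- by move=> A _ IH H' i; apply/PBotC/IH/incl_cons.
- by move=> A B _ IA _ IB H' i; apply/PAndI; [apply: IA|apply: IB].
- by move=> A B _ IH H' i; apply/PAndE1; apply: IH.
- by move=> A B _ IH H' i; apply/PAndE2; apply: IH.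
- by move=> A B _ IH H' i; apply/POrI1; apply: IH.
- by move=> A B _ IH H' i; apply/POrI2; apply: IH.
- by move=> A B C _ I1 _ I2 _ I3 H' i; apply/POrE;
    [apply: I1|apply/I2/incl_cons|apply/I3/incl_cons].
- by move=> A B _ IH H' i; apply/PImpI/IH/incl_cons.
- by move=> A B _ I1 _ I2 H' i; apply/PImpE; [apply: I1|apply: I2].
- by move=> s A _ IH H' i; apply/PAllI/IH/List.incl_map.
- by move=> s A a _ IH H' i; apply/PAllE; apply: IH.
- by move=> s A a _ IH H' i; apply: (PExI _ _ _ _ _ a); apply: IH.
- move=> s A B _ I1 _ I2 H' i; apply: PExE; first exact: I1.
  exact/I2/incl_cons/List.incl_map.
Qed.

Lemma Prv_mono T V H H' A : List.incl H H' -> Prv T V H A -> Prv T V H' A.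
Proof. by move=> i /Prv_weak; apply. Qed.

Lemma Prv_exfalso T V H A : Prv T V H Bot -> Prv T V H A.
Proof. by move=> h; apply: PBotC; apply: Prv_mono h => x; right. Qed.

(** * Countability of the syntax *)

Fixpoint code_ty (t : ty) : GenTree.tree nat :=
  match t with
  | N => GenTree.Leaf 0
  | s ⇒ t => GenTree.Node 0 [:: code_ty s; code_ty t]
  end.

Lemma code_ty_inj : injective code_ty.
Proof. by elim=> [|s Is t It] [|s' t'] //= [/Is -> /It ->]. Qed.

Lemma ty_eq_dec (s t : ty) : {s = t} + {s <> t}.
Proof. by decide equality. Qed.

Lemma inj_pairT (P : ty -> Type) t (x y : P t) :
  existT P t x = existT P t y -> x = y.
Proof. exact: (Eqdep_dec.inj_pair2_eq_dec _ ty_eq_dec). Qed.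

Definition code_const t (c : const t) : GenTree.tree nat :=
  match c with
  | Zero => GenTree.Leaf 0
  | One => GenTree.Leaf 1
  | Plus => GenTree.Leaf 2
  | Times => GenTree.Leaf 3
  | Pi s t => GenTree.Node 0 [:: code_ty s; code_ty t]
  | Sigma r s t => GenTree.Node 0 [:: code_ty r; code_ty s; code_ty t]
  | Rec => GenTree.Leaf 4
  end.

Lemma code_const_inj t (c : const t) t' (c' : const t') :
  code_const c = code_const c' -> existT const t c = existT const t' c'.
Proof.
case: c => [||||s t1|r s t1|]; case: c' => [||||s' t1'|r' s' t1'|] //=.
  by case=> /code_ty_inj -> /code_ty_inj ->.
by case=> /code_ty_inj -> /code_ty_inj -> /code_ty_inj ->.
Qed.

Section CodeTerm.
Variables (V : ty -> Set) (cV : forall t, V t -> GenTree.tree nat).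

Fixpoint code_term t (u : term V t) : GenTree.tree nat :=
  match u with
  | @Var _ t x => GenTree.Node 0 [:: cV x]
  | Cst _ c => GenTree.Node 1 [:: code_const c]
  | App _ _ f a => GenTree.Node 2 [:: code_term f; code_term a]
  end.

Hypothesis cV_inj : forall t (x : V t) t' (y : V t'),
  cV x = cV y -> existT V t x = existT V t' y.

Lemma code_term_inj t (u : term V t) t' (u' : term V t') :
  code_term u = code_term u' -> existT (term V) t u = existT (term V) t' u'.
Proof.
elim: u t' u' => [t0 x|t0 c|s t0 f If a Ia] t' [t1 x'|t1 c'|s' t1 f' a'] //=.
- by case=> /cV_inj e; have := projT1_eq e => /= e'; subst;
    rewrite (inj_pairT e).
- by case=> /code_const_inj e; have := projT1_eq e => /= e'; subst;
    rewrite (inj_pairT e).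
- case=> /If e /Ia e'; have := projT1_eq e => /= -[e1 e2]; subst.
  by rewrite (inj_pairT e) (inj_pairT e').
Qed.

Definition code_ext s t (x : ext V s t) : GenTree.tree nat :=
  match x with
  | new => GenTree.Leaf 0
  | old t y => GenTree.Node 0 [:: cV y]
  end.

Lemma code_ext_inj s t (x : ext V s t) t' (y : ext V s t') :
  code_ext x = code_ext y -> existT (ext V s) t x = existT (ext V s) t' y.
Proof.
case: x => [|t0 x]; case: y => [|t1 y] //= [/cV_inj e].
by have := projT1_eq e => /= e'; subst; rewrite (inj_pairT e).
Qed.
End CodeTerm.

Fixpoint code_form (V : ty -> Set) (cV : forall t, V t -> GenTree.tree nat) (A : form V) :
    GenTree.tree nat :=
  match A with
  | Bot => GenTree.Leaf 0
  | Eq a b => GenTree.Node 0 [:: code_term cV a; code_term cV b]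
  | Lt a b => GenTree.Node 1 [:: code_term cV a; code_term cV b]
  | And A B => GenTree.Node 2 [:: code_form cV A; code_form cV B]
  | Or A B => GenTree.Node 3 [:: code_form cV A; code_form cV B]
  | Imp A B => GenTree.Node 4 [:: code_form cV A; code_form cV B]
  | All s A => GenTree.Node 5 [:: code_ty s; code_form (@code_ext V cV s) A]
  | Ex s A => GenTree.Node 6 [:: code_ty s; code_form (@code_ext V cV s) A]
  end.

Lemma code_form_inj (V : ty -> Set) (cV : forall t, V t -> GenTree.tree nat) :
  (forall t (x : V t) t' (y : V t'), cV t x = cV t' y -> existT V t x = existT V t' y) ->
  injective (code_form cV).
Proof.
move=> cVi A; elim: A cV cVi => {V} V.
- by move=> cV _ [].
- move=> a b cV cVi [] //= a' b' [] /(code_term_inj cVi) e /(code_term_inj cVi) e'.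
  by rewrite (inj_pairT e) (inj_pairT e').
- move=> a b cV cVi [] //= a' b' [] /(code_term_inj cVi) e /(code_term_inj cVi) e'.
  by rewrite (inj_pairT e) (inj_pairT e').
- by move=> A IA B IB cV cVi [] //= A' B' [] /(IA _ cVi) -> /(IB _ cVi) ->.
- by move=> A IA B IB cV cVi [] //= A' B' [] /(IA _ cVi) -> /(IB _ cVi) ->.
- by move=> A IA B IB cV cVi [] //= A' B' [] /(IA _ cVi) -> /(IB _ cVi) ->.
- move=> s A IA cV cVi [] //= s' A' [] /code_ty_inj es; subst s'.
  by move/IA => -> // t x t' y; apply: code_ext_inj.
- move=> s A IA cV cVi [] //= s' A' [] /code_ty_inj es; subst s'.
  by move/IA => -> // t x t' y; apply: code_ext_inj.
Qed.

(** Variables of this countable context serve as Henkin witnesses. *)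
Definition hvar (t : ty) : Set := nat.

Lemma form_hvar_enum : exists e : nat -> form hvar, forall A, exists n, e n = A.
Proof.
pose cV (t : ty) (x : hvar t) := GenTree.Node 0 [:: code_ty t; GenTree.Leaf (x : nat)].
have cVi t (x : hvar t) t' (y : hvar t') :
    cV t x = cV t' y -> existT hvar t x = existT hvar t' y.
  by case=> /code_ty_inj <- ->.
have /= inj := code_form_inj cVi.
pose P n A := pickle (code_form cV A) = n.
(* Numbers that code no formula are sent to [Bot]. *)
exists (fun n => if pselect (exists A, P n A) is left h then projT1 (cid h) else Bot).
move=> A; exists (pickle (code_form cV A)).
case: pselect => [h|]; last by case; exists A.
case: (cid h) => B /= hB; apply: inj.
by apply: (pcan_inj (@pickleK (GenTree.tree nat))); rewrite hB.
Qed.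

(** * Finite support *)

Section Support.
Variables (V : ty -> Set) (idx : forall t, V t -> nat).
(** Finite support is expressed by insensitivity to changes of a renaming at indices from [k] on,
    which avoids computing lists of free variables under binders. *)
Definition agree_below W k (r r' : renaming V W) :=
  forall t (x : V t), idx x < k -> r t x = r' t x.
End Support.

Lemma agree_belowW (V : ty -> Set) (idx : forall t, V t -> nat) W k k'
    (r r' : renaming V W) :
  k <= k' -> agree_below idx k' r r' -> agree_below idx k r r'.
Proof. by move=> le h t x lx; apply: h; apply: leq_trans le. Qed.

Lemma term_support (V : ty -> Set) (idx : forall t, V t -> nat) t (u : term V t) :
  exists k, forall W (r r' : renaming V W), agree_below idx k r r' -> ren r u = ren r' u.
Proof.
elim: u => [t' x|t' c|s t' f [kf hf] a [ka ha]].
- by exists (idx t' x).+1 => W r r' /= h; rewrite h.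
- by exists 0.
- exists (maxn kf ka) => W r r' h /=.
  rewrite (hf _ r r') ?(ha _ r r') //.
    by apply: agree_belowW h; rewrite leq_maxr.
  by apply: agree_belowW h; rewrite leq_maxl.
Qed.

Definition idx_ext (V : ty -> Set) (idx : forall t, V t -> nat) s t (x : ext V s t) :=
  match x with new => 0 | old t y => idx t y end.

Lemma form_support (V : ty -> Set) (idx : forall t, V t -> nat) (A : form V) :
  exists k, forall W (r r' : renaming V W), agree_below idx k r r' -> renF r A = renF r' A.
Proof.
have up (V' : ty -> Set) (idx' : forall t, V' t -> nat) s W k (r r' : renaming V' W) :
  agree_below idx' k r r' ->
  agree_below (@idx_ext _ idx' s) k (@up_ren _ _ r s) (up_ren r').
  by move=> h t [//|t' y] /= ly; rewrite h.
elim: A idx => {V} V.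
- by exists 0.
- move=> a b idx; have [kf hf] := term_support idx a; have [ka ha] := term_support idx b.
  exists (maxn kf ka) => W r r' h /=.
  by rewrite (hf _ r r') ?(ha _ r r') //; apply: agree_belowW h; rewrite ?leq_maxr ?leq_maxl.
- move=> a b idx; have [kf hf] := term_support idx a; have [ka ha] := term_support idx b.
  exists (maxn kf ka) => W r r' h /=.
  by rewrite (hf _ r r') ?(ha _ r r') //; apply: agree_belowW h; rewrite ?leq_maxr ?leq_maxl.
- move=> A IA B IB idx; have [kf hf] := IA idx; have [ka ha] := IB idx.
  exists (maxn kf ka) => W r r' h /=.
  by rewrite (hf _ r r') ?(ha _ r r') //; apply: agree_belowW h; rewrite ?leq_maxr ?leq_maxl.
- move=> A IA B IB idx; have [kf hf] := IA idx; have [ka ha] := IB idx.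
  exists (maxn kf ka) => W r r' h /=.
  by rewrite (hf _ r r') ?(ha _ r r') //; apply: agree_belowW h; rewrite ?leq_maxr ?leq_maxl.
- move=> A IA B IB idx; have [kf hf] := IA idx; have [ka ha] := IB idx.
  exists (maxn kf ka) => W r r' h /=.
  by rewrite (hf _ r r') ?(ha _ r r') //; apply: agree_belowW h; rewrite ?leq_maxr ?leq_maxl.
- move=> s A IA idx; have [k hk] := IA (@idx_ext _ idx s).
  by exists k => W r r' h /=; rewrite (hk _ _ _ (up _ _ _ _ _ _ _ h)).
- move=> s A IA idx; have [k hk] := IA (@idx_ext _ idx s).
  by exists k => W r r' h /=; rewrite (hk _ _ _ (up _ _ _ _ _ _ _ h)).
Qed.

Definition hidx (t : ty) (x : hvar t) : nat := x.

Lemma forms_support (H : list (form hvar)) :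
  exists k, forall A, List.In A H -> forall W (r r' : renaming hvar W),
    agree_below hidx k r r' -> renF r A = renF r' A.
Proof.
elim: H => [|A H [k hk]]; first by exists 0.
have [k' hk'] := form_support hidx A.
exists (maxn k k') => B /= [<-|BH] W r r' h.
  by apply: hk'; apply: agree_belowW h; rewrite leq_maxr.
by apply: hk => //; apply: agree_belowW h; rewrite leq_maxl.
Qed.

(** * Henkin extensions *)

Section Henkin.
Variables (T : theory) (sT : stable T).
Arguments T : clear implicits.

Definition consistent (H : list (form hvar)) := ~ Prv T hvar H Bot.

Definition fresh_ren s (k : nat) : renaming hvar (ext hvar s) := fun t y =>
  match ty_eq_dec s t with
  | left e => if y == k :> nat then eq_rect s (ext hvar s) new t e else old y
  | right _ => old y
  end.

Lemma fresh_ren_old s k : agree_below hidx k (fresh_ren s k) (@old hvar s).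
Proof.
move=> t y ly; rewrite /fresh_ren; case: ty_eq_dec => // e.
by case: eqP => // ey; move: ly; rewrite /hidx ey ltnn.
Qed.

Lemma fresh_ren_new s (k : nat) : fresh_ren s k (k : hvar s) = new.
Proof.
rewrite /fresh_ren; case: ty_eq_dec => // e; rewrite eqxx.
by rewrite -(Eqdep_dec.eq_rect_eq_dec ty_eq_dec).
Qed.

(** Take a variable whose number exceeds the supports of [B] and of all of [H]. Renaming it to the
    bound variable with [fresh_ren] changes neither of them, so a contradiction from the instance
    becomes the premise of an existential elimination. *)
Lemma henkin_witness s (B : form (ext hvar s)) H :
  List.In (Ex s B) H -> consistent H ->
  exists x : hvar s, consistent (inst B (Var x) :: H).
Proof.
move=> HB cH.
have [k1 h1] := forms_support H.
have [k2 h2] := form_support (@idx_ext _ hidx s) B.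
exists (maxn k1 k2) => hk; apply: cH; set k := maxn k1 k2 in hk.
apply: PExE (PHyp _ _ _ _ HB) _.
have := Prv_sub sT hk (fun t x => Var (fresh_ren s k x)).
rewrite /= -renF_subV /inst subF_renF.
have -> : subF (fun t x => ren (fresh_ren s k) (scons (Var (k : hvar s)) (@Var hvar) t x)) B = B.
  rewrite -[RHS]subF_Var.
  pose r t (x : ext hvar s t) : ext hvar s t :=
    match x with new => new | old t y => fresh_ren s k y end.
  rewrite -[RHS](renF_subV (fun t x => x) B).
  rewrite -(h2 _ r); last first.
    move=> t [|t' y] // ly; rewrite /r; apply: (@fresh_ren_old s k).
    by apply: leq_trans ly _; rewrite leq_maxr.
  rewrite renF_subV; congr (subF _ B).
  apply: functional_extensionality_dep => t; apply: funext => -[|t' y] //=.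
  by rewrite fresh_ren_new.
have -> : List.map (subF (fun t x => Var (fresh_ren s k x))) H = List.map (renF (@old hvar s)) H.
  apply: List.map_ext_in => A HA; rewrite -renF_subV; apply: h1 => //.
  by apply: agree_belowW (@fresh_ren_old s k); rewrite leq_maxl.
by [].
Qed.

Definition henkin_for (A : form hvar) (H : list (form hvar)) :=
  match A with Ex s B => exists x, List.In (inst B (Var x)) H | _ => True end.

(** If [A] is refuted by the present stage, the stage is kept, and the negation of [A] is derivable
    from it; this makes the limit theory complete. *)
Lemma henkin_step (S : {H | consistent H}) A :
  exists S' : {H | consistent H}, List.incl (sval S) (sval S') /\
    (Prv T hvar (A :: sval S) Bot \/ List.In A (sval S') /\ henkin_for A (sval S')).
Proof.
have [i|c] := pselect (Prv T hvar (A :: sval S) Bot).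
  by exists S; split => //; left.
have inA : List.In A (A :: sval S) by left.
have base : (henkin_for A (A :: sval S)) -> exists S' : {H | consistent H},
    List.incl (sval S) (sval S') /\
    (Prv T hvar (A :: sval S) Bot \/ List.In A (sval S') /\ henkin_for A (sval S')).
  by move=> h; exists (exist consistent _ c); split; [move=> x; right|right].
case: A c inA base => [|a b|a b|A B|A B|A B|s A|s A] c inA base; try exact: base.
have [x cx] := henkin_witness inA c.
exists (exist consistent _ cx); split => /=; first by move=> y hy; right; right.
by right; split; [right; left|exists x; left].
Qed.

Variables (H0 : list (form hvar)) (cH0 : consistent H0).

Definition henkin_next S A := projT1 (cid (henkin_step S A)).
Definition enum_form := projT1 (cid form_hvar_enum).

Fixpoint chain n : {H | consistent H} :=
  match n with
  | 0 => exist consistent _ cH0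
  | n.+1 => henkin_next (chain n) (enum_form n)
  end.

(** Derivability at some stage, rather than membership in the union of the stages: closure under
    each rule is then inherited from the calculus, through [Gam1] and [Gam2]. *)
Definition Gam A := exists n, Prv T hvar (sval (chain n)) A.

Lemma chain_incl n m : n <= m -> List.incl (sval (chain n)) (sval (chain m)).
Proof.
move=> /subnK <-; elim: (m - n) => [|k IH] //= x /IH hx.
by rewrite /henkin_next; case: cid => S' /= [i _]; apply: i.
Qed.

Lemma Gam_step A : exists n, Prv T hvar (A :: sval (chain n)) Bot \/
   (List.In A (sval (chain n)) /\ henkin_for A (sval (chain n))).
Proof.
have [n en] : exists n, enum_form n = A.
  by rewrite /enum_form; case: cid => e he; apply: he.
have key : Prv T hvar (enum_form n :: sval (chain n)) Bot \/
    (List.In (enum_form n) (sval (chain n.+1)) /\ henkin_for (enum_form n) (sval (chain n.+1))).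
  exact: proj2 (projT2 (cid (henkin_step (chain n) (enum_form n)))).
rewrite en in key; case: key => h; first by exists n; left.
by exists n.+1; right.
Qed.

Lemma Gam1 A B : (forall H, Prv T hvar H A -> Prv T hvar H B) -> Gam A -> Gam B.
Proof. by move=> h [n p]; exists n; apply: h. Qed.

Lemma Gam2 A B C : (forall H, Prv T hvar H A -> Prv T hvar H B -> Prv T hvar H C) ->
  Gam A -> Gam B -> Gam C.
Proof.
move=> h [n p] [m q]; exists (maxn n m); apply: h.
  by apply: Prv_mono p; apply: chain_incl; rewrite leq_maxl.
by apply: Prv_mono q; apply: chain_incl; rewrite leq_maxr.
Qed.

Lemma Gam_ax A : T hvar A -> Gam A.
Proof. by move=> h; exists 0; apply: PAx. Qed.

Lemma Gam_H0 A : List.In A H0 -> Gam A.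
Proof. by move=> h; exists 0; apply: PHyp. Qed.

Lemma Gam_Bot : ~ Gam Bot.
Proof. by move=> [n]; case: (chain n). Qed.

Lemma Gam_mp A B : Gam (Imp A B) -> Gam A -> Gam B.
Proof. by apply: Gam2 => H; apply: PImpE. Qed.

Lemma Gam_Not A : Gam (Not A) <-> ~ Gam A.
Proof.
split=> [nA hA|nA]; first by apply: Gam_Bot; apply: Gam_mp nA hA.
have [n [h|[h _]]] := Gam_step A; first by exists n; apply: PImpI.
by case: nA; exists n; apply: PHyp.
Qed.

Lemma Gam_And A B : Gam (And A B) <-> Gam A /\ Gam B.
Proof.
split=> [h|[]]; last by apply: Gam2 => H; apply: PAndI.
by split; move: h; apply: Gam1 => H h; [apply: PAndE1 h|apply: PAndE2 h].
Qed.

Lemma Gam_Imp A B : Gam (Imp A B) <-> (Gam A -> Gam B).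
Proof.
split=> [|h]; first exact: Gam_mp.
have [hA|/Gam_Not hA] := pselect (Gam A).
  move: (h hA); apply: Gam1 => H hB; apply: PImpI; apply: Prv_mono hB => x; exact: or_intror.
move: hA; apply: Gam1 => H hA; apply: PImpI; apply: Prv_exfalso; apply: PImpE (_ : Prv _ _ _ A).
  by apply: Prv_mono hA => x; right.
by apply: PHyp; left.
Qed.

Lemma Gam_Or A B : Gam (Or A B) <-> Gam A \/ Gam B.
Proof.
split=> [h|[]]; last first.
- by apply: Gam1 => H; apply: POrI2.
- by apply: Gam1 => H; apply: POrI1.
have [hA|/Gam_Not hA] := pselect (Gam A); first by left.
right; move: h hA; apply: Gam2 => H hO hA.
apply: (POrE _ _ _ _ _ _ hO); last by apply: PHyp; left.
apply: Prv_exfalso; apply: PImpE (_ : Prv _ _ _ A).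
  by apply: Prv_mono hA => x; right.
by apply: PHyp; left.
Qed.

Lemma Gam_Ex s B : Gam (Ex s B) <-> exists u : term hvar s, Gam (inst B u).
Proof.
split=> [h|[u]]; last by apply: Gam1 => H; apply: PExI.
have [n [i|[_ [x hx]]]] := Gam_step (Ex s B).
  have : Gam (Not (Ex s B)) by exists n; apply: PImpI.
  by move=> /Gam_Not /(_ h).
by exists (Var x); exists n; apply: PHyp.
Qed.

Lemma Prv_Not_All V H s (A : form (ext V s)) :
  Prv T V H (Not (All s A)) -> Prv T V H (Ex s (Not A)).
Proof.
move=> h; apply: PBotC.
apply: PImpE (_ : Prv _ _ _ (All s A)).
  by apply: Prv_mono h => x; right.
apply: PAllI => /=; apply: PBotC.
apply: PImpE (_ : Prv _ _ _ (renF (@old V s) (Ex s (Not A)))).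
  by apply: PHyp; right; left.
have -> : renF (@old V s) (Ex s (Not A)) = Ex s (renF (up_ren (@old V s)) (Not A)) by [].
apply: (PExI _ _ _ _ _ (Var new)); rewrite /inst renF_subF.
have -> : (fun t x => scons (Var new) (@Var (ext V s)) t (up_ren (@old V s) t x)) = @Var (ext V s).
  by apply: functional_extensionality_dep => t; apply: funext => -[].
by rewrite subF_Var; apply: PHyp; left.
Qed.

Lemma Gam_All s B : Gam (All s B) <-> forall u : term hvar s, Gam (inst B u).
Proof.
split=> [h u|h]; first by move: h; apply: Gam1 => H; apply: PAllE.
apply: contrapT => /Gam_Not hn.
have /Gam_Ex [u hu] : Gam (Ex s (Not B)) by move: hn; apply: Gam1 => H; apply: Prv_Not_All.
by have /Gam_Not := hu; apply; apply: h.
Qed.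
End Henkin.

(** * Structures and satisfaction *)

Record structure := Structure {
  dom :> ty -> Set;
  app : forall s t, dom (s ⇒ t) -> dom s -> dom t;
  cst : forall t, const t -> dom t;
  nlt : dom N -> dom N -> Prop }.

Definition valuation (V : ty -> Set) (D : structure) := forall t, V t -> D t.

Definition vcons V (D : structure) (v : valuation V D) s (a : D s) :
    valuation (ext V s) D :=
  fun t x => match x in ext _ _ t return D s -> D t with
             | new => fun a => a
             | old t y => fun _ => v t y
             end a.

Fixpoint ev V (D : structure) (v : valuation V D) t (u : term V t) : D t :=
  match u with
  | Var t x => v t x
  | Cst t c => cst D c
  | App s t f a => app (ev v f) (ev v a)
  end.

Fixpoint sat V (D : structure) (v : valuation V D) (A : form V) : Prop :=
  match A with
  | Bot => False
  | Eq a b => ev v a = ev v b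
  | Lt a b => nlt (ev v a) (ev v b)
  | And A B => sat v A /\ sat v B
  | Or A B => sat v A \/ sat v B
  | Imp A B => sat v A -> sat v B
  | All s A => forall a : D s, sat (vcons v a) A
  | Ex s A => exists a : D s, sat (vcons v a) A
  end.

Definition models (D : structure) (T : theory) :=
  forall V (v : valuation V D) A, T V A -> sat v A.

Definition extensional (D : structure) :=
  forall s t (f g : D (s ⇒ t)), (forall a, app f a = app g a) -> f = g.

Definition novar (D : structure) : valuation empty D := fun t x => match x with end.

Section Quotient.
Variables (X : Set) (E : X -> X -> Prop).
Hypotheses (Er : forall x, E x x) (Es : forall x y, E x y -> E y x)
  (Et : forall x y z, E x y -> E y z -> E x z).

Definition choose_rep (P : X -> Prop) (h : exists x, P x) := projT1 (cid h).
Definition rep x := choose_rep (ex_intro (E x) x (Er x)).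

Lemma rep_rel x : E x (rep x).
Proof. by rewrite /rep /choose_rep; case: cid. Qed.

(** By extensionality [E x] and [E y] are the same predicate, and the choice depends on nothing but
    the predicate, the proofs of existence being irrelevant. *)
Lemma rep_eq x y : E x y -> rep x = rep y.
Proof.
move=> xy; rewrite /rep; have e : E x = E y.
  by apply: funext => z; apply: propext; split; apply: Et => //; apply: Es.
move: (ex_intro _ _ _) (ex_intro _ _ _); rewrite e => h h'.
by rewrite (Prop_irrelevance h h').
Qed.

Definition quot : Set := {x : X | rep x = x}.
Definition qpi (x : X) : quot := exist _ (rep x) (rep_eq (Es (rep_rel x))).

Lemma qpiP x y : qpi x = qpi y <-> E x y.
Proof.
split=> [[e]|xy].
  by apply: Et (rep_rel x) _; rewrite e; apply: Es; apply: rep_rel.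
have e := rep_eq xy; rewrite /qpi.
by move: (rep_eq _) (rep_eq _); rewrite e => h h'; rewrite (Prop_irrelevance h h').
Qed.

Lemma qpi_val (q : quot) : qpi (sval q) = q.
Proof.
case: q => x hx /=; rewrite /qpi; move: (rep_eq _); rewrite hx => h.
by rewrite (Prop_irrelevance h hx).
Qed.
End Quotient.

(** The model is the term structure of a Henkin theory, modulo provable
    extensional equality. *)
Section TermModel.
Variables (T : theory) (sT : stable T) (RT : forall V A, RCA0w V A -> @T V A).
Arguments T : clear implicits.
Variables (H0 : list (form hvar)) (cH0 : consistent T H0).
Let G := Gam sT cH0.

Definition teq t (u v : term hvar t) := G (EqT u v).

Lemma teq_app s t (f g : term hvar (s ⇒ t)) :
  teq f g <-> forall u, teq (f · u) (g · u).
Proof.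
rewrite /teq /= /allB; split=> [/Gam_All h u|h].
  by have := h u; rewrite inst_EqT_ext.
by apply/Gam_All => u; rewrite inst_EqT_ext; apply: h.
Qed.

Lemma teq_refl t (u : term hvar t) : teq u u.
Proof.
elim: t u => [|s _ t IH] u; last by apply/teq_app.
by apply: Gam_ax; apply/RT/semiring; constructor.
Qed.

Lemma teq_sym t (u v : term hvar t) : teq u v -> teq v u.
Proof.
elim: t u v => [|s _ t IH] u v; last by move=> /teq_app h; apply/teq_app => w; apply/IH.
by apply: Gam_mp; apply: Gam_ax; apply/RT/semiring; constructor.
Qed.

Lemma teq_trans t (u v w : term hvar t) : teq u v -> teq v w -> teq u w.
Proof.
elim: t u v w => [|s _ t IH] u v w; last first.
  by move=> /teq_app h /teq_app k; apply/teq_app => x; apply: IH (h x) (k x).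
move=> h; apply: Gam_mp; move: h.
by apply: Gam_mp; apply: Gam_ax; apply/RT/semiring; constructor.
Qed.

(** The function position is handled by the pointwise definition of [EqT], the argument position by
    the extensionality axiom. *)
Lemma teq_cong s t (f g : term hvar (s ⇒ t)) u v :
  teq f g -> teq u v -> teq (f · u) (g · v).
Proof.
move=> /teq_app fg uv; apply: teq_trans (fg v).
by move: uv; apply: Gam_mp; apply: Gam_ax; apply: RT; constructor.
Qed.

Definition tdom (t : ty) : Set := quot (@teq_refl t).
Definition tpi t (u : term hvar t) : tdom t := qpi (@teq_refl t) (@teq_sym t) (@teq_trans t) u.

Lemma tpiP t (u v : term hvar t) : tpi u = tpi v <-> teq u v.
Proof. exact: qpiP. Qed.

Lemma tpi_val t (q : tdom t) : tpi (sval q) = q.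
Proof. exact: qpi_val. Qed.

Definition term_structure : structure := @Structure tdom
  (fun s t f a => tpi (sval f · sval a)) (fun t c => tpi (Cst c))
  (fun a b => G (Lt (sval a) (sval b))).

Lemma ev_term V (p : substitution V hvar) t (u : term V t) :
  ev (fun t x => tpi (p t x) : term_structure t) u = tpi (sub p u).
Proof.
elim: u => //= s t' f -> a ->; apply/tpiP.
by apply: teq_cong; apply/tpiP; rewrite tpi_val.
Qed.

Lemma G_Lt_cong (a b a' b' : term hvar N) :
  teq a a' -> teq b b' -> G (Lt a b) -> G (Lt a' b').
Proof.
move=> ha hb hab; apply: Gam_mp hab; apply: Gam_mp hb; apply: Gam_mp ha.
by apply: Gam_ax; apply/RT/semiring; constructor.
Qed.

Lemma vcons_term V (p : substitution V hvar) s (u : term hvar s) :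
  vcons (fun t x => tpi (p t x) : term_structure t) (tpi u) =
  (fun t x => tpi (scons u p t x)).
Proof. by apply: functional_extensionality_dep => t; apply: funext => -[]. Qed.

Lemma truth V (A : form V) (p : substitution V hvar) :
  sat (fun t x => tpi (p t x) : term_structure t) A <-> G (subF p A).
Proof.
elim: A p => {V} V /=.
- by move=> p; split=> // /Gam_Bot.
- by move=> a b p; rewrite !ev_term; apply: tpiP.
- move=> a b p; rewrite !ev_term; split; apply: G_Lt_cong; apply/tpiP;
  by rewrite tpi_val.
- by move=> A IA B IB p; rewrite IA IB; symmetry; apply: Gam_And.
- by move=> A IA B IB p; rewrite IA IB; symmetry; apply: Gam_Or.
- by move=> A IA B IB p; rewrite IA IB; symmetry; apply: Gam_Imp.
- move=> s A IA p; split=> [h|/Gam_All h a].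
    by apply/Gam_All => u; rewrite inst_up; apply/IA; rewrite -vcons_term.
  by rewrite -(tpi_val a) vcons_term; apply/IA; rewrite -inst_up; apply: h.
- move=> s A IA p; split=> [[a]|/Gam_Ex [u]].
    rewrite -(tpi_val a) vcons_term => /IA; rewrite -inst_up => h.
    by apply/Gam_Ex; exists (sval a).
  by rewrite inst_up => /IA; rewrite -vcons_term => h; exists (tpi u).
Qed.

Lemma term_structure_models : models term_structure T.
Proof.
move=> V v A TA.
have -> : v = fun t x => tpi (sval (v t x)).
  by apply: functional_extensionality_dep => t; apply: funext => x; rewrite tpi_val.
by apply/(truth A (fun t x => sval (v t x))); apply: Gam_ax; apply: sT.
Qed.

Lemma term_structure_ext : extensional term_structure.
Proof.
move=> s t f g h; rewrite -(tpi_val f) -(tpi_val g); apply/tpiP/teq_app => u.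
have /= /tpiP e := h (tpi u).
have uu : teq u (sval (tpi u)) by apply/tpiP; rewrite tpi_val.
apply: teq_trans (teq_cong (teq_refl _) uu) _; apply: teq_trans e _.
by apply: teq_cong (teq_refl _) (teq_sym uu).
Qed.

Lemma term_structure_H0 V (p : substitution V hvar) A :
  List.In (subF p A) H0 -> sat (fun t x => tpi (p t x) : term_structure t) A.
Proof. by move=> h; apply/truth; apply: Gam_H0. Qed.
End TermModel.

Fixpoint closed_term (t : ty) : term empty t :=
  match t with
  | N => Cst Zero
  | s ⇒ t => Cst (Pi t s) · closed_term t
  end.

Theorem completeness T (A : form empty) : stable T -> (forall V A, RCA0w V A -> T V A) ->
  (forall D, extensional D -> models D T -> sat (novar D) A) -> proves T A.
Proof.
move=> sT RT h.
pose p : substitution empty hvar := fun t x => match x with end.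
apply: PBotC.
pose H0 := [:: Not (subF p A)]%SEQ.
have [i|cH0] := pselect (Prv T hvar H0 Bot).
  (* Every type has a closed term, so the witnesses can be eliminated. *)
  have := Prv_sub sT i (fun t _ => closed_term t).
  rewrite /H0 /= subF_subF.
  have -> // : subF (fun t x => sub (fun t _ => closed_term t) (p t x)) A = A.
  rewrite -[RHS]subF_Var; congr (subF _ A).
  by apply: functional_extensionality_dep => t; apply: funext => -[].
have := term_structure_H0 sT RT cH0 (p := p) (A := Not A).
have -> : (fun t x => tpi sT RT cH0 (p t x)) = novar (term_structure sT RT cH0).
  by apply: functional_extensionality_dep => t; apply: funext => -[].
case; first by left.
by apply: h; [apply: term_structure_ext|apply: term_structure_models].
Qed.

(** * Stability of the axioms *)

Lemma semiring_ax_sub V W (p : substitution V W) A : semiring_ax A -> semiring_ax (subF p A).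
Proof. by case=> *; constructor. Qed.

Lemma qf_sub V W (p : substitution V W) A : qf A -> qf (subF p A).
Proof. by elim: A W p => //= {V} V A IA B IB W p [/IA hA /IB hB]. Qed.

Lemma RCA0w_stable : stable RCA0w.
Proof.
move=> V W p A; case=> {A}.
- by move=> A /semiring_ax_sub h; apply: semiring.
- by move=> s t x y; rewrite sub_EqT; constructor.
- by move=> r s t x y z; rewrite sub_EqT; constructor.
- by move=> f m; constructor.
- by move=> f m n; apply: Rec_S_ax.
- by move=> s t f x y; rewrite /= !sub_EqT; constructor.
- move=> A qA /=.
  have := @qf_ind_ax W _ (qf_sub (up_sub p) qA); rewrite /= sub_inst /= /allB.
  rewrite !subF_subF.
  have <- : (fun t x => sub (scons (Var new ⊕ 𝟏) (fun t v => Var (old v))) (up_sub p t x)) =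
       (fun t x => sub (up_sub p) (scons (Var (@new V N) ⊕ 𝟏) (fun t v => Var (old v)) t x)).
    apply: functional_extensionality_dep => t; apply: funext => -[//|t' y] /=.
    by rewrite sub_ren ren_subV.
  by [].
- move=> A qA /=.
  have := @qf_ac_ax W _ (qf_sub (up_sub (up_sub p)) qA); rewrite /= /allB /exB.
  rewrite /= !subF_subF.
  set q1 := (fun t x => _); set q2 := (fun t x => _).
  have -> // : q1 = q2.
  apply: functional_extensionality_dep => t; apply: funext => -[//|t' [//|t'' y]] /=.
  by rewrite /q1 /q2 /= !sub_ren !ren_subV !sub_sub /=.
Qed.

Lemma ACA0w_stable : stable ACA0w.
Proof.
by move=> V W p A [B /(RCA0w_stable p) h|]; [apply: ACA0w_RCA0w|apply: ACA0w_mu].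
Qed.

Lemma proves_ACA0w (A : form empty) :
  (forall D, extensional D -> models D ACA0w -> sat (novar D) A) -> proves ACA0w A.
Proof. exact: completeness ACA0w_stable (@ACA0w_RCA0w). Qed.

(** * Evaluation *)

Lemma ev_ren V W D (v : valuation W D) (r : renaming V W) t (u : term V t) :
  ev v (ren r u) = ev (fun t x => v t (r t x)) u.
Proof. by elim: u => //= s t' f -> a ->. Qed.

Lemma ev_sub V W D (v : valuation W D) (p : substitution V W) t (u : term V t) :
  ev v (sub p u) = ev (fun t x => ev v (p t x)) u.
Proof. by elim: u => //= s t' f -> a ->. Qed.

Lemma vcons_up V W D (v : valuation W D) (p : substitution V W) s (a : D s) :
  (fun t x => ev (vcons v a) (up_sub p t x)) = vcons (fun t x => ev v (p t x)) a.
Proof.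
apply: functional_extensionality_dep => t; apply: funext => -[//|t' y] /=.
by rewrite ev_ren.
Qed.

Lemma sat_sub V W D (v : valuation W D) (p : substitution V W) A :
  sat v (subF p A) <-> sat (fun t x => ev v (p t x)) A.
Proof.
elim: A W v p => {V} V //=.
- by move=> a b W v p; rewrite !ev_sub.
- by move=> a b W v p; rewrite !ev_sub.
- by move=> A IA B IB W v p; rewrite IA IB.
- by move=> A IA B IB W v p; rewrite IA IB.
- by move=> A IA B IB W v p; rewrite IA IB.
- move=> s A IA W v p; split=> h a.
    by have /IA := h a; rewrite vcons_up.
  by apply/IA; rewrite vcons_up.
- move=> s A IA W v p; split=> -[a h]; exists a.
    by move: h => /IA; rewrite vcons_up.
  by apply/IA; rewrite vcons_up.
Qed.

Lemma sat_ren V W D (v : valuation W D) (r : renaming V W) A :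
  sat v (renF r A) <-> sat (fun t x => v t (r t x)) A.
Proof. by rewrite renF_subV sat_sub. Qed.

Lemma ev_strengthen V D (v : valuation V D) s (a : D s) t (u : term (ext V s) t) u' :
  strengthen u = Some u' -> ev (vcons v a) u = ev v u'.
Proof.
elim: u u' => [t0 x|t0 c|s0 t0 f IHf b IHb] /=.
- by case: x => [|t1 y] u' //= [<-].
- by move=> u' [<-].
- move=> u'; case: (strengthen f) IHf => // f' /(_ _ erefl) ->.
  by case: (strengthen b) IHb => // b' /(_ _ erefl) -> [<-].
Qed.

(** * Models of the axioms: combinators, induction and [mu] *)

Record model := Model {
  mstr :> structure;
  m_ext : extensional mstr;
  m_ax : models mstr ACA0w }.

Section Combinators.
Variable M : model.

Lemma sat_EqT V (v : valuation V M) t (a b : term V t) :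
  sat v (EqT a b) <-> ev v a = ev v b.
Proof.
elim: t V v a b => [|s _ t IH] V v a b //=; split=> [h|e z].
  by apply: m_ext => z; have /IH /= := h z; rewrite !ev_ren.
by apply/IH; rewrite /= !ev_ren /=; congr (app _ _).
Qed.

(** The model itself is taken as a context in which each element is a variable denoting itself.
    Axioms can thus be instantiated at elements, and definitions can use them as parameters. *)
Definition idv : valuation M M := fun t x => x.

Lemma m_rca V (v : valuation V M) A : RCA0w V A -> sat v A.
Proof. by move=> h; apply: m_ax; apply: ACA0w_RCA0w. Qed.

Lemma ev_lam V (v : valuation V M) s t (u : term (ext V s) t) a :
  app (ev v (lam u)) a = ev (vcons v a) u.
Proof.
have hPi s' t' (x : M s') (y : M t') : app (app (cst M (Pi s' t')) x) y = x.
  by have /sat_EqT := m_rca idv (@Pi_ax M s' t' (Var x) (Var y)).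
have hSigma r s' t' x y z : app (app (app (cst M (Sigma r s' t')) x) y) z = app (app x z) (app y z).
  by have /sat_EqT := m_rca idv (@Sigma_ax M r s' t' (Var x) (Var y) (Var z)).
elim: u => [t0 x|t0 c|s0 t0 f IHf b IHb] /=; last 1 first.
- case Ef: (strengthen f) => [f'|] /=; last by rewrite hSigma IHf IHb.
  case Eb: (strengthen b) => [b'|] /=; last by rewrite hSigma IHf IHb.
  by rewrite hPi (ev_strengthen _ _ Ef) (ev_strengthen _ _ Eb).
- by case: x => [|t1 y] /=; rewrite ?hSigma hPi.
- by rewrite hPi.
Qed.

Lemma qf_induction V (v : valuation V M) (A : form (ext V N)) : qf A ->
  sat (vcons v (cst M Zero)) A ->
  (forall n, sat (vcons v n) A -> sat (vcons v (app (app (cst M Plus) n) (cst M One))) A) ->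
  forall n, sat (vcons v n) A.
Proof.
move=> qA h0 hS; have /= h := m_rca v (qf_ind_ax V A qA); apply: h; split.
  apply/sat_sub; move: h0.
  have -> // : vcons v (cst M Zero) = (fun t x => ev v (scons 𝟎 (@Var V) t x)).
  by apply: functional_extensionality_dep => t; apply: funext => -[].
move=> n h; apply/sat_sub; move: (hS n h).
set v1 := vcons _ _; set v2 := (fun t x => _).
have -> // : v1 = v2.
by apply: functional_extensionality_dep => t; apply: funext => -[].
Qed.

Lemma mu_exists : exists mu : M (R ⇒ N), forall f : M R,
  ((exists n, app f n = cst M Zero) -> app f (app mu f) = cst M Zero /\
     forall i, nlt i (app mu f) -> app f i <> cst M Zero).
Proof.
have [mu h] := m_ax idv (ACA0w_mu M).
exists mu => f hf; have [h1 _] := h f.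
by have [] := h1 hf.
Qed.

Definition nn : Set := M N.
End Combinators.

HB.instance Definition _ (M : model) := gen_eqMixin (nn M).
HB.instance Definition _ (M : model) := gen_choiceMixin (nn M).

(** * The ordered semiring of numbers of a model *)

Section Arithmetic.
Variable M : model.
Notation nn := (nn M).
Implicit Types a b c n m : nn.

Definition n_zero : nn := cst M Zero.
Definition n_one : nn := cst M One.
Definition nadd a b : nn := app (app (cst M Plus) a) b.
Definition nmul a b : nn := app (app (cst M Times) a) b.

Let sax A : @semiring_ax M A -> sat (@idv M) A.
Proof. by move=> h; apply: m_rca; apply: semiring. Qed.

Lemma naddA : associative nadd.
Proof. by move=> a b c; exact: sax (add_assoc_ax (Var (a : M N)) (Var (b : M N)) (Var (c : M N))). Qed.
Lemma naddC : commutative nadd.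
Proof. by move=> a b; exact: sax (add_comm_ax (Var (a : M N)) (Var (b : M N))). Qed.
Lemma nadd0 : left_id n_zero nadd.
Proof. by move=> a; rewrite naddC; exact: sax (add_0_ax (Var (a : M N))). Qed.
Lemma nmulA : associative nmul.
Proof. by move=> a b c; exact: sax (mul_assoc_ax (Var (a : M N)) (Var (b : M N)) (Var (c : M N))). Qed.
Lemma nmulC : commutative nmul.
Proof. by move=> a b; exact: sax (mul_comm_ax (Var (a : M N)) (Var (b : M N))). Qed.
Lemma nmul1 : left_id n_one nmul.
Proof. by move=> a; rewrite nmulC; exact: sax (mul_1_ax (Var (a : M N))). Qed.
Lemma nmul0 : left_zero n_zero nmul.
Proof. by move=> a; rewrite nmulC; exact: sax (mul_0_ax (Var (a : M N))). Qed.
Lemma nmulDl : left_distributive nmul nadd.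
Proof.
move=> a b c; rewrite nmulC [nmul a c]nmulC [nmul b c]nmulC.
exact: sax (distr_ax (Var (c : M N)) (Var (a : M N)) (Var (b : M N))).
Qed.
Lemma nltxx a : ~ nlt a a.
Proof. exact: sax (lt_irrefl_ax (Var (a : M N))). Qed.
Lemma n1_neq0 : n_one != n_zero.
Proof. by apply/eqP => e; have /= := sax lt_0_1_ax; rewrite -/n_one e => /nltxx. Qed.

HB.instance Definition _ := GRing.isNmodule.Build nn naddA naddC nadd0.
HB.instance Definition _ := GRing.Nmodule_isComNzSemiRing.Build nn nmulA nmulC nmul1 nmulDl nmul0 n1_neq0.
End Arithmetic.

Section Recursors.
Variable M : model.
Notation nn := (nn M).
Implicit Types a b c n m : nn.
Local Open Scope ring_scope.

Definition nltn (a b : nn) : Prop := @nlt M a b.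
Local Notation "a <| b" := (nltn a b) (at level 70).

Let sax A : @semiring_ax M A -> sat (@idv M) A.
Proof. by move=> h; apply: m_rca; apply: semiring. Qed.

Lemma nlt_trans a b c : a <| b -> b <| c -> a <| c.
Proof. exact: sax (lt_trans_ax (Var (a : M N)) (Var (b : M N)) (Var (c : M N))). Qed.
Lemma nlt_total a b : a <| b \/ a = b \/ b <| a.
Proof. exact: sax (lt_total_ax (Var (a : M N)) (Var (b : M N))). Qed.
Lemma nlt01 : 0 <| 1.
Proof. exact: sax lt_0_1_ax. Qed.
Lemma nlt_add a b c : a <| b -> a + c <| b + c.
Proof. exact: sax (lt_add_ax (Var (a : M N)) (Var (b : M N)) (Var (c : M N))). Qed.
Lemma nlt_mul a b c : 0 <| c -> a <| b -> a * c <| b * c.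
Proof. exact: sax (lt_mul_ax (Var (a : M N)) (Var (b : M N)) (Var (c : M N))). Qed.

(** Cancellation is not among the axioms; it comes from trichotomy and strict monotonicity. *)
Lemma naddI a b c : a + c = b + c -> a = b.
Proof.
move=> e; have [h|[//|h]] := nlt_total a b;
by have := nlt_add c h; rewrite e => /nltxx.
Qed.

Definition ncode (n : nn) : term M N := Var (n : M N).

Lemma nlt0S n : 0 <| n + 1.
Proof.
apply: (@qf_induction M M (@idv M) (Lt 𝟎 (Var new ⊕ 𝟏)) I).
  by have : 0 <| 0 + 1 by rewrite add0r; exact: nlt01.
move=> k h; suff : 0 <| (k : nn) + 1 + 1 by [].
by apply: nlt_trans h _; have := nlt_add ((k : nn) + 1) nlt01; rewrite add0r [1 + _]addrC.
Qed.

Lemma nmulI a b c : a * (c + 1) = b * (c + 1) -> a = b.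
Proof.
move=> e; have [h|[//|h]] := nlt_total a b;
by have := nlt_mul (nlt0S c) h; rewrite e => /nltxx.
Qed.

Lemma rec0 (f : M (N ⇒ N ⇒ N)) m : app (app (app (cst M Rec) f) m) (0 : nn) = m.
Proof. exact: (m_rca (@idv M) (Rec_0_ax _ (Var f) (Var (m : M N)))). Qed.

Lemma recS (f : M (N ⇒ N ⇒ N)) m n :
  app (app (app (cst M Rec) f) m) (n + 1) =
  app (app f n) (app (app (app (cst M Rec) f) m) n).
Proof. exact: (m_rca (@idv M) (Rec_S_ax _ (Var f) (Var (m : M N)) (Var (n : M N)))). Qed.

Lemma ev_lambda V (v : valuation V M) s t (u : term (ext V s) s -> term (ext V s) t) (a : M s) :
  app (ev v (lambda s u)) a = ev (vcons v a) (u (Var new)).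
Proof. exact: ev_lam. Qed.

Definition predM (n : nn) : nn := ev (@idv M) (npred (ncode n)).
Definition monusM (m n : nn) : nn := ev (@idv M) (monus (ncode m) (ncode n)).
Definition pow2m1M (n : nn) : nn := ev (@idv M) (pow2m1 (ncode n)).
Definition isqrtM (n : nn) : nn := ev (@idv M) (isqrt (ncode n)).

#[local] Opaque lambda.

Lemma predM0 : predM 0 = 0.
Proof. by rewrite /predM /npred /= (rec0 _ (0 : nn)). Qed.
Lemma predMS n : predM (n + 1) = n.
Proof. by rewrite /predM /npred /= (recS _ (0 : nn)) !ev_lambda. Qed.
Lemma monusM0 m : monusM m 0 = m.
Proof. by rewrite /monusM /monus /= rec0. Qed.
Lemma monusMS m n : monusM m (n + 1) = predM (monusM m n).
Proof. by rewrite /monusM /monus /= recS !ev_lambda. Qed.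
Lemma pow2m1M0 : pow2m1M 0 = 0.
Proof. by rewrite /pow2m1M /pow2m1 /= (rec0 _ (0 : nn)). Qed.
Lemma pow2m1MS n : pow2m1M (n + 1) = pow2m1M n + pow2m1M n + 1.
Proof. by rewrite /pow2m1M /pow2m1 /= (recS _ (0 : nn)) !ev_lambda. Qed.
Lemma isqrtM0 : isqrtM 0 = 0.
Proof. by rewrite /isqrtM /isqrt /= (rec0 _ (0 : nn)). Qed.
Lemma isqrtMS n : isqrtM (n + 1) =
  isqrtM n + monusM 1 (monusM ((isqrtM n + 1) * (isqrtM n + 1)) (n + 1)).
Proof. by rewrite /isqrtM /isqrt /= (recS _ (0 : nn)) !ev_lambda. Qed.

(** Naming the predecessor by the term [npred] makes the statement quantifier-free, as the induction
    available at this point demands. In [nle_sub], the term [monus] does the same for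
    differences. *)
Lemma n_case n : n = 0 \/ exists m, n = m + 1.
Proof.
suff : n = 0 \/ n = predM n + 1 by move=> [|h]; [left|right; exists (predM n)].
apply: (@qf_induction M M (@idv M)
  (Or (Eq (Var new) 𝟎) (Eq (Var new) (npred (Var new) ⊕ 𝟏))) (conj I I)); first by left.
by move=> k _; right; suff : (k : nn) + 1 = predM ((k : nn) + 1) + 1 by []; rewrite predMS.
Qed.

Lemma nltSn n : n <| n + 1.
Proof. by have := nlt_add n nlt01; rewrite add0r addrC. Qed.

Lemma nle_sub n m : ~ m <| n -> n + monusM m n = m.
Proof.
move: n; apply: (@qf_induction M M (@idv M)
  (Imp (Not (Lt (ren weaken (ncode m)) (Var new)))
       (Eq (Var new ⊕ monus (ren weaken (ncode m)) (Var new)) (ren weaken (ncode m))))).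
- by [].
- by move=> _; suff : 0 + monusM m 0 = m by []; rewrite add0r monusM0.
move=> k h h1; suff : (k : nn) + 1 + monusM m ((k : nn) + 1) = m by [].
have mk : ~ m <| k by move=> mk; apply: h1; apply: nlt_trans mk (nltSn k).
have {}h : (k : nn) + monusM m k = m by apply: h.
rewrite monusMS -addrA; have [e|[j e]] := n_case (monusM m k).
  by case: h1; suff : m <| (k : nn) + 1 by []; rewrite -{1}h e addr0; apply: nltSn.
by rewrite e predMS [1 + j]addrC -e.
Qed.

Lemma nltW a b : a <| b -> ~ b <| a.
Proof. by move=> ab ba; apply: nltxx (nlt_trans ab ba). Qed.

Lemma nlt_ex a b : a <| b -> exists c, b = a + c + 1.
Proof.
move=> ab; have := nle_sub (nltW ab).
have [->|[c ->]] := n_case (monusM b a); first by rewrite addr0 => e; move: ab; rewrite e => /nltxx.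
by move=> <-; exists c; rewrite addrA.
Qed.

Lemma nlt_addl a c : a <| a + c + 1.
Proof. by have := nlt_add a (nlt0S c); rewrite add0r [_ + a]addrC addrA. Qed.
End Recursors.

(** * The ordered field of rationals of a model *)

Section Rationals.
Variable M : model.
Notation nn := (nn M).
Local Open Scope ring_scope.
Local Notation "a <| b" := (nltn a b) (at level 70).

(** [(p, m, d)] stands for [(p - m) / (d + 1)]. *)
Definition frac : Set := (nn * nn * nn)%type.
Implicit Types x y z : frac.

Definition frac_eq x y :=
  x.1.1 * (y.2 + 1) + y.1.2 * (x.2 + 1) = y.1.1 * (x.2 + 1) + x.1.2 * (y.2 + 1).

Lemma frac_refl x : frac_eq x x. Proof. by []. Qed.
Lemma frac_sym x y : frac_eq x y -> frac_eq y x. Proof. by []. Qed.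
Lemma frac_trans x y z : frac_eq x y -> frac_eq y z -> frac_eq x z.
Proof.
(* The denominator of [y] is a successor and can be cancelled; the numerators of [y], added on both
   sides, make up for the missing subtraction. *)
rewrite /frac_eq => e1 e2; apply: (@nmulI M _ _ y.2).
apply: (@naddI M _ _ ((y.1.1 + y.1.2) * (x.2 + 1) * (z.2 + 1))).
transitivity ((x.1.1 * (y.2 + 1) + y.1.2 * (x.2 + 1)) * (z.2 + 1)
  + (y.1.1 * (z.2 + 1) + z.1.2 * (y.2 + 1)) * (x.2 + 1)); first by ring.
by rewrite e1 e2; ring.
Qed.

Definition mrat : Set := quot frac_refl.
Definition fq x : mrat := qpi frac_refl frac_sym frac_trans x.
Lemma fqP x y : fq x = fq y <-> frac_eq x y. Proof. exact: qpiP. Qed.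
Lemma fq_val (a : mrat) : fq (sval a) = a. Proof. exact: qpi_val. Qed.
Lemma fq_rep x : frac_eq x (sval (fq x)). Proof. by apply/fqP; rewrite fq_val. Qed.

(** The last component is [(x.2 + 1) * (y.2 + 1) - 1], written without subtraction, as denominators
    are stored minus one. *)
Definition frac_add x y : frac :=
  (x.1.1 * (y.2 + 1) + y.1.1 * (x.2 + 1), x.1.2 * (y.2 + 1) + y.1.2 * (x.2 + 1),
   x.2 * y.2 + x.2 + y.2).
Definition frac_mul x y : frac :=
  (x.1.1 * y.1.1 + x.1.2 * y.1.2, x.1.1 * y.1.2 + x.1.2 * y.1.1, x.2 * y.2 + x.2 + y.2).
Definition frac_opp x : frac := (x.1.2, x.1.1, x.2).

Definition mrat_add (a b : mrat) := fq (frac_add (sval a) (sval b)).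
Definition mrat_mul (a b : mrat) := fq (frac_mul (sval a) (sval b)).
Definition mrat_opp (a : mrat) := fq (frac_opp (sval a)).

Lemma frac_addC x y : frac_add x y = frac_add y x.
Proof. by rewrite /frac_add; congr (_, _, _); ring. Qed.
Lemma frac_mulC x y : frac_mul x y = frac_mul y x.
Proof. by rewrite /frac_mul; congr (_, _, _); ring. Qed.

Lemma frac_addl x x' y : frac_eq x x' -> frac_eq (frac_add x y) (frac_add x' y).
Proof.
rewrite /frac_eq /= => e.
transitivity ((x.1.1 * (x'.2 + 1) + x'.1.2 * (x.2 + 1)) * (y.2 + 1) * (y.2 + 1)
  + (y.1.1 + y.1.2) * (x.2 + 1) * (x'.2 + 1) * (y.2 + 1)); first by ring.
by rewrite e; ring.
Qed.

Lemma frac_mull x x' y : frac_eq x x' -> frac_eq (frac_mul x y) (frac_mul x' y).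
Proof.
rewrite /frac_eq /= => e.
transitivity ((x.1.1 * (x'.2 + 1) + x'.1.2 * (x.2 + 1)) * y.1.1 * (y.2 + 1)
  + (x'.1.1 * (x.2 + 1) + x.1.2 * (x'.2 + 1)) * y.1.2 * (y.2 + 1)); first by ring.
transitivity ((x'.1.1 * (x.2 + 1) + x.1.2 * (x'.2 + 1)) * y.1.1 * (y.2 + 1)
  + (x.1.1 * (x'.2 + 1) + x'.1.2 * (x.2 + 1)) * y.1.2 * (y.2 + 1)); last by ring.
by rewrite e.
Qed.

Lemma fqD x y : fq (frac_add x y) = mrat_add (fq x) (fq y).
Proof.
apply/fqP; apply: frac_trans (frac_addl _ (fq_rep x)) _.
by rewrite ![frac_add (sval (fq x)) _]frac_addC; apply: frac_addl; apply: fq_rep.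
Qed.

Lemma fqM x y : fq (frac_mul x y) = mrat_mul (fq x) (fq y).
Proof.
apply/fqP; apply: frac_trans (frac_mull _ (fq_rep x)) _.
by rewrite ![frac_mul (sval (fq x)) _]frac_mulC; apply: frac_mull; apply: fq_rep.
Qed.

Lemma fqN x : fq (frac_opp x) = mrat_opp (fq x).
Proof.
apply/fqP; have := fq_rep x; rewrite /frac_eq /= => e.
by rewrite addrC -e addrC.
Qed.

Lemma mrat_ind (P : mrat -> Prop) : (forall x, P (fq x)) -> forall a, P a.
Proof. by move=> h a; rewrite -(fq_val a). Qed.

Definition mrat0 := fq (0, 0, 0).
Definition mrat1 := fq (1, 0, 0).

Lemma mrat_addA : associative mrat_add.
Proof.
elim/mrat_ind => x; elim/mrat_ind => y; elim/mrat_ind => z; rewrite -!fqD.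
by apply/fqP; rewrite /frac_eq /=; ring.
Qed.
Lemma mrat_addC : commutative mrat_add.
Proof. by move=> a b; rewrite /mrat_add frac_addC. Qed.
Lemma mrat_add0 : left_id mrat0 mrat_add.
Proof. by elim/mrat_ind => x; rewrite -!fqD; apply/fqP; rewrite /frac_eq /=; ring. Qed.
Lemma mrat_addN : left_inverse mrat0 mrat_opp mrat_add.
Proof. by elim/mrat_ind => x; rewrite -fqN -!fqD; apply/fqP; rewrite /frac_eq /=; ring. Qed.
Lemma mrat_mulA : associative mrat_mul.
Proof.
elim/mrat_ind => x; elim/mrat_ind => y; elim/mrat_ind => z; rewrite -!fqM.
by apply/fqP; rewrite /frac_eq /=; ring.
Qed.
Lemma mrat_mulC : commutative mrat_mul.
Proof. by move=> a b; rewrite /mrat_mul frac_mulC. Qed.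
Lemma mrat_mul1 : left_id mrat1 mrat_mul.
Proof. by elim/mrat_ind => x; rewrite -!fqM; apply/fqP; rewrite /frac_eq /=; ring. Qed.
Lemma mrat_mulD : left_distributive mrat_mul mrat_add.
Proof.
elim/mrat_ind => x; elim/mrat_ind => y; elim/mrat_ind => z; rewrite -fqD -!fqM -fqD.
by apply/fqP; rewrite /frac_eq /=; ring.
Qed.

Lemma n_neq01 : (0 : nn) <> 1.
Proof. by move/esym/eqP; rewrite (negbTE (n1_neq0 M)). Qed.
Lemma mrat1_neq_mrat0 : mrat1 <> mrat0.
Proof.
by move=> /fqP; rewrite /frac_eq /= !(mul0r, add0r, addr0, mulr1) => /esym /n_neq01.
Qed.

HB.instance Definition _ := gen_eqMixin mrat.
HB.instance Definition _ := gen_choiceMixin mrat.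
HB.instance Definition _ := GRing.isZmodule.Build mrat mrat_addA mrat_addC mrat_add0 mrat_addN.
Lemma mrat_1_neq0 : mrat1 != 0 :> mrat.
Proof. exact/eqP/mrat1_neq_mrat0. Qed.
HB.instance Definition _ := GRing.Zmodule_isComNzRing.Build mrat
  mrat_mulA mrat_mulC mrat_mul1 mrat_mulD mrat_1_neq0.

Definition frac_ge0 x := ~ x.1.1 <| x.1.2.

Lemma nlt_mulS (a b c : nn) : a * (c + 1) <| b * (c + 1) <-> a <| b.
Proof.
split=> [h|]; last exact: nlt_mul (nlt0S c).
have [//|[e|/(nlt_mul (nlt0S c))]] := nlt_total a b; last by move/nltW.
by move: h; rewrite e => /nltxx.
Qed.

Lemma nlt_addr (a b c : nn) : a + c <| b + c <-> a <| b.
Proof.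
split=> [h|]; last exact: nlt_add.
have [//|[e|/(nlt_add c)]] := nlt_total a b; last by move/nltW.
by move: h; rewrite e => /nltxx.
Qed.

Lemma frac_ge0_eq x y : frac_eq x y -> frac_ge0 x -> frac_ge0 y.
Proof.
rewrite /frac_eq => e h /(nlt_mulS _ _ x.2) h'; apply: h.
apply/(nlt_mulS _ _ y.2)/(nlt_addr _ _ (y.1.2 * (x.2 + 1))); rewrite e.
by rewrite [X in _ <| X]addrC; apply: nlt_add.
Qed.

Definition mrat_ge0 (a : mrat) := frac_ge0 (sval a).
Lemma fq_ge0 x : mrat_ge0 (fq x) <-> frac_ge0 x.
Proof. by split; apply: frac_ge0_eq; [apply: frac_sym|]; apply: fq_rep. Qed.

Lemma nle_ex (a b : nn) : ~ b <| a <-> exists c, b = a + c.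
Proof.
split=> [h|[c ->]]; first by exists (monusM b a); rewrite nle_sub.
have [->|[k ->]] := n_case c; first by rewrite addr0; apply: nltxx.
by rewrite addrA; apply: nltW; apply: nlt_addl.
Qed.

(** Fractions without negative part are visibly closed under sums and products, which gives the
    order axioms. *)
Lemma mrat_ge0_nat (a : mrat) : mrat_ge0 a <-> exists n d : nn, a = fq (n, 0, d).
Proof.
split; last first.
  by move=> [n [d ->]]; apply/fq_ge0/nle_ex; exists n; rewrite add0r.
elim/mrat_ind: a => x /fq_ge0/nle_ex[c hc]; exists c, x.2; apply/fqP.
by rewrite /frac_eq /= hc; ring.
Qed.

Lemma fq_add_nat (n d n' d' : nn) :
  fq (n, 0, d) + fq (n', 0, d') = fq (n * (d' + 1) + n' * (d + 1), 0, d * d' + d + d') :> mrat.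
Proof. by rewrite -[LHS]fqD /frac_add /= !mul0r addr0. Qed.

Lemma mrat_ge0D (a b : mrat) : mrat_ge0 a -> mrat_ge0 b -> mrat_ge0 (a + b).
Proof.
move=> /mrat_ge0_nat[n [d ->]] /mrat_ge0_nat[n' [d' ->]]; rewrite fq_add_nat.
by apply/mrat_ge0_nat; do 2 eexists.
Qed.

Lemma mrat_ge0M (a b : mrat) : mrat_ge0 a -> mrat_ge0 b -> mrat_ge0 (a * b).
Proof.
move=> /mrat_ge0_nat[n [d ->]] /mrat_ge0_nat[n' [d' ->]]; rewrite -[_ * _]fqM.
by apply/mrat_ge0_nat; rewrite /frac_mul /= !mul0r !mulr0 !addr0; do 2 eexists.
Qed.

Lemma mrat_ge0_anti (a : mrat) : mrat_ge0 a -> mrat_ge0 (- a) -> a = 0.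
Proof.
elim/mrat_ind: a => x /fq_ge0 h; rewrite -[- _]fqN => /fq_ge0 h'.
have [//|[e|//]] := nlt_total x.1.1 x.1.2.
by apply/fqP; rewrite /frac_eq /= e; ring.
Qed.

Lemma mrat_ge0_total (a : mrat) : mrat_ge0 a \/ mrat_ge0 (- a).
Proof.
elim/mrat_ind: a => x; rewrite -[- _]fqN !fq_ge0.
have [|h] := pselect (x.1.1 <| x.1.2); last by left.
by move=> /nltW; right.
Qed.

Lemma mrat_inv_ex (a : mrat) : exists b : mrat, (a != 0 -> b * a = 1) /\ (a = 0 -> b = 0).
Proof.
have [->|a0] := pselect (a = 0); first by exists 0; split => //; rewrite eqxx.
have pos (c : mrat) : c <> 0 -> mrat_ge0 c -> exists b : mrat, b * c = 1.
  move=> c0 /mrat_ge0_nat[n [d ec]]; have [n0|[k ek]] := n_case n.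
    by case: c0; rewrite ec n0; apply/fqP; rewrite /frac_eq /=; ring.
  exists (fq (d + 1, 0, k)); rewrite ec ek -[LHS]fqM; apply/fqP.
  by rewrite /frac_eq /=; ring.
have [/(pos _ a0)[b hb]|/pos[|b hb]] := mrat_ge0_total a.
- by exists b; split.
- by move/(congr1 -%R); rewrite opprK oppr0.
- by exists (- b); split => // _; rewrite mulNr -mulrN.
Qed.

Definition mrat_inv (a : mrat) : mrat := projT1 (cid (mrat_inv_ex a)).

Lemma mrat_mulV (a : mrat) : a != 0 -> mrat_inv a * a = 1.
Proof. exact: (projT2 (cid (mrat_inv_ex a))).1. Qed.
Lemma mrat_inv0 : mrat_inv 0 = 0.
Proof. exact: (projT2 (cid (mrat_inv_ex 0))).2. Qed.

HB.instance Definition _ := GRing.ComNzRing_isField.Build mrat mrat_mulV mrat_inv0.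

Definition mrat_le (a b : mrat) : bool := `[< mrat_ge0 (b - a) >].
Definition mrat_lt (a b : mrat) : bool := (b != a) && mrat_le a b.
Definition mrat_norm (a : mrat) : mrat := if mrat_le 0 a then a else - a.

Lemma mrat_le0 (a : mrat) : mrat_le 0 a <-> mrat_ge0 a.
Proof. by rewrite /mrat_le subr0; split => /asboolP. Qed.
Lemma mrat_le_0 (a : mrat) : mrat_le a 0 <-> mrat_ge0 (- a).
Proof. by rewrite /mrat_le sub0r; split => /asboolP. Qed.

Lemma mrat_le0D (a b : mrat) : mrat_le 0 a -> mrat_le 0 b -> mrat_le 0 (a + b).
Proof. by move=> /mrat_le0 h /mrat_le0 h'; apply/mrat_le0/mrat_ge0D. Qed.
Lemma mrat_le0M (a b : mrat) : mrat_le 0 a -> mrat_le 0 b -> mrat_le 0 (a * b).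
Proof. by move=> /mrat_le0 h /mrat_le0 h'; apply/mrat_le0/mrat_ge0M. Qed.
Lemma mrat_le_anti (a : mrat) : mrat_le 0 a -> mrat_le a 0 -> a = 0.
Proof. by move=> /mrat_le0 h /mrat_le_0 h'; apply: mrat_ge0_anti. Qed.
Lemma mrat_sub_ge0 (a b : mrat) : mrat_le 0 (b - a) = mrat_le a b.
Proof. by rewrite /mrat_le subr0. Qed.
Lemma mrat_le_total (a : mrat) : mrat_le 0 a || mrat_le a 0.
Proof.
by apply/orP; have [h|h] := mrat_ge0_total a; [left; apply/mrat_le0|right; apply/mrat_le_0].
Qed.
Lemma mrat_normN (a : mrat) : mrat_norm (- a) = mrat_norm a.
Proof.
rewrite /mrat_norm opprK; case: ifPn; case: ifPn => //.
  by move=> /mrat_le0 h /mrat_le0 h'; rewrite (mrat_ge0_anti h h') oppr0.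
move=> h h'; have := mrat_le_total a; rewrite (negbTE h) /= => /mrat_le_0/mrat_le0.
by rewrite (negbTE h').
Qed.
Lemma mrat_ge0_norm (a : mrat) : mrat_le 0 a -> mrat_norm a = a.
Proof. by rewrite /mrat_norm => ->. Qed.
Lemma mrat_lt_def (a b : mrat) : mrat_lt a b = (b != a) && mrat_le a b.
Proof. by []. Qed.

(** From here on [lra] and [nra] apply to the rationals of an arbitrary, possibly nonstandard,
    model; the estimates below rely on them. *)
HB.instance Definition _ := Num.IntegralDomain_isLeReal.Build mrat
  mrat_le0D mrat_le0M mrat_le_anti mrat_sub_ge0 mrat_le_total mrat_normN mrat_ge0_norm mrat_lt_def.

End Rationals.

(** * Codes of rationals *)
#[local] Opaque lambda.

Section Codes.
Variable M : model.
Notation nn := (nn M).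
Notation mrat := (mrat M).
Local Open Scope ring_scope.
Local Notation "a <| b" := (nltn a b) (at level 70).
Implicit Types (a b c n m k : nn) (q r : mrat).

Lemma fq_le (x y : frac M) : (fq x <= fq y) <->
  ~ y.1.1 * (x.2 + 1) + x.1.2 * (y.2 + 1) <| y.1.2 * (x.2 + 1) + x.1.1 * (y.2 + 1).
Proof.
rewrite -[_ <= _]/(mrat_le (fq x) (fq y)) /mrat_le -[- _]fqN -[_ + _]fqD.
by split=> [/asboolP/fq_ge0|h]; [|apply/asboolP/fq_ge0].
Qed.

Lemma fq_lt (x y : frac M) : (fq x < fq y) <->
  x.1.1 * (y.2 + 1) + y.1.2 * (x.2 + 1) <| y.1.1 * (x.2 + 1) + x.1.2 * (y.2 + 1).
Proof.
rewrite ltNge; split=> [/negP h|h].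
  by apply: contrapT => h'; apply: h; apply/fq_le; rewrite [X in _ <| X]addrC addrC [X in _ <| X]addrC.
by apply/negP => /fq_le; apply; rewrite [X in _ <| X]addrC.
Qed.

(** The embedding through which inequalities between numbers are proved, since subtraction and
    linear arithmetic are available in [mrat]. *)
Definition nq n : mrat := fq (n, 0, 0).

Lemma nq0 : nq 0 = 0. Proof. by []. Qed.
Lemma nq1 : nq 1 = 1. Proof. by []. Qed.
Lemma nqD a b : nq (a + b) = nq a + nq b.
Proof. by rewrite /nq -[RHS]fqD; apply/fqP; rewrite /frac_eq /=; ring. Qed.
Lemma nqM a b : nq (a * b) = nq a * nq b.
Proof. by rewrite /nq -[RHS]fqM; apply/fqP; rewrite /frac_eq /=; ring. Qed.
Lemma nq_lt a b : nq a < nq b <-> a <| b.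
Proof. by rewrite fq_lt /= !add0r !mulr1 !addr0. Qed.
Lemma nq_le a b : nq a <= nq b <-> ~ b <| a.
Proof. by rewrite leNgt; split => [/negP h /nq_lt|h]; [|apply/negP => /nq_lt]. Qed.
Lemma nq_inj a b : nq a = nq b -> a = b.
Proof. by move/fqP; rewrite /frac_eq /= !add0r !mulr1 !addr0. Qed.
Lemma nq_ge0 a : 0 <= nq a.
Proof. by apply/nq_le/nle_ex; exists a; rewrite add0r. Qed.
Lemma nq_ltS a b : nq a < nq b -> nq a + 1 <= nq b.
Proof. by move=> /nq_lt/nlt_ex[c ->]; rewrite !nqD nq1; have := nq_ge0 c; lra. Qed.
Lemma nq_leS a b : nq a < nq b + 1 -> nq a <= nq b.
Proof. by rewrite leNgt => h; apply/negP => /nq_ltS; move: h; lra. Qed.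

Lemma fq_addE (x y : frac M) : fq x + fq y = fq (frac_add x y).
Proof. by rewrite fqD. Qed.
Lemma fq_mulE (x y : frac M) : fq x * fq y = fq (frac_mul x y).
Proof. by rewrite fqM. Qed.
Lemma fq_oppE (x : frac M) : - fq x = fq (frac_opp x).
Proof. by rewrite fqN. Qed.

Lemma fqE (x : frac M) : fq x = (nq x.1.1 - nq x.1.2) / (nq x.2 + 1).
Proof.
have h : nq x.2 + 1 != 0 by apply: lt0r_neq0; have := nq_ge0 x.2; lra.
apply: (mulIf h); rewrite divfK // -nq1 /nq !(fq_oppE, fq_addE, fq_mulE).
by apply/fqP; rewrite /frac_eq /=; ring.
Qed.

Lemma mrat_archi q : exists n, q < nq n.
Proof.
elim/mrat_ind: q => x; exists (x.1.1 + 1); rewrite fqE nqD nq1.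
have h0 := nq_ge0 x.1.1; have h1 := nq_ge0 x.1.2; have h2 := nq_ge0 x.2.
rewrite ltr_pdivrMr; nra.
Qed.

Lemma monus_self n : monusM n n = 0.
Proof.
by apply: (@naddI M _ _ n); rewrite add0r addrC; apply: nle_sub; apply: nltxx.
Qed.

Lemma nq_monus m n : nq n <= nq m -> nq (monusM m n) = nq m - nq n.
Proof. by move=> /nq_le/nle_sub {2}<-; rewrite nqD; lra. Qed.

Lemma monus_eq0 m n : nq m <= nq n -> monusM m n = 0.
Proof.
move=> /nq_le/nle_ex[k ->]; move: k.
apply: (@qf_induction M M (@idv M)
  (Eq (monus (ren weaken (ncode m)) (ren weaken (ncode m) ⊕ Var new)) 𝟎) I).
  by suff : monusM m (m + 0) = 0 by []; rewrite addr0 monus_self.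
move=> k h; suff : monusM m (m + ((k : nn) + 1)) = 0 by [].
by rewrite addrA monusMS; have -> : monusM m (m + k) = 0 by []; rewrite predM0.
Qed.

Lemma isqrt_spec n :
  nq (isqrtM n) ^+ 2 <= nq n /\ nq n < (nq (isqrtM n) + 1) ^+ 2.
Proof.
suff : nq (isqrtM n * isqrtM n) <= nq n /\ nq n < nq ((isqrtM n + 1) * (isqrtM n + 1)).
  by rewrite !nqM nqD nq1 !expr2.
rewrite nq_le nq_lt.
move: n; apply: (@qf_induction M M (@idv M)
  (And (Not (Lt (Var new) (isqrt (Var new) ⊗ isqrt (Var new))))
    (Lt (Var new) ((isqrt (Var new) ⊕ 𝟏) ⊗ (isqrt (Var new) ⊕ 𝟏))))) => //.
  suff : let z : nn := 0 in ~ z <| isqrtM z * isqrtM z /\ z <| (isqrtM z + 1) * (isqrtM z + 1) by [].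
  by rewrite /= isqrtM0 mulr0 add0r mulr1; split; [apply: nltxx|apply: nlt01].
move=> n0; pose n : nn := n0.
suff : ~ n <| isqrtM n * isqrtM n /\ n <| (isqrtM n + 1) * (isqrtM n + 1) ->
  ~ n + 1 <| isqrtM (n + 1) * isqrtM (n + 1) /\
    n + 1 <| (isqrtM (n + 1) + 1) * (isqrtM (n + 1) + 1) by [].
rewrite -!nq_le -!nq_lt isqrtMS; set r := isqrtM n => -[h1 h2].
(* The two truncated differences compute the increment: if [(r + 1) ^ 2 <= n + 1], the inner one is
   0 and the outer one 1; otherwise the inner one is at least 1 and the outer one 0. *)
have [h|h] := leP (nq ((r + 1) * (r + 1))) (nq (n + 1)).
  rewrite (monus_eq0 h) monusM0; split => //.
  have := nq_ltS h2; have := nq_ge0 r.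
  by rewrite !nqM !nqD nq1; set x := nq r; set y := nq n => *; nra.
have /nq_lt/nlt_ex[k ek] : nq 0 < nq (monusM ((r + 1) * (r + 1)) (n + 1)).
  by rewrite nq_monus ?nq0 ?subr_gt0 //; apply: ltW.
rewrite ek add0r monus_eq0 ?addr0; last first.
  by rewrite nqD nq1; have := nq_ge0 k; lra.
by split => //; move: h1; rewrite nqD nq1; lra.
Qed.

Lemma isqrt_uniq n k : nq k ^+ 2 <= nq n -> nq n < (nq k + 1) ^+ 2 -> isqrtM n = k.
Proof.
have [h1 h2] := isqrt_spec n; set s := isqrtM n in h1 h2 *.
have s0 := nq_ge0 s; have r0 := nq_ge0 k => h3 h4; apply: nq_inj; apply: le_anti.
by apply/andP; split; apply: nq_leS; rewrite ltNge; apply/negP => h;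
  nra.
Qed.

Definition pfstM c : nn := monusM c (isqrtM c * isqrtM c).
Definition psndM c : nn := monusM (isqrtM c) (pfstM c).

Section Ev.
Variables (V : ty -> Set) (v : valuation V M).
Implicit Types u w : term V N.

Definition evn u : nn := ev v u.

Lemma evn_add u w : evn (u ⊕ w) = evn u + evn w. Proof. by []. Qed.
Lemma evn_mul u w : evn (u ⊗ w) = evn u * evn w. Proof. by []. Qed.
Lemma evn_monus u w : evn (monus u w) = monusM (evn u) (evn w). Proof. by []. Qed.
End Ev.

Lemma ev_pfst V (v : valuation V M) u : evn v (pfst u) = pfstM (evn v u).
Proof. by rewrite /pfst /evn /= ev_lambda. Qed.
Lemma ev_psnd V (v : valuation V M) u : evn v (psnd u) = psndM (evn v u).
Proof.
by rewrite /psnd /evn /= ev_lambda; exact: (congr1 (monusM _) (ev_pfst _ _)).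
Qed.
Lemma ev_npair V (v : valuation V M) u w :
  evn v (npair u w) = (evn v u + evn v w) * (evn v u + evn v w) + evn v u.
Proof. by rewrite /npair /evn [LHS]/= !ev_lambda. Qed.

(** As [a <= 2 * (a + b)], the code stays below the next square [(a + b + 1) ^ 2]; so the root
    recovers [a + b] and the remainder [a]. *)
Lemma isqrt_pair a b : isqrtM ((a + b) * (a + b) + a) = a + b.
Proof.
have ha := nq_ge0 a; have hb := nq_ge0 b.
by apply: isqrt_uniq; rewrite !nqD nqM nqD; nra.
Qed.
Lemma pfst_pair a b : pfstM ((a + b) * (a + b) + a) = a.
Proof.
have ha := nq_ge0 a; have hb := nq_ge0 b.
by apply: nq_inj; rewrite /pfstM isqrt_pair nq_monus; rewrite ?nqD; lra.
Qed.
Lemma psnd_pair a b : psndM ((a + b) * (a + b) + a) = b.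
Proof.
have ha := nq_ge0 a; have hb := nq_ge0 b.
by apply: nq_inj; rewrite /psndM pfst_pair isqrt_pair nq_monus; rewrite ?nqD; lra.
Qed.

Definition cfrac c : frac M := (pfstM (pfstM c), psndM (pfstM c), psndM c).
Definition qv (c : M N) : mrat := fq (cfrac c).

Lemma ev_rat V (v : valuation V M) (p m d : term V N) :
  cfrac (ev v (rat p m d)) = (evn v p, evn v m, evn v d).
Proof.
rewrite /rat -[ev v _]/(evn v _) ev_npair.
by rewrite /cfrac !psnd_pair !pfst_pair ev_npair psnd_pair pfst_pair.
Qed.

Lemma qv_surj q : exists c, qv c = q.
Proof.
elim/mrat_ind: q => -[[p m] d].
by exists (ev (@idv M) (rat (ncode p) (ncode m) (ncode d))); rewrite /qv ev_rat.
Qed.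

Lemma qv_rat V (v : valuation V M) (p m d : term V N) :
  qv (ev v (rat p m d)) = (nq (evn v p) - nq (evn v m)) / (nq (evn v d) + 1).
Proof. by rewrite /qv ev_rat fqE. Qed.

Lemma qv_qopp V (v : valuation V M) u : qv (ev v (qopp u)) = - qv (ev v u).
Proof.
rewrite /qopp /= ev_lambda /qv ev_rat -[RHS]fqN; congr fq.
by rewrite /qneg /qpos !ev_psnd !ev_pfst.
Qed.

Lemma qv_qadd V (v : valuation V M) u w :
  qv (ev v (qadd u w)) = qv (ev v u) + qv (ev v w).
Proof.
rewrite /qadd /= !ev_lambda /qv ev_rat -[RHS]fqD; congr fq.
rewrite /qneg /qpos /qden !(evn_add, evn_mul, ev_psnd, ev_pfst, ev_ren) /=.
rewrite /frac_add /cfrac /=; congr (_, _, _).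
set v' := vcons _ _; rewrite evn_monus -[evn v' 𝟏]/(1 : nn).
rewrite -[X in monusM _ X]add0r monusMS monusM0.
rewrite !(evn_add, evn_mul, ev_psnd) -[evn v' 𝟏]/(1 : nn) /=.
rewrite -[evn v' (Var (weaken N new))]/(ev v u : nn) -[evn v' (Var new)]/(ev v w : nn).
set x := psndM _; set y := psndM _.
have -> : (x + 1) * (y + 1) = x * y + x + y + 1 by ring.
by rewrite predMS.
Qed.

Lemma qv_qsub V (v : valuation V M) u w :
  qv (ev v (qsub u w)) = qv (ev v u) - qv (ev v w).
Proof. by rewrite /qsub qv_qadd qv_qopp. Qed.

Lemma qv_qnat V (v : valuation V M) u : qv (ev v (qnat u)) = nq (evn v u).
Proof.
by rewrite /qnat qv_rat -[evn v 𝟎]/(0 : nn) nq0 subr0 add0r divr1.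
Qed.

Lemma sat_qlt V (v : valuation V M) u w :
  sat v (qlt u w) <-> qv (ev v u) < qv (ev v w).
Proof.
rewrite fq_lt /cfrac /qlt [X in X <-> _]/(evn v _ <| evn v _).
by rewrite /qden /qpos /qneg !(evn_add, evn_mul, ev_psnd, ev_pfst).
Qed.

Lemma sat_qle V (v : valuation V M) u w :
  sat v (qle u w) <-> qv (ev v u) <= qv (ev v w).
Proof.
rewrite leNgt -[sat _ _]/(~ sat v (qlt w u)) sat_qlt.
by split=> [h|/negP]; [apply/negP|].
Qed.

(** [2 ^ - n]; note that [pow2m1M n] is [2 ^ n - 1]. *)
Definition p2 n : mrat := (nq (pow2m1M n) + 1)^-1.

Lemma p2_gt0 n : 0 < p2 n.
Proof. by rewrite invr_gt0; have := nq_ge0 (pow2m1M n); lra. Qed.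
Lemma p2_0 : p2 0 = 1.
Proof. by rewrite /p2 pow2m1M0 nq0 add0r invr1. Qed.
Lemma p2S n : p2 (n + 1) = p2 n / 2.
Proof.
rewrite /p2 pow2m1MS !nqD nq1; have := nq_ge0 (pow2m1M n); move: (nq _) => x x0.
by field; apply/andP; split; apply: lt0r_neq0; lra.
Qed.
Lemma nq_pow2m1 n : nq (pow2m1M n) = (p2 n)^-1 - 1.
Proof. by rewrite /p2 invrK addrK. Qed.

Lemma qv_qpow V (v : valuation V M) u : qv (ev v (qpow u)) = p2 (evn v u).
Proof.
by rewrite /qpow qv_rat -[evn v 𝟏]/(1 : nn) -[evn v 𝟎]/(0 : nn) nq1 nq0 subr0 mul1r.
Qed.
Lemma qv_qpow1 V (v : valuation V M) u : qv (ev v (qpow1 u)) = 2 * p2 (evn v u).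
Proof.
by rewrite /qpow1 qv_rat evn_add -[evn v 𝟏]/(1 : nn) -[evn v 𝟎]/(0 : nn) nqD nq1 nq0 subr0.
Qed.
End Codes.

(** * Definable functions and predicates *)

Section Definability.
Variable M : model.
Notation nn := (nn M).
Notation mrat := (mrat M).
Local Open Scope ring_scope.
Local Notation "a <| b" := (nltn a b) (at level 70).

(** The base context is the model, so that definable means definable with parameters of any type. *)
Fixpoint ctx (G : seq ty) : ty -> Set :=
  match G with [::] => dom M | s :: G => ext (ctx G) s end.
Fixpoint env (G : seq ty) : Set :=
  match G with [::] => unit | s :: G => (env G * M s)%type end.
Fixpoint valu (G : seq ty) : env G -> valuation (ctx G) M :=
  match G with
  | [::] => fun _ => @idv M
  | s :: G => fun e => vcons (valu e.1) e.2
  end.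

Definition DefT G t (F : env G -> M t) :=
  exists u : term (ctx G) t, forall e, ev (valu e) u = F e.
Definition DefN G (F : env G -> nn) := DefT (F : env G -> M N).
Definition DefQ G (F : env G -> mrat) :=
  exists2 f : env G -> M N, DefT f & forall e, qv (f e) = F e.

(** With [mu], number quantifiers are decided by terms, so every arithmetical
    predicate is the set of zeros of a term. *)
Definition DefP G (P : env G -> Prop) :=
  exists2 f : env G -> nn, DefN f & forall e, P e <-> f e = 0.

Lemma DefT_const G t (c : M t) : DefT (fun _ : env G => c).
Proof.
elim: G => [|s G [u hu]]; first by exists (Var c).
by exists (ren (@old _ _) u) => e; rewrite ev_ren /=; apply: hu.
Qed.

Lemma DefT_new G s : DefT (fun e : env (s :: G) => e.2).
Proof. by exists (Var new). Qed.
Lemma DefT_old1 G s t : DefT (fun e : env [:: s, t & G]%SEQ => e.1.2).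
Proof. by exists (Var (old new)). Qed.
Lemma DefT_old2 G s t r : DefT (fun e : env [:: s, t, r & G]%SEQ => e.1.1.2).
Proof. by exists (Var (old (old new))). Qed.
Lemma DefT_old3 G s t r q : DefT (fun e : env [:: s, t, r, q & G]%SEQ => e.1.1.1.2).
Proof. by exists (Var (old (old (old new)))). Qed.

Lemma DefT_app G s t (F : env G -> M (s ⇒ t)) (A : env G -> M s) :
  DefT F -> DefT A -> DefT (fun e => app (F e) (A e)).
Proof. by move=> [u hu] [w hw]; exists (u · w) => e /=; rewrite hu hw. Qed.

Lemma DefT_lam G s t (F : env (s :: G) -> M t) : DefT F ->
  exists2 f : env G -> M (s ⇒ t), DefT f & forall e a, app (f e) a = F (e, a).
Proof.
move=> [u hu]; exists (fun e => ev (valu e) (lam u)); first by exists (lam u).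
by move=> e a; rewrite ev_lam -hu.
Qed.

Lemma DefT_ext G t (F F' : env G -> M t) : (forall e, F e = F' e) -> DefT F -> DefT F'.
Proof. by move=> h; rewrite (_ : F = F') //; apply: funext. Qed.

Lemma DefN_const G (c : nn) : DefN (fun _ : env G => c).
Proof. exact: DefT_const. Qed.
Lemma DefN_add G (F F' : env G -> nn) : DefN F -> DefN F' -> DefN (fun e => F e + F' e).
Proof. by move=> [u hu] [w hw]; exists (u ⊕ w) => e /=; rewrite hu hw. Qed.
Lemma DefN_mul G (F F' : env G -> nn) : DefN F -> DefN F' -> DefN (fun e => F e * F' e).
Proof. by move=> [u hu] [w hw]; exists (u ⊗ w) => e /=; rewrite hu hw. Qed.
Lemma DefN_monus G (F F' : env G -> nn) :
  DefN F -> DefN F' -> DefN (fun e => monusM (F e) (F' e)).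
Proof. by move=> [u hu] [w hw]; exists (monus u w) => e; rewrite -[LHS]/(monusM (ev _ u) (ev _ w)) hu hw. Qed.

Lemma monus11 : monusM 1 1 = 0 :> nn. Proof. exact: monus_self. Qed.
Lemma monus1_neq0 (a : nn) : a <> 0 -> monusM 1 a = 0.
Proof.
have [//|[k ->] _] := n_case a.
by apply: monus_eq0; rewrite nqD; have := nq_ge0 k; lra.
Qed.
Lemma n_1_neq0 : (1 : nn) <> 0.
Proof. by move/esym; exact: n_neq01. Qed.

Lemma DefP_ext G (P P' : env G -> Prop) : (forall e, P e <-> P' e) -> DefP P -> DefP P'.
Proof. by move=> h [f df hf]; exists f => // e; rewrite -h. Qed.

Lemma DefP_not G (P : env G -> Prop) : DefP P -> DefP (fun e => ~ P e).
Proof.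
move=> [f df hf]; exists (fun e => monusM 1 (f e)).
  by apply: DefN_monus => //; apply: DefN_const.
move=> e; rewrite hf; split; first exact: monus1_neq0.
by move=> h h0; move: h; rewrite h0 monusM0 => /n_1_neq0.
Qed.

Lemma nadd_eq0 (a b : nn) : a + b = 0 <-> a = 0 /\ b = 0.
Proof.
split=> [h|[-> ->]]; last by rewrite addr0.
have /(congr1 (@nq M)) := h; rewrite nqD nq0 => e.
by have := nq_ge0 a; have := nq_ge0 b; split; apply: nq_inj; rewrite nq0; lra.
Qed.

Lemma DefP_and G (P P' : env G -> Prop) : DefP P -> DefP P' -> DefP (fun e => P e /\ P' e).
Proof.
move=> [f df hf] [f' df' hf']; exists (fun e => f e + f' e); first exact: DefN_add.
by move=> e; rewrite nadd_eq0 hf hf'.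
Qed.

Lemma DefP_or G (P P' : env G -> Prop) : DefP P -> DefP P' -> DefP (fun e => P e \/ P' e).
Proof.
move=> hP hP'; apply: (DefP_ext _ (DefP_not (DefP_and (DefP_not hP) (DefP_not hP')))) => e.
by have [] := pselect (P e); have [] := pselect (P' e); tauto.
Qed.

Lemma DefP_imp G (P P' : env G -> Prop) : DefP P -> DefP P' -> DefP (fun e => P e -> P' e).
Proof.
move=> hP hP'; apply: (DefP_ext _ (DefP_or (DefP_not hP) hP')) => e.
by have [] := pselect (P e); tauto.
Qed.

Lemma DefP_iff G (P P' : env G -> Prop) : DefP P -> DefP P' -> DefP (fun e => P e <-> P' e).
Proof. by move=> hP hP'; apply: DefP_and; apply: DefP_imp. Qed.

(** With [g e] vanishing exactly where [P e] holds, a witness exists iff [g e] vanishes at the value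
    of [mu]. A number quantifier thus costs one application of [mu]. *)
Lemma DefP_ex G (P : env G -> nn -> Prop) :
  DefP (fun e : env (N :: G) => P e.1 e.2) -> DefP (fun e => exists k, P e k).
Proof.
move=> [f /DefT_lam[g dg hg] hf]; have [mu hmu] := mu_exists M.
exists (fun e => app (g e) (app mu (g e))).
  by apply: DefT_app => //; apply: DefT_app => //; apply: DefT_const.
move=> e; split=> [[k hk]|h].
  have [|-> //] := hmu (g e); exists k; rewrite hg.
  by apply/hf.
by exists (app mu (g e)); apply/(hf (e, _)); rewrite -hg.
Qed.

Lemma DefP_all G (P : env G -> nn -> Prop) :
  DefP (fun e : env (N :: G) => P e.1 e.2) -> DefP (fun e => forall k, P e k).
Proof.
move=> /DefP_not hP.
apply: (DefP_ext _ (DefP_not (DefP_ex (P := fun e k => ~ P e k) hP))) => e.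
split=> [h k|h [k]]; last by apply; apply: h.
by apply: contrapT => hk; apply: h; exists k.
Qed.

Lemma DefP_const G (P : Prop) : DefP (fun _ : env G => P).
Proof.
have [h|h] := pselect P.
  by exists (fun _ => 0); [apply: DefN_const|].
by exists (fun _ => 1); [apply: DefN_const|split=> // /n_1_neq0].
Qed.

Lemma DefP_ltn G (F F' : env G -> nn) : DefN F -> DefN F' -> DefP (fun e => F e <| F' e).
Proof.
move=> h h'; exists (fun e => monusM (F e + 1) (F' e)).
  by apply: DefN_monus => //; apply: DefN_add => //; apply: DefN_const.
move=> e; rewrite -nq_lt; split=> [/nq_ltS l|e0].
  by apply: monus_eq0; rewrite nqD nq1.
rewrite ltNge; apply/negP => l; have l' : nq (F' e) <= nq (F e + 1).
  by rewrite nqD nq1; move: l; lra.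
have /(congr1 (@nq M)) := e0; rewrite (nq_monus l') nqD nq1 nq0; move: l; lra.
Qed.

Lemma DefP_eqn G (F F' : env G -> nn) : DefN F -> DefN F' -> DefP (fun e => F e = F' e).
Proof.
move=> h h'; apply: (DefP_ext _ (DefP_and (DefP_not (DefP_ltn h h')) (DefP_not (DefP_ltn h' h)))) => e.
split=> [[n1 n2]|->]; last by split; apply: nltxx.
by have [|[]] := nlt_total (F e) (F' e).
Qed.

Lemma DefP_qlt G (F F' : env G -> mrat) : DefQ F -> DefQ F' -> DefP (fun e => F e < F' e).
Proof.
move=> [f [u hu] hf] [f' [w hw] hf'].
pose t1 : term (ctx G) N := qpos u ⊗ qden w ⊕ qneg w ⊗ qden u.
pose t2 : term (ctx G) N := qpos w ⊗ qden u ⊕ qneg u ⊗ qden w.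
have h1 : DefN (fun e => evn (valu e) t1) by exists t1.
have h2 : DefN (fun e => evn (valu e) t2) by exists t2.
apply: (DefP_ext _ (DefP_ltn h1 h2)) => e.
by rewrite -hf -hf' -hu -hw -sat_qlt.
Qed.

Lemma DefP_qle G (F F' : env G -> mrat) : DefQ F -> DefQ F' -> DefP (fun e => F e <= F' e).
Proof.
move=> h h'; apply: (DefP_ext _ (DefP_not (DefP_qlt h' h))) => e.
by rewrite leNgt; split=> /negP.
Qed.

Lemma DefP_qeq G (F F' : env G -> mrat) : DefQ F -> DefQ F' -> DefP (fun e => F e = F' e).
Proof.
move=> h h'; apply: (DefP_ext _ (DefP_and (DefP_qle h h') (DefP_qle h' h))) => e.
by split=> [[a b]|->//]; apply: le_anti; rewrite a b.
Qed.

Lemma DefQ_const G (c : mrat) : DefQ (fun _ : env G => c).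
Proof. by have [k hk] := qv_surj c; exists (fun _ => k) => //; apply: DefT_const. Qed.
Lemma DefQ_qv G (F : env G -> M N) : DefT F -> DefQ (fun e => qv (F e)).
Proof. by move=> h; exists F. Qed.
Lemma DefQ_nq G (F : env G -> nn) : DefN F -> DefQ (fun e => nq (F e)).
Proof.
move=> [u hu]; exists (fun e => ev (valu e) (qnat u)); first by exists (qnat u).
by move=> e; rewrite qv_qnat /evn hu.
Qed.
Lemma DefQ_p2 G (F : env G -> nn) : DefN F -> DefQ (fun e => p2 (F e)).
Proof.
move=> [u hu]; exists (fun e => ev (valu e) (qpow u)); first by exists (qpow u).
by move=> e; rewrite qv_qpow /evn hu.
Qed.
Lemma DefQ_add G (F F' : env G -> mrat) : DefQ F -> DefQ F' -> DefQ (fun e => F e + F' e).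
Proof.
move=> [f [u hu] hf] [f' [w hw] hf'].
exists (fun e => ev (valu e) (qadd u w)); first by exists (qadd u w).
by move=> e; rewrite qv_qadd hu hw hf hf'.
Qed.
Lemma DefQ_opp G (F : env G -> mrat) : DefQ F -> DefQ (fun e => - F e).
Proof.
move=> [f [u hu] hf].
exists (fun e => ev (valu e) (qopp u)); first by exists (qopp u).
by move=> e; rewrite qv_qopp hu hf.
Qed.

Lemma qv_mul V (v : valuation V M) (u w : term V N) :
  qv (ev v (rat (qpos u ⊗ qpos w ⊕ qneg u ⊗ qneg w) (qpos u ⊗ qneg w ⊕ qneg u ⊗ qpos w)
    (psnd u ⊗ psnd w ⊕ psnd u ⊕ psnd w))) = qv (ev v u) * qv (ev v w).
Proof.
rewrite /qv ev_rat -[RHS]fqM; congr fq.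
by rewrite /qpos /qneg !(evn_add, evn_mul, ev_psnd, ev_pfst).
Qed.

Lemma DefQ_mul G (F F' : env G -> mrat) : DefQ F -> DefQ F' -> DefQ (fun e => F e * F' e).
Proof.
move=> [f [u hu] hf] [f' [w hw] hf'].
eexists; last by move=> e; rewrite -hf -hf' -hu -hw -qv_mul.
by eexists.
Qed.

Lemma DefT_if G (P : env G -> Prop) (F F' : env G -> nn) : DefP P -> DefN F -> DefN F' ->
  DefN (fun e => if `[< P e >] then F e else F' e).
Proof.
move=> [c dc hc] dF dF'.
(* [c e] is 0 iff [P e], so [monusM 1 (c e)] is 1 or 0 accordingly, and a second negation selects
   the other branch. *)
apply: (@DefT_ext _ _ (fun e => F e * monusM 1 (c e) + F' e * monusM 1 (monusM 1 (c e)) : M N)).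
  move=> e; case: asboolP => [/hc ->|/hc h].
    by rewrite monusM0 monus11 mulr1 mulr0 addr0.
  by rewrite monus1_neq0 // monusM0 mulr1 mulr0 add0r.
apply: (DefN_add (F := fun e => _ * _)); apply: DefN_mul => //; apply: DefN_monus;
  rewrite ?(_ : true) //; try exact: DefN_const.
by apply: DefN_monus => //; exact: DefN_const.
Qed.

Lemma DefQ_if G (P : env G -> Prop) (F F' : env G -> mrat) : DefP P -> DefQ F -> DefQ F' ->
  DefQ (fun e => if `[< P e >] then F e else F' e).
Proof.
move=> hP [f df hf] [f' df' hf'].
exists (fun e => if `[< P e >] then f e else f' e); first exact: (DefT_if hP df df').
by move=> e; case: asboolP.
Qed.

(** ** Sums *)

Definition sum_step : M (R ⇒ N ⇒ N ⇒ N) :=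
  ev (@idv M) (LAM f : R, LAM k : N, LAM r : N, qadd r (↑f · ↑k)).
Definition zero_code : M N := projT1 (cid (qv_surj (0 : mrat))).

Definition Sm (f : M R) (n : nn) : mrat :=
  qv (app (app (app (cst M Rec) (app sum_step f)) zero_code) n).

Lemma Sm0 f : Sm f 0 = 0.
Proof. by rewrite /Sm rec0 (projT2 (cid (qv_surj (0 : mrat)))). Qed.

Lemma sum_stepE f k r : qv (app (app (app sum_step f) k) r) = qv r + qv (app f k).
Proof. by rewrite /sum_step !ev_lambda qv_qadd. Qed.

Lemma SmS f n : Sm f (n + 1) = Sm f n + qv (app f n).
Proof. by rewrite /Sm recS sum_stepE. Qed.

Lemma DefQ_Sm G (F : env G -> M R) (A : env G -> nn) : DefT F -> DefN A ->
  DefQ (fun e => Sm (F e) (A e)).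
Proof.
move=> h h'; apply: DefQ_qv; apply: DefT_app => //; apply: DefT_app; last exact: DefT_const.
by apply: DefT_app; [apply: DefT_const|apply: DefT_app => //; apply: DefT_const].
Qed.

(** ** Induction, least numbers and comprehension *)

(** The quantifiers of [P] are hidden in a term whose zeros it describes, so that quantifier-free
    induction on a single equation is enough. *)
Lemma def_ind (P : nn -> Prop) : DefP (fun e : env [:: N] => P e.2) ->
  P 0 -> (forall n, P n -> P (n + 1)) -> forall n, P n.
Proof.
move=> [f [u hu] hf] P0 PS n.
have hP k : P k <-> sat (vcons (@idv M) k) (Eq u 𝟎).
  by rewrite (hf (tt, k)) -hu.
by apply/hP/qf_induction => // [|k /hP/PS hk]; apply/hP.
Qed.

Lemma def_least (P : nn -> Prop) : DefP (fun e : env [:: N] => P e.2) ->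
  (exists n, P n) -> exists n, P n /\ forall i, i <| n -> ~ P i.
Proof.
move=> [f /DefT_lam[g dg hg] hf] [n Pn]; have [mu hmu] := mu_exists M.
have h k : app (g tt) k = 0 :> nn <-> P k by rewrite hg (hf (tt, k)).
have [|h1 h2] := hmu (g tt); first by exists n; apply/h.
exists (app mu (g tt)); split; first by apply/h.
by move=> i /h2 hi /h.
Qed.

Lemma def_comp2 s1 s2 t (F : M s1 -> M s2 -> M t) :
  DefT (fun e : env [:: s2; s1] => F e.1.2 e.2) ->
  exists f : M (s1 ⇒ s2 ⇒ t), forall a b, app (app f a) b = F a b.
Proof.
by move=> /DefT_lam[f /DefT_lam[g _ hg] hf]; exists (g tt) => a b; rewrite hg hf.
Qed.

Lemma def_comp1Q s (F : M s -> mrat) : DefQ (fun e : env [:: s] => F e.2) ->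
  exists f : M (s ⇒ N), forall a, qv (app f a) = F a.
Proof.
by move=> [f /DefT_lam[g _ hg] hf]; exists (g tt) => a; rewrite hg hf.
Qed.

Lemma def_comp2Q s1 s2 (F : M s1 -> M s2 -> mrat) :
  DefQ (fun e : env [:: s2; s1] => F e.1.2 e.2) ->
  exists f : M (s1 ⇒ s2 ⇒ N), forall a b, qv (app (app f a) b) = F a b.
Proof.
move=> [f /DefT_lam[g /DefT_lam[h _ hh] hg] hf].
by exists (h tt) => a b; rewrite hh hg hf.
Qed.

Lemma def_comp3Q s1 s2 s3 (F : M s1 -> M s2 -> M s3 -> mrat) :
  DefQ (fun e : env [:: s3; s2; s1] => F e.1.1.2 e.1.2 e.2) ->
  exists f : M (s1 ⇒ s2 ⇒ s3 ⇒ N), forall a b c, qv (app (app (app f a) b) c) = F a b c.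
Proof.
move=> [f /DefT_lam[g /DefT_lam[h /DefT_lam[k _ hk] hh] hg] hf].
by exists (k tt) => a b c; rewrite hk hh hg hf.
Qed.
End Definability.

(** Definability is read off the shape of the expression. Quantifiers are accepted over numbers
    only, as these are the ones that [mu] decides; objects of higher type occur as parameters or as
    free variables. *)
Ltac def_step := first
  [ assumption
  | match goal with
    | |- DefP (fun e => @?P e /\ @?P' e) => apply: (@DefP_and _ _ P P')
    | |- DefP (fun e => @?P e \/ @?P' e) => apply: (@DefP_or _ _ P P')
    | |- DefP (fun e => ~ @?P e) => apply: (@DefP_not _ _ P)
    | |- DefP (fun e => @?P e <-> @?P' e) => apply: (@DefP_iff _ _ P P')
    | |- DefP (fun e => exists k, @?P e k) => apply: (@DefP_ex _ _ P)
    | |- DefP (fun e => forall k : dom _ N, @?P e k) => apply: (@DefP_all _ _ P)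
    | |- DefP (fun e => forall k : nn _, @?P e k) => apply: (@DefP_all _ _ P)
    | |- DefP (fun e => @?P e -> @?P' e) => apply: (@DefP_imp _ _ P P')
    | |- DefP (fun e => nltn _ _) => apply: DefP_ltn
    | |- DefP (fun e => @eq _ _ _) => first [apply: DefP_qeq | apply: DefP_eqn]
    | |- DefP (fun e => is_true (_ < _)%R) => apply: DefP_qlt
    | |- DefP (fun e => is_true (_ <= _)%R) => apply: DefP_qle
    | |- DefQ (fun e => (_ + _)%R) => apply: DefQ_add
    | |- DefQ (fun e => (_ * _)%R) => apply: DefQ_mul
    | |- DefQ (fun e => (- _)%R) => apply: DefQ_opp
    | |- DefQ (fun e => nq _) => apply: DefQ_nq
    | |- DefQ (fun e => p2 _) => apply: DefQ_p2
    | |- DefQ (fun e => qv _) => apply: DefQ_qv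
    | |- DefQ (fun e => Sm _ _) => apply: DefQ_Sm
    | |- DefQ (fun e => if `[< _ >] then _ else _) => apply: DefQ_if
    | |- DefN (fun e => (_ + _)%R) => apply: DefN_add
    | |- DefN (fun e => (_ * _)%R) => apply: DefN_mul
    | |- DefN (fun e => monusM _ _) => apply: DefN_monus
    | |- DefT (fun e => monusM _ _) => apply: DefN_monus
    | |- DefN (fun e => if `[< _ >] then _ else _) => apply: DefT_if
    end
  | exact: DefQ_const
  | exact: DefT_const
  | exact: DefT_new | exact: DefT_old1 | exact: DefT_old2 | exact: DefT_old3
  | apply: DefT_app
  | exact: DefP_const ].
Ltac def := repeat (cbn beta; def_step).

(** * Reals of a model *)

Section SatConnectives.
Variables (D : structure) (V : ty -> Set) (v : valuation V D).

Lemma sat_allI s f (P : D s -> Prop) :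
  (forall a, sat (vcons v a) (f (Var new)) <-> P a) -> sat v (allB s f) <-> forall a, P a.
Proof. by move=> h; split=> k a; apply/h; apply: k. Qed.
Lemma sat_exI s f (P : D s -> Prop) :
  (forall a, sat (vcons v a) (f (Var new)) <-> P a) -> sat v (exB s f) <-> exists a, P a.
Proof. by move=> h; split=> -[a /h k]; exists a. Qed.
(** The second equivalence may assume the first component: the translation of a body often needs to
    know that its variable is a real, since cuts behave well for reals only. *)
Lemma sat_andI A B (P P' : Prop) :
  (sat v A <-> P) -> (P -> sat v B <-> P') -> sat v (And A B) <-> P /\ P'.
Proof. by move=> /= h h'; tauto. Qed.
Lemma sat_impI A B (P P' : Prop) :
  (sat v A <-> P) -> (P -> sat v B <-> P') -> sat v (Imp A B) <-> (P -> P').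
Proof. by move=> /= h h'; tauto. Qed.
Lemma sat_notI A (P : Prop) : (sat v A <-> P) -> sat v (Not A) <-> ~ P.
Proof. by move=> /= h; tauto. Qed.
Lemma sat_iffI A B (P P' : Prop) :
  (sat v A <-> P) -> (sat v B <-> P') -> sat v (Iff A B) <-> (P <-> P').
Proof. by move=> /= h h'; tauto. Qed.
End SatConnectives.

Section Reals.
Variable M : model.
Notation nn := (nn M).
Notation mrat := (mrat M).
Local Open Scope ring_scope.
Local Notation "a <| b" := (nltn a b) (at level 70).

Definition xq (x : M R) (n : nn) : mrat := qv (app x n).

Definition isRe (x : M R) := forall n i : nn,
  xq x n - xq x (n + i) < p2 n /\ - (xq x n - xq x (n + i)) < p2 n.
Definition LTR (x y : M R) := exists n : nn, xq x n + 2 * p2 n < xq y n.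
Definition eqRe (x y : M R) := forall n : nn,
  xq x n - xq y n <= 2 * p2 n /\ - (xq x n - xq y n) <= 2 * p2 n.

(** The cut of a real [x] in the rationals: [x < q] and [q < x]. *)
Definition Below (x : M R) (q : mrat) := exists n : nn, xq x n + p2 n < q.
Definition Above (x : M R) (q : mrat) := exists n : nn, q < xq x n - p2 n.

(** This is [n + 1 <= 2 ^ n] divided by [2 ^ n]; with the archimedean property it makes [p2]
    arbitrarily small. *)
Lemma p2_nat (n : nn) : nq n * p2 n <= 1 - p2 n.
Proof.
move: n; apply: def_ind; first by def.
  by rewrite nq0 p2_0; lra.
move=> n h; rewrite p2S nqD nq1; have := p2_gt0 n; have := nq_ge0 n; move: h; nra.
Qed.

Lemma p2_small (e : mrat) : 0 < e -> exists n : nn, p2 n < e.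
Proof.
move=> e0; have [n hn] := mrat_archi (e^-1); exists n.
have h := p2_nat n; have h0 := p2_gt0 n.
have h1 : e * e^-1 = 1 by rewrite mulfV // lt0r_neq0.
rewrite ltNge; apply/negP => h2.
have h3 : nq n * e <= nq n * p2 n by rewrite ler_wpM2l // nq_ge0.
have h4 : e * e^-1 < e * nq n by rewrite ltr_pM2l.
by move: h3 h4 h1 h h0; rewrite [e * nq n]mulrC; lra.
Qed.

Lemma p2_add (n k : nn) : p2 (n + k) <= p2 n.
Proof.
move: k; apply: def_ind; first by def.
  by rewrite addr0.
by move=> k h; rewrite addrA p2S; have := p2_gt0 (n + k); lra.
Qed.

Lemma p2_le1 (n : nn) : p2 n <= 1.
Proof. by have := p2_add 0 n; rewrite add0r p2_0. Qed.

Lemma n_le_ex (a b : nn) : (exists k, b = a + k) \/ (exists k, a = b + k).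
Proof. by have [/nltW/nle_ex|/nle_ex] := pselect (a <| b); [left|right]. Qed.

Lemma isRe_dist x (i j : nn) : isRe x -> xq x i - xq x j < p2 i + p2 j.
Proof.
move=> h; have hi := p2_gt0 i; have hj := p2_gt0 j.
have [[k ek]|[k ek]] := n_le_ex i j.
  by have [+ _] := h i k; rewrite -ek; lra.
by have [_] := h j k; rewrite -ek; lra.
Qed.

Lemma Below_app x q (j : nn) : isRe x -> Below x q -> xq x j - p2 j < q.
Proof. by move=> h [n hn]; have := isRe_dist j n h; lra. Qed.
Lemma Above_app x q (j : nn) : isRe x -> Above x q -> q < xq x j + p2 j.
Proof. by move=> h [n hn]; have := isRe_dist n j h; lra. Qed.

(** A strict inequality witnessed at one index becomes a gap valid at all indices, so several
    inequalities can be compared at a common one. *)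
Lemma Below_gap x q : isRe x -> Below x q ->
  exists2 g, 0 < g & forall j, xq x j + g < q + p2 j.
Proof.
move=> h [n hn]; exists (q - xq x n - p2 n); first lra.
by move=> j; have := isRe_dist j n h; lra.
Qed.
Lemma Above_gap x q : isRe x -> Above x q ->
  exists2 g, 0 < g & forall j, q + g < xq x j + p2 j.
Proof.
move=> h [n hn]; exists (xq x n - p2 n - q); first lra.
by move=> j; have := isRe_dist n j h; lra.
Qed.

Lemma Below_le x q r : Below x q -> q <= r -> Below x r.
Proof. by move=> [n hn] l; exists n; lra. Qed.
Lemma Above_le x q r : Above x q -> r <= q -> Above x r.
Proof. by move=> [n hn] l; exists n; lra. Qed.

Lemma real_approx x e : 0 < e -> exists w, Above x w /\ Below x (w + e).
Proof.
move=> e0; have [|n hn] := @p2_small (e / 4); first lra.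
have := p2_gt0 n.
by exists (xq x n - 2 * p2 n); split; exists n; lra.
Qed.

Lemma Below_open x q : Below x q -> exists2 r, r < q & Below x r.
Proof. by move=> [n hn]; exists ((xq x n + p2 n + q) / 2); [lra|exists n; lra]. Qed.
Lemma Above_open x q : Above x q -> exists2 r, q < r & Above x r.
Proof. by move=> [n hn]; exists ((xq x n - p2 n + q) / 2); [lra|exists n; lra]. Qed.

Lemma LTR_cut x y : isRe x -> isRe y -> LTR x y <-> exists q, Below x q /\ Above y q.
Proof.
move=> hx hy; split=> [[n hn]|[q [/(Below_gap hx)[g g0 hg] /(Above_gap hy)[g' g'0 hg']]]].
  by exists ((xq x n + xq y n) / 2); split; exists n; lra.
have [|n hn] := @p2_small ((g + g') / 4); first lra.
by exists n; have := hg n; have := hg' n; lra.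
Qed.

Definition is_const (x : M R) (c : mrat) := forall n, xq x n = c.

Lemma is_const_isRe x c : is_const x c -> isRe x.
Proof. by move=> h n i; have := p2_gt0 n; rewrite !h; lra. Qed.
Lemma is_const_Below x c q : is_const x c -> Below x q <-> c < q.
Proof.
move=> h; split=> [[n]|l]; first by rewrite h; have := p2_gt0 n; lra.
by have [|n hn] := @p2_small (q - c); [lra|exists n; rewrite h; lra].
Qed.
Lemma is_const_Above x c q : is_const x c -> Above x q <-> q < c.
Proof.
move=> h; split=> [[n]|l]; first by rewrite h; have := p2_gt0 n; lra.
by have [|n hn] := @p2_small (c - q); [lra|exists n; rewrite h; lra].
Qed.
Lemma LTR_const x y c : isRe x -> is_const y c -> LTR x y <-> Below x c.
Proof.
move=> hx hy; rewrite (LTR_cut hx (is_const_isRe hy)); split=> [[q [hb /(is_const_Above _ hy) l]]|].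
  by apply: Below_le hb (ltW l).
by move=> /Below_open[r l hr]; exists r; split=> //; apply/(is_const_Above _ hy).
Qed.
Lemma const_LTR x y c : isRe x -> is_const y c -> LTR y x <-> Above x c.
Proof.
move=> hx hy; rewrite (LTR_cut (is_const_isRe hy) hx); split=> [[q [/(is_const_Below _ hy) l hb]]|].
  by apply: Above_le hb (ltW l).
by move=> /Above_open[r l hr]; exists r; split=> //; apply/(is_const_Below _ hy).
Qed.

Lemma eqRe_sym x y : eqRe x y -> eqRe y x.
Proof. by move=> h n; have := h n; lra. Qed.
Lemma eqRe_Below x y q : isRe x -> isRe y -> eqRe x y -> Below x q -> Below y q.
Proof.
move=> hx hy e /(Below_gap hx)[g g0 hg].
have [|n hn] := @p2_small (g / 4); first lra.
by exists n; have := hg n; have := e n; lra.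
Qed.
Lemma eqRe_Above x y q : isRe x -> isRe y -> eqRe x y -> Above x q -> Above y q.
Proof.
move=> hx hy e /(Above_gap hx)[g g0 hg].
have [|n hn] := @p2_small (g / 4); first lra.
by exists n; have := hg n; have := e n; lra.
Qed.
Lemma eqRe_const x y c : is_const x c -> is_const y c -> eqRe x y.
Proof. by move=> hx hy n; rewrite hx hy; have := p2_gt0 n; lra. Qed.

(** ** Satisfaction of the basic formulas *)

Section SatRationals.
Variables (V : ty -> Set) (v : valuation V M).

Lemma sat_qabs_lt q r :
  sat v (qabs_lt q r) <-> qv (ev v q) < qv (ev v r) /\ - qv (ev v q) < qv (ev v r).
Proof. by rewrite -qv_qopp -!sat_qlt. Qed.
Lemma sat_qabs_le q r :
  sat v (qabs_le q r) <-> qv (ev v q) <= qv (ev v r) /\ - qv (ev v q) <= qv (ev v r).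
Proof. by rewrite -qv_qopp -!sat_qle. Qed.
End SatRationals.

Section Sat.
Variables (V : ty -> Set) (v : valuation V M).

Lemma sat_isReal (x : term V R) : sat v (isReal x) <-> isRe (ev v x).
Proof.
apply: sat_allI => n; apply: sat_allI => i.
by rewrite sat_qabs_lt qv_qsub qv_qpow /= !ev_ren.
Qed.

Lemma sat_ltR (x y : term V R) : sat v (ltR x y) <-> LTR (ev v x) (ev v y).
Proof. by apply: sat_exI => n; rewrite sat_qlt qv_qadd qv_qpow1 /= !ev_ren. Qed.

Lemma sat_leR (x y : term V R) : sat v (leR x y) <-> ~ LTR (ev v y) (ev v x).
Proof. by apply: sat_notI; apply: sat_ltR. Qed.

Lemma sat_eqR (x y : term V R) : sat v (eqR x y) <-> eqRe (ev v x) (ev v y).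
Proof.
apply: sat_allI => n.
by rewrite sat_qabs_le qv_qsub qv_qpow1 /= !ev_ren.
Qed.

Lemma is_const_rcst (q : term V N) : is_const (ev v (rcst q)) (qv (ev v q)).
Proof. by move=> n; rewrite /xq ev_lambda ev_ren. Qed.

Lemma is_const_rzero : is_const (ev v rzero) 0.
Proof. by move=> n; rewrite is_const_rcst qv_qnat. Qed.
Lemma is_const_rone : is_const (ev v rone) 1.
Proof. by move=> n; rewrite is_const_rcst qv_qnat. Qed.

Lemma xq_ropp (x : term V R) n : xq (ev v (ropp x)) n = - xq (ev v x) n.
Proof. by rewrite /xq ev_lambda qv_qopp /= ev_ren. Qed.
Lemma xq_radd (x y : term V R) n :
  xq (ev v (radd x y)) n = xq (ev v x) (n + 1) + xq (ev v y) (n + 1).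
Proof. by rewrite /xq ev_lambda qv_qadd /= !ev_ren. Qed.
Lemma xq_rsub (x y : term V R) n :
  xq (ev v (rsub x y)) n = xq (ev v x) (n + 1) - xq (ev v y) (n + 1).
Proof. by rewrite xq_radd xq_ropp. Qed.

Definition inIR (x : M R) := isRe x /\ ~ Below x 0 /\ ~ Above x 1.

Lemma sat_inI (x : term V R) : sat v (inI x) <-> inIR (ev v x).
Proof.
apply: sat_andI; first exact: sat_isReal.
move=> hx; apply: sat_andI => [|_]; rewrite sat_leR; split=> h h'; apply: h; move: h'.
- by rewrite (LTR_const hx is_const_rzero).
- by rewrite (LTR_const hx is_const_rzero).
- by rewrite (const_LTR hx is_const_rone).
- by rewrite (const_LTR hx is_const_rone).
Qed.

Definition memR (x : M R) (K : M (R ⇒ R)) := exists n : nn, 2 * p2 n < xq (app K x) n.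

Lemma sat_mem (x : term V R) K : sat v (mem x K) <-> memR (ev v x) (ev v K).
Proof.
rewrite sat_ltR /LTR /memR.
by split=> -[n hn]; exists n; move: hn; rewrite is_const_rzero add0r.
Qed.
End Sat.
End Reals.

(** * Covers *)

Lemma iff_ex T (P P' : T -> Prop) :
  (forall x, P x <-> P' x) -> (exists x, P x) <-> (exists x, P' x).
Proof. by move=> h; split=> -[x /h k]; exists x. Qed.

Section Covers.
Variable M : model.
Notation nn := (nn M).
Notation mrat := (mrat M).
Local Open Scope ring_scope.
Local Notation "a <| b" := (nltn a b) (at level 70).

Lemma p2D (m n : nn) : p2 (m + n) = p2 m * p2 n.
Proof.
move: n; apply: def_ind; first by def.
  by rewrite addr0 p2_0 mulr1.
by move=> n h; rewrite addrA !p2S h mulrA.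
Qed.

Lemma Sm_ext (f g : M R) n : (forall k, qv (app f k) = qv (app g k)) -> Sm f n = Sm g n.
Proof.
move=> h; move: n; apply: def_ind; first by def.
  by rewrite !Sm0.
by move=> n e; rewrite !SmS e h.
Qed.

Lemma Sm_sub (f g h : M R) n : (forall k, qv (app h k) = qv (app f k) - qv (app g k)) ->
  Sm h n = Sm f n - Sm g n.
Proof.
move=> e; move: n; apply: def_ind; first by def.
  by rewrite !Sm0 subr0.
by move=> n e'; rewrite !SmS e' e; ring.
Qed.

Lemma rec_sum (L : M (N ⇒ N ⇒ N)) (z : M N) (g : M R) n :
  (forall k r, qv (app (app L k) r) = qv r + qv (app g k)) -> qv z = 0 ->
  qv (app (app (app (cst M Rec) L) z) n) = Sm g n.
Proof.
move=> hL hz; move: n; apply: def_ind; first by def.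
  by rewrite rec0 Sm0.
by move=> n e; rewrite recS SmS hL e.
Qed.

Lemma diff_ex (a b : M (N ⇒ R)) (j : nn) :
  exists g : M R, forall k, qv (app g k) = xq (app b k) j - xq (app a k) j.
Proof. by apply: def_comp1Q; rewrite /xq; def. Qed.

(** The [m]-th approximation of [psum]: [rsum] evaluates its summands at [m + n], and the
    subtraction of reals shifts this by one. *)
Definition PSum (a b : M (N ⇒ R)) (n m : nn) := Sm (projT1 (cid (diff_ex a b (m + n + 1)))) n.

Lemma PSumE a b n m (g : M R) :
  (forall k, qv (app g k) = xq (app b k) (m + n + 1) - xq (app a k) (m + n + 1)) ->
  PSum a b n m = Sm g n.
Proof. by move=> h; apply: Sm_ext => k; rewrite h (projT2 (cid (diff_ex a b (m + n + 1)))). Qed.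

Definition intervalsR (a b : M (N ⇒ R)) :=
  forall k, isRe (app a k) /\ isRe (app b k) /\ ~ LTR (app b k) (app a k).
Definition coversR (a b : M (N ⇒ R)) (E : M R -> Prop) :=
  forall x, isRe x -> E x -> exists k, LTR (app a k) x /\ LTR x (app b k).
Definition leSum a b n d := ~ exists m : nn, xq d m + 2 * p2 m < PSum a b n m.

Lemma xq_psum V (v : valuation V M) (a b : term V (N ⇒ R)) (n : term V N) m :
  xq (ev v (psum a b n)) m = PSum (ev v a) (ev v b) (ev v n) m.
Proof.
have [g hg] := diff_ex (ev v a) (ev v b) (m + ev v n + 1).
rewrite (PSumE hg) /xq /psum /rsum ev_lambda.
set w := vcons v m; have -> : ev v n = ev w (ren weaken n) by rewrite ev_ren.
match goal with |- qv (ev _ (App (App (App _ ?L) ?z) ?k)) = _ =>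
  refine (@rec_sum (ev w L) (ev w z) g (ev w k) _ _) end; last by rewrite qv_qnat.
move=> k r; rewrite !ev_lambda qv_qadd hg; congr (_ + _).
match goal with |- qv (ev ?w (App (App ?X ?k) ?i)) = ?y =>
  change (xq (app (ev w X) (ev w k)) (ev w i) = y) end.
by rewrite ev_ren ev_lambda xq_rsub /= !ev_ren.
Qed.

Lemma sat_up V W (v : valuation W M) (r : renaming V W) s (x : M s) (E : form (ext V s)) :
  sat (vcons v x) (renF (up_ren r) E) <-> sat (vcons (fun t y => v t (r t y)) x) E.
Proof.
rewrite sat_ren; have -> // : (fun t y => vcons v x (up_ren r t y)) = vcons (fun t y => v t (r t y)) x.
by apply: functional_extensionality_dep => t; apply: funext => -[].
Qed.

Definition setR V (v : valuation V M) (E : rset V) (x : M R) := sat (vcons v x) E.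

Lemma LTR_vals (x y : M R) (f g : nn -> mrat) :
  (forall m, xq x m = f m) -> (forall m, xq y m = g m) ->
  LTR x y <-> exists m, f m + 2 * p2 m < g m.
Proof. by move=> hf hg; apply: iff_ex => m; rewrite hf hg. Qed.

Section SatMeasure.
Variables (V : ty -> Set) (v : valuation V M).

Lemma sat_intervals a b : sat v (intervals a b) <-> intervalsR (ev v a) (ev v b).
Proof.
apply: sat_allI => k; apply: sat_andI; first by rewrite sat_isReal /= ev_ren.
move=> _; apply: sat_andI => [|_]; first by rewrite sat_isReal /= ev_ren.
by rewrite sat_leR /= !ev_ren.
Qed.

Lemma sat_covers a b E : sat v (covers a b E) <-> coversR (ev v a) (ev v b) (setR v E).
Proof.
apply: sat_allI => x; apply: sat_impI; first by rewrite sat_isReal.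
move=> _; apply: sat_impI => // _; apply: sat_exI => k.
by apply: sat_andI => [|_]; rewrite sat_ltR /= !ev_ren.
Qed.

Lemma sat_leSum a b n d : sat v (leR (psum a b n) d) <-> leSum (ev v a) (ev v b) (ev v n) (ev v d).
Proof.
move: (xq_psum v a b n); move: (psum a b n) => p hp; rewrite sat_leR /LTR /leSum.
by split=> h -[m hm]; apply: h; exists m; move: hm; rewrite hp.
Qed.

Lemma sat_le_radd a b n a' b' n' d :
  sat v (leR (radd (psum a b n) (psum a' b' n')) (radd rone d)) <->
  ~ exists m : nn, 1 + xq (ev v d) (m + 1) + 2 * p2 m <
    PSum (ev v a) (ev v b) (ev v n) (m + 1) + PSum (ev v a') (ev v b') (ev v n') (m + 1).
Proof.
have E1 m : xq (ev v (radd (psum a b n) (psum a' b' n'))) m =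
    PSum (ev v a) (ev v b) (ev v n) (m + 1) + PSum (ev v a') (ev v b') (ev v n') (m + 1).
  exact: etrans (xq_radd _ _ _ _) (congr2 +%R (xq_psum _ _ _ _ _) (xq_psum _ _ _ _ _)).
have E2 m : xq (ev v (radd rone d)) m = 1 + xq (ev v d) (m + 1).
  by have e := xq_radd v rone d m; have e1 := @is_const_rone M V v (m + 1); rewrite e1 in e.
exact: iff_trans (sat_leR _ _ _) (not_iff_compat (LTR_vals E2 E1)).
Qed.
End SatMeasure.

Definition measltR (E : M R -> Prop) (c : M R) := exists a b,
  intervalsR a b /\ coversR a b E /\ exists d, isRe d /\ LTR d c /\ forall n, leSum a b n d.
Definition measgeR (E : M R -> Prop) (c : M R) := forall a b,
  intervalsR a b -> coversR a b E ->
  forall d, isRe d -> LTR d c -> exists n m : nn, xq d m + 2 * p2 m < PSum a b n m.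
Definition measaddR (E F : M R -> Prop) := forall d, isRe d -> Above d 0 ->
  exists a b a' b', intervalsR a b /\ coversR a b E /\ intervalsR a' b' /\ coversR a' b' F /\
  forall n, ~ exists m : nn,
    1 + xq d (m + 1) + 2 * p2 m < PSum a b n (m + 1) + PSum a' b' n (m + 1).
Definition measurableR (E : M R -> Prop) := measaddR E (fun x => inIR x /\ ~ E x).

Lemma coversR_ext a b (E F : M R -> Prop) : (forall x, isRe x -> (E x <-> F x)) ->
  coversR a b E <-> coversR a b F.
Proof. by move=> h; split=> k x hx /(h x hx); apply: k. Qed.

Section SatMeasure2.
Variables (V : ty -> Set) (v : valuation V M).

Lemma setR_complI E x : setR v (complI E) x <-> inIR x /\ ~ setR v E x.
Proof.
by apply: sat_andI => [|_]; [exact: (sat_inI (vcons v x) (Var new))|exact: sat_notI].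
Qed.

Lemma sat_measure_lt E c : sat v (measure_lt E c) <-> measltR (setR v E) (ev v c).
Proof.
apply: sat_exI => a; apply: sat_exI => b; apply: sat_andI; first exact: sat_intervals.
move=> _; apply: sat_andI.
  by rewrite sat_covers; apply: coversR_ext => x _; rewrite /setR sat_up.
move=> _; apply: sat_exI => d; apply: sat_andI; first exact: sat_isReal.
move=> _; apply: sat_andI; first by rewrite sat_ltR ev_ren.
by move=> _; apply: sat_allI => n; exact: sat_leSum.
Qed.

Lemma sat_measure_ge E c : sat v (measure_ge E c) <-> measgeR (setR v E) (ev v c).
Proof.
apply: sat_allI => a; apply: sat_allI => b; apply: sat_impI; first exact: sat_intervals.
move=> _; apply: sat_impI.
  by rewrite sat_covers; apply: coversR_ext => x _; rewrite /setR sat_up.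
move=> _; apply: sat_allI => d; apply: sat_impI; first exact: sat_isReal.
move=> _; apply: sat_impI; first by rewrite sat_ltR ev_ren.
move=> _; apply: sat_exI => n; rewrite sat_ltR.
by apply: iff_ex => m; match goal with |- context [ev ?w (psum ?a ?b ?n)] =>
  rewrite (xq_psum w a b n m) end.
Qed.

Lemma sat_measurable E : sat v (measurable E) <-> measurableR (setR v E).
Proof.
apply: sat_allI => d; apply: sat_impI; first exact: sat_isReal.
move=> hd; apply: sat_impI; first by rewrite sat_ltR; apply: const_LTR => //; apply: is_const_rzero.
move=> _; apply: sat_exI => a; apply: sat_exI => b; apply: sat_exI => a'; apply: sat_exI => b'.
apply: sat_andI; first exact: sat_intervals.
move=> _; apply: sat_andI.
  by rewrite sat_covers; apply: coversR_ext => x _; rewrite /setR sat_up.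
move=> _; apply: sat_andI; first exact: sat_intervals.
move=> _; apply: sat_andI.
  rewrite sat_covers; apply: coversR_ext => x _; rewrite {1}/setR sat_up.
  exact: setR_complI.
by move=> _; apply: sat_allI => n; rewrite sat_le_radd.
Qed.
End SatMeasure2.

(** ** Rational covers *)

(** [E] has a cover by rational intervals of total length at most [s]; the sum of
    their first [n] lengths is [Sm b n - Sm a n]. *)
Definition rcov (E : M R -> Prop) (s : mrat) := exists a b : M R,
  (forall k, xq a k <= xq b k) /\ (forall n, Sm b n - Sm a n <= s) /\
  forall x, isRe x -> E x -> exists k, Above x (xq a k) /\ Below x (xq b k).

Lemma real_seq (a : M R) : exists A : M (N ⇒ R), forall k, is_const (app A k) (xq a k).
Proof. by apply: def_comp2Q; rewrite /xq; def. Qed.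

Lemma rcov_real E s : rcov E s -> exists A B,
  intervalsR A B /\ coversR A B E /\ forall n m, PSum A B n m <= s.
Proof.
move=> [a [b [ab [hs hc]]]]; have [A hA] := real_seq a; have [B hB] := real_seq b.
exists A, B; split.
  move=> k; split; first exact: is_const_isRe (hA k).
  split; first exact: is_const_isRe (hB k).
  by move=> /(LTR_const (is_const_isRe (hB k)) (hA k)) /(is_const_Below _ (hB k)); rewrite ltNge ab.
split.
  move=> x hx /(hc x hx)[k [ha hb]]; exists k.
  by rewrite (const_LTR hx (hA k)) (LTR_const hx (hB k)).
move=> n m; have [g hg] := diff_ex A B (m + n + 1).
rewrite (PSumE hg) (@Sm_sub b a) // => k; rewrite hg (hA k) (hB k) //.
Qed.

(** The end-points of the [k]-th interval are replaced by approximations with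
    error [2 ^ - (k + s)], so that the total error is at most [2 ^ - s * 8]. *)
Lemma real_rcov a b E d q : intervalsR a b -> coversR a b E -> isRe d ->
  (forall n, leSum a b n d) -> Below d q -> rcov E q.
Proof.
move=> hI hC hd hS /(Below_gap hd)[g g0 hg].
have [|s hs] := @p2_small M (g / 16); first lra.
have [a' ha'] : exists a' : M R, forall k : M N, xq a' k = xq (app a k) ((k : nn) + s) - p2 ((k : nn) + s).
  by apply: (def_comp1Q (F := fun k : M N => xq (app a k) ((k : nn) + s) - p2 ((k : nn) + s))); rewrite /xq; def.
have [b' hb'] : exists b' : M R, forall k : M N, xq b' k = xq (app b k) ((k : nn) + s) + p2 ((k : nn) + s).
  by apply: (def_comp1Q (F := fun k : M N => xq (app b k) ((k : nn) + s) + p2 ((k : nn) + s))); rewrite /xq; def.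
exists a', b'; split; last split.
- move=> k; have [_ [_ h]] := hI k; rewrite ha' hb' leNgt; apply/negP => h'; apply: h.
  by exists ((k : nn) + s); lra.
(* The gap [g] is spent in halves: [8 * p2 s] on moving the end-points, and [4 * p2 m] on the
   approximations of the partial sum and of [d]. *)
- move=> n; have [|m hm] := @p2_small M (g / 8); first lra.
  have [G hG] := diff_ex a b (m + n + 1).
  (* The interval of index [k] costs [4 * p2 (k + s)], half for enlarging it and half for the change
     of index; the bracket is the closed form of this geometric sum. The last term is the error at
     index [m + n + 1]. *)
  have key (k : nn) : Sm b' k - Sm a' k <= Sm G k + 4 * (2 * p2 s - 2 * p2 (k + s))
      + 2 * nq k * p2 (m + n + 1).
    move: k; apply: def_ind; first by def.
      by rewrite !Sm0 [0 + s]add0r nq0; lra.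
    move=> k hk; have [h1 [h2 _]] := hI k; rewrite !SmS hG -!/(xq _ _) ha' hb'.
    have := isRe_dist (k + s) (m + n + 1) h2; have := isRe_dist (m + n + 1) (k + s) h1.
    rewrite [k + 1 + s]addrAC [p2 (k + s + 1)]p2S nqD nq1; move: hk; lra.
  have := key n; have : Sm G n <= xq d m + 2 * p2 m.
    rewrite leNgt; apply/negP => h; apply: (hS n); exists m.
    by rewrite (PSumE hG).
  have -> : p2 (m + n + 1) = p2 m * p2 n / 2 by rewrite p2S p2D.
  have := p2_nat n; have := hg m; have := p2_gt0 n; have := p2_gt0 m.
  have := p2_gt0 (n + s); have := p2_le1 n; have := nq_ge0 n.
  move: (p2 m) (p2 n) (nq n) (p2 (n + s)) (Sm b' n) (Sm a' n) (Sm G n) hm => pm pn x pns sb sa sG hm *.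
  have : pm * (x * pn) <= pm by nra.
  lra.
- move=> x hx /(hC x hx)[k [h1 h2]]; exists k; have [ra [rb _]] := hI k.
  move: h1 h2 => /(LTR_cut ra hx)[q1 [h1 h1']] /(LTR_cut hx rb)[q2 [h2' h2]].
  rewrite ha' hb'; split.
    by apply: Above_le h1' _; apply: ltW; apply: Below_app h1.
  by apply: Below_le h2' _; apply: ltW; apply: Above_app h2.
Qed.

Lemma rcov_sub (E F : M R -> Prop) s : (forall x, isRe x -> F x -> E x) -> rcov E s -> rcov F s.
Proof.
move=> h [a [b [h1 [h2 h3]]]]; exists a, b; split=> //; split=> // x hx /(h _ hx); exact: h3.
Qed.

Lemma rcov_ge0 E s : rcov E s -> 0 <= s.
Proof. by move=> [a [b [_ [h _]]]]; have := h 0; rewrite !Sm0 subr0. Qed.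

(** Passing to rational end-points is harmless because the total length is strictly below [c], with
    a rational in between. *)
Lemma measltR_rcov E c : isRe c -> measltR E c <-> exists s, Above c s /\ rcov E s.
Proof.
move=> hc; split.
  move=> [a [b [h1 [h2 [d [hd [/(LTR_cut hd hc)[s [hb ha]] h3]]]]]]].
  by exists s; split=> //; apply: real_rcov h1 h2 hd h3 hb.
move=> [s [hs /rcov_real[A [B [h1 [h2 h3]]]]]]; exists A, B; split=> //; split=> //.
have [D hD] : exists D : M R, forall k : M N, qv (app D k) = s.
  by apply: (def_comp1Q (F := fun k : M N => s)); def.
exists D; have rD := is_const_isRe hD; split=> //; split; first by apply/(const_LTR hc hD).
by move=> n [m]; rewrite [xq D m]hD; have := h3 n m; have := p2_gt0 m; lra.
Qed.

Lemma measgeR_rcov E c : isRe c -> (forall s, rcov E s -> ~ Above c s) -> measgeR E c.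
Proof.
move=> hc h a b h1 h2 d hd /(LTR_cut hd hc)[s [hb ha]].
apply: contrapT => hn; apply: h ha; apply: real_rcov h1 h2 hd _ hb.
by move=> n [m hm]; apply: hn; exists n, m.
Qed.

Lemma measurableR_rcov E : (forall e, 0 < e -> exists s s',
    rcov E s /\ rcov (fun x => inIR x /\ ~ E x) s' /\ s + s' <= 1 + e) -> measurableR E.
Proof.
move=> h d hd ha; have [g g0 hg] := Above_gap hd ha.
have [s [s' [/rcov_real[a [b [h1 [h2 h3]]]] [/rcov_real[a' [b' [h1' [h2' h3']]]] l]]]] := h g g0.
exists a, b, a', b'; split=> //; split=> //; split=> //; split=> // n.
move=> [m]; have := h3 n (m + 1); have := h3' n (m + 1); have := hg (m + 1).
by have := p2_add m 1; have := p2_gt0 m; lra.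
Qed.

(** The definition is symmetric in a set and its complement in [I]: the two covers are exchanged. *)
Lemma measurableR_compl E F : (forall x, isRe x -> F x -> inIR x /\ ~ E x) ->
  (forall x, isRe x -> inIR x /\ ~ F x -> E x) -> measurableR E -> measurableR F.
Proof.
move=> hF hE h d hd h0; have [a [b [a' [b' [h1 [h2 [h3 [h4 h5]]]]]]]] := h d hd h0.
exists a', b', a, b; split; first exact: h3.
split; first by move=> x hx /(hF _ hx); apply: h4.
split; first exact: h1.
split; first by move=> x hx /(hE _ hx); apply: h2.
by move=> n [m hm]; apply: (h5 n); exists m; move: hm; lra.
Qed.

Lemma measurableR_ext (E F : M R -> Prop) : (forall x, isRe x -> (E x <-> F x)) ->
  measurableR E -> measurableR F.
Proof.
move=> e h d hd h0; have [a [b [a' [b' [h1 [h2 [h3 [h4 h5]]]]]]]] := h d hd h0.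
exists a, b, a', b'; split; first exact: h1.
split; first by move=> x hx /(e _ hx); apply: h2.
split; first exact: h3.
split; last exact: h5.
by move=> x hx [hi hn]; apply: h4 => //; split=> // /(e _ hx).
Qed.
End Covers.

(** * Closed sets are measurable *)

Section ClosedMeasurable.
Variable M : model.
Notation nn := (nn M).
Notation mrat := (mrat M).
Local Open Scope ring_scope.
Local Notation "a <| b" := (nltn a b) (at level 70).

Lemma Sm_step (f : M R) (n : nn) : Sm f (n + 1) = Sm f n + xq f n.
Proof. exact: SmS. Qed.

Lemma n_ltS (a b : nn) : a <| b + 1 <-> nq a <= nq b.
Proof.
rewrite -nq_lt nqD nq1; split; first exact: nq_leS.
by move=> h; apply: le_lt_trans h _; lra.
Qed.

Lemma floor_ex (q : mrat) : 0 <= q -> exists k : nn, nq k <= q /\ q < nq k + 1.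
Proof.
move=> q0; have [||n [hn hm]] := @def_least M (fun n => q < nq n); first by def.
  exact: mrat_archi.
have [n0|[k ek]] := n_case n; first by move: hn; rewrite n0 nq0; lra.
exists k; move: hn; rewrite ek nqD nq1 => hn; split=> //; rewrite leNgt; apply/negP.
by apply: hm; rewrite ek; apply/n_ltS.
Qed.

Lemma Sm_le (w : M R) (n k : nn) : (forall i, 0 <= xq w i) -> Sm w n <= Sm w (n + k).
Proof.
move=> w0; move: k; apply: def_ind; first by def.
  by rewrite addr0.
by move=> k h; rewrite addrA Sm_step; have := w0 (n + k); lra.
Qed.

Lemma Sm_ge0 (w : M R) (n : nn) : (forall i, 0 <= xq w i) -> 0 <= Sm w n.
Proof. by move=> h; have := Sm_le 0 n h; rewrite Sm0 add0r. Qed.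

Lemma monus_addl (n k : nn) : monusM (n + k) n = k.
Proof. by have := nq_ge0 k => h; apply: nq_inj; rewrite nq_monus nqD; lra. Qed.

Lemma rcov_empty : rcov (fun _ : M R => False) 0.
Proof.
have [z hz] : exists z : M R, forall k : M N, xq z k = 0.
  by apply: (def_comp1Q (F := fun k : M N => 0 : mrat)); def.
exists z, z; split; first by move=> k; rewrite hz.
by split=> // n; rewrite subrr.
Qed.

(** Adds finitely many selected intervals in front of a cover. The sequence [w] of added lengths is
    returned because sums over complementary selections are later computed together. *)
Lemma rcov_cons (a b : M R) (P : nn -> Prop) (n : nn) E s :
  DefP (fun e : env M [:: N] => P e.2) -> (forall k, xq a k <= xq b k) -> rcov E s ->
  exists w : M R, (forall k, xq w k = if `[< P k >] then xq b k - xq a k else 0) /\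
    rcov (fun x => E x \/ exists k, k <| n /\ P k /\ Above x (xq a k) /\ Below x (xq b k))
      (s + Sm w n).
Proof.
move=> dP ab hE; have s0 := rcov_ge0 hE; case: hE => a' [b' [ab' [hs' hc']]].
have [w hw] : exists w : M R, forall k, xq w k = if `[< P k >] then xq b k - xq a k else 0.
  by apply: (def_comp1Q (F := fun k => if `[< P k >] then xq b k - xq a k else 0)); rewrite /xq; def.
have w0 i : 0 <= xq w i by rewrite hw; case: ifP => // _; have := ab i; lra.
(* Unselected indices below [n] receive the empty interval with both ends 0; the given cover is
   shifted by [n]. *)
have seq_ex (f f' : M R) : exists c : M R, forall k : nn, xq c k =
    if `[< k <| n >] then if `[< P k >] then xq f k else 0 else xq f' (monusM k n).
  apply: (def_comp1Q (F := fun k => if `[< k <| n >] then if `[< P k >] then xq f k else 0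
    else xq f' (monusM k n))); rewrite /xq; def.
have [c hc] := seq_ex a a'; have [d hd] := seq_ex b b'.
exists w; split=> //; exists c, d; split; last split.
- move=> k; rewrite hc hd; case: (asboolP (k <| n)) => _; last exact: ab'.
  by case: (asboolP (P k)) => _; [exact: ab|exact: lexx].
- move=> m.
  have h1 i : nq i <= nq n -> Sm d i - Sm c i = Sm w i.
    move: i; apply: def_ind; [by def|by rewrite !Sm0 subr0|].
    move=> i hi; rewrite nqD nq1 => l; rewrite !Sm_step hc hd hw.
    have -> : `[< i <| n >] by apply/asboolP/nq_lt; lra.
    have := hi; case: asboolP => _ hi'; rewrite -hi'; lra.
  have h2 i : Sm d (n + i) - Sm c (n + i) = Sm w n + (Sm b' i - Sm a' i).
    move: i; apply: def_ind; first by def.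
      by rewrite addr0 !Sm0 h1 // subr0 addr0.
    move=> i hi; rewrite addrA !Sm_step hc hd monus_addl.
    have -> : `[< n + i <| n >] = false.
      by apply/asboolPn => /nq_lt; rewrite nqD; have := nq_ge0 i; lra.
    by move: hi; lra.
  have [[k ek]|[k ek]] := n_le_ex n m.
    by rewrite ek h2; have := hs' k; lra.
  have l : nq m <= nq n by rewrite ek nqD; have := nq_ge0 k; lra.
  by rewrite (h1 m l) ek; have := Sm_le m k w0; lra.
- move=> x hx [Ex|[k [kn [Pk [h1 h2]]]]].
    have [k [h1 h2]] := hc' x hx Ex; exists (n + k); rewrite hc hd monus_addl.
    have -> // : `[< n + k <| n >] = false.
    by apply/asboolPn => /nq_lt; rewrite nqD; have := nq_ge0 k; lra.
  exists k; rewrite hc hd.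
  by have -> : `[< k <| n >] by [apply/asboolP]; have -> : `[< P k >] by apply/asboolP.
Qed.

Lemma Sm_const (w : M R) c (n : nn) : (forall k, xq w k = c) -> Sm w n = nq n * c.
Proof.
move=> h; move: n; apply: def_ind; first by def.
  by rewrite Sm0 nq0 mul0r.
by move=> n e; rewrite Sm_step e h nqD nq1; ring.
Qed.

(** Stands in for convergence of the partial sums: if no tail were small, they would gain [d] again
    and again, and by induction on the number of gains exceed [s]. *)
Lemma tail_small (a b : M R) s d : (forall k, xq a k <= xq b k) ->
  (forall n, Sm b n - Sm a n <= s) -> 0 < d ->
  exists n : nn, forall m, (Sm b (n + m) - Sm a (n + m)) - (Sm b n - Sm a n) <= d.
Proof.
move=> ab hs d0; apply: contrapT => hn.
have h n : exists m, d < (Sm b (n + m) - Sm a (n + m)) - (Sm b n - Sm a n).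
  apply: contrapT => h; apply: hn; exists n => m; rewrite leNgt; apply/negP => l.
  by apply: h; exists m.
have big j : exists n, nq j * d <= Sm b n - Sm a n.
  move: j; apply: def_ind; first by def.
    by exists 0; rewrite nq0 mul0r !Sm0 subrr.
  move=> j [n hj]; have [m hm] := h n; exists (n + m); rewrite nqD nq1; lra.
have [j hj] := @mrat_archi M (s / d); have [n hjn] := big j.
have := hs n; move: hj; rewrite ltr_pdivrMr //; lra.
Qed.

Lemma rcov_tail (a b : M R) s (n : nn) d : (forall k, xq a k <= xq b k) ->
  (forall n, Sm b n - Sm a n <= s) ->
  (forall m, (Sm b (n + m) - Sm a (n + m)) - (Sm b n - Sm a n) <= d) ->
  rcov (fun x => exists k, Above x (xq a (n + k)) /\ Below x (xq b (n + k))) d.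
Proof.
move=> ab hs hd.
have sh (f : M R) : exists f' : M R, forall k : nn, xq f' k = xq f (n + k).
  by apply: (def_comp1Q (F := fun k : M N => xq f (n + k))); rewrite /xq; def.
have [a' ha] := sh a; have [b' hb] := sh b.
have shS (f f' : M R) : (forall k : nn, xq f' k = xq f (n + k)) ->
    forall m, Sm f' m = Sm f (n + m) - Sm f n.
  move=> h m; move: m; apply: def_ind; first by def.
    by rewrite addr0 Sm0 subrr.
  by move=> m e; rewrite addrA !Sm_step e h; lra.
exists a', b'; split; first by move=> k; rewrite ha hb.
split; first by move=> m; rewrite (shS _ _ ha) (shS _ _ hb); have := hd m; lra.
by move=> x hx [k hk]; exists k; rewrite ha hb.
Qed.

Lemma nq_pow2 (L : nn) : nq (pow2m1M L + 1) * p2 L = 1.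
Proof. by rewrite nqD nq1 nq_pow2m1 subrK mulVf // lt0r_neq0 // p2_gt0. Qed.

(** The cell is that of a rational [w] slightly below [x], or the first one if [w] is negative; the
    margin [eta] absorbs the distance from [w] to [x]. *)
Lemma cell_ex (x : M R) (L : nn) (eta : mrat) : 0 < eta -> inIR x ->
  exists k, k <| pow2m1M L + 1 /\ Above x (nq k * p2 L - eta) /\
    Below x ((nq k + 1) * p2 L + eta).
Proof.
move=> e0 [hx [h0 h1]]; have [w [hw hw']] := real_approx x e0.
have L0 := p2_gt0 L; have hN := nq_pow2 L.
have wl : 0 < w + eta.
  by rewrite ltNge; apply/negP => l; apply: h0; apply: Below_le hw' l.
have wr : w < 1.
  by rewrite ltNge; apply/negP => l; apply: h1; apply: Above_le hw l.
have [w0|w0] := leP 0 w.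
  have [|k [hk hk']] := @floor_ex (w / p2 L); first by rewrite divr_ge0 // ltW.
  move: hk hk'; rewrite ler_pdivlMr // ltr_pdivrMr // => hk hk'.
  exists k; split; last by split; [apply: Above_le hw _|apply: Below_le hw' _]; lra.
  apply/nq_lt; rewrite -(ltr_pM2r L0); lra.
exists 0; rewrite nq0; split; last by split; [apply: Above_le hw _|apply: Below_le hw' _]; lra.
exact: nlt0S.
Qed.

Definition avoids (a b : M R) (x : M R) := forall k, ~ (Above x (xq a k) /\ Below x (xq b k)).

Lemma closed_measurable (a b : M R) s : (forall k, xq a k <= xq b k) ->
  (forall n, Sm b n - Sm a n <= s) -> measurableR (fun x => inIR x /\ avoids a b x).
Proof.
move=> ab hs; apply: measurableR_rcov => e e0.
have [|n0 hn0] := tail_small (d := e / 4) ab hs; first lra.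
have c0 := nq_ge0 n0.
(* The budget: [e / 4] for the tail, [8 * nq n0 * h < e / 4] for neighbourhoods of length [4 * h] of
   the [2 * n0] end-points, and [2 * t < e / 8] for the margins of the cells, which without margins
   have total length 1. *)
have [|L hL] := @p2_small M (e / (32 * (nq n0 + 1))); first by apply: divr_gt0; lra.
move: hL; rewrite ltr_pdivlMr; last lra.
have := p2_gt0 L; set h := p2 L => h0 hL.
have [|j hj] := @p2_small M (e / 8); first lra.
(* With [t <= 1 / 2] a cell and its two margins have length at most [2 * h]. So a point common to
   such an enlarged cell and to an interval from which the cell sticks out is within [2 * h] of an
   end-point. *)
have := p2S j; have := p2_gt0 (j + 1); have := p2_le1 j.
move: (p2 (j + 1)) => t j1 t0 tj; have t2 : t <= 1 / 2 by lra.
pose n := pow2m1M L + 1; have hN : nq n * h = 1 by exact: nq_pow2.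
(* The margin [t * h] lets the enlarged cells fit in the intervals too. *)
pose good (k : nn) := exists i : nn, i <| n0 /\ xq a i <= nq k * h - t * h /\
  (nq k + 1) * h + t * h <= xq b i.
have dgood : DefP (fun e : env M [:: N] => good e.2) by rewrite /good /xq; def.
have [ca hca] : exists c : M R, forall k : nn, xq c k = nq k * h - t * h.
  by apply: (def_comp1Q (F := fun k : nn => nq k * h - t * h)); def.
have [cb hcb] : exists c : M R, forall k : nn, xq c k = (nq k + 1) * h + t * h.
  by apply: (def_comp1Q (F := fun k : nn => (nq k + 1) * h + t * h)); def.
have th : 0 < t * h by apply: mulr_gt0.
have cab k : xq ca k <= xq cb k by rewrite hca hcb; lra.
have nbhd (f : M R) : exists l r : M R, forall k, xq l k = xq f k - 2 * h /\ xq r k = xq f k + 2 * h.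
  have [l hl] : exists c : M R, forall k : nn, xq c k = xq f k - 2 * h.
    by apply: (def_comp1Q (F := fun k : nn => xq f k - 2 * h)); rewrite /xq; def.
  have [r hr] : exists c : M R, forall k : nn, xq c k = xq f k + 2 * h.
    by apply: (def_comp1Q (F := fun k : nn => xq f k + 2 * h)); rewrite /xq; def.
  by exists l, r.
have [al [ar ha]] := nbhd a; have [bl [br hb]] := nbhd b.
have alr k : xq al k <= xq ar k by have [-> ->] := ha k; lra.
have blr k : xq bl k <= xq br k by have [-> ->] := hb k; lra.
have dT : DefP (fun _ : env M [:: N] => True) by def.
have [w1 [hw1 cov1]] := rcov_cons (P := fun _ : nn => True) n0 dT alr (rcov_tail ab hs hn0).
have [w2 [hw2 cov2]] := rcov_cons (P := fun _ : nn => True) n0 dT blr cov1.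
have [w3 [hw3 cov3]] := rcov_cons (P := good) n dgood cab cov2.
have dbad : DefP (fun e : env M [:: N] => ~ good e.2) by apply: DefP_not.
have [w4 [hw4 cov4]] := rcov_cons (P := fun k => ~ good k) n dbad cab rcov_empty.
have S1 : Sm w1 n0 = nq n0 * (4 * h).
  apply: Sm_const => k; rewrite hw1; have [-> ->] := ha k.
  by have -> : `[< True >] by [apply/asboolP]; ring.
have S2 : Sm w2 n0 = nq n0 * (4 * h).
  apply: Sm_const => k; rewrite hw2; have [-> ->] := hb k.
  by have -> : `[< True >] by [apply/asboolP]; ring.
have S34 m : Sm w3 m + Sm w4 m = nq m * (h + 2 * (t * h)).
  move: m; apply: def_ind; first by def.
    by rewrite !Sm0 nq0 mul0r addr0.
  move=> m em; rewrite !Sm_step hw3 hw4 nqD nq1 hca hcb; move: em.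
  case: (asboolP (good m)) => g; case: (asboolP (~ good m)) => g' em;
    [by case: g'|lra|lra|by case: g'].
exists (0 + Sm w4 n), (e / 4 + Sm w1 n0 + Sm w2 n0 + Sm w3 n); split; last split.
- apply: rcov_sub cov4 => x hx [hI hav]; right.
  have [k [kn [h1 h2]]] := cell_ex L th hI; exists k; split=> //; rewrite hca hcb; split=> //.
  move=> [i [_ [l r]]]; apply: (hav i); split; [apply: Above_le h1 l|apply: Below_le h2 r].
- apply: rcov_sub cov3 => x hx [hI hnav].
  have [i [h1 h2]] : exists i, Above x (xq a i) /\ Below x (xq b i).
    apply: contrapT => hn; apply: hnav; split=> // k hk; apply: hn; exists k; exact: hk.
  have [lt|/nle_ex[i' ei]] := pselect (i <| n0); last by left; left; left; exists i'; rewrite -ei.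
  have [k [kn [h3 h4]]] := cell_ex L th hI.
  have [g|g] := pselect (good k); first by right; exists k; rewrite hca hcb.
  left; have [l|l] := leP (xq a i) (nq k * h - t * h); last first.
    left; right; exists i; split=> //; split=> //; have [-> ->] := ha i.
    split; first by apply: Above_le h1 _; lra.
    by apply: Below_le h4 _; rewrite -/h; nra.
  right; exists i; split=> //; split=> //; have [-> ->] := hb i.
  have r : xq b i < (nq k + 1) * h + t * h.
    by rewrite ltNge; apply/negP => r; apply: g; exists i.
  split; last by apply: Below_le h2 _; lra.
  by apply: Above_le h3 _; rewrite -/h; nra.
- have := S34 n; rewrite S1 S2; have : 2 * (t * h) * nq n = 2 * t by rewrite -mulrA [_ * nq n]mulrC; nra.
  nra.
Qed.
End ClosedMeasurable.

(** * Bisection *)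

Section Bisection.
Variable M : model.
Notation nn := (nn M).
Notation mrat := (mrat M).
Local Open Scope ring_scope.
Local Notation "a <| b" := (nltn a b) (at level 70).

(** [C m j n] is the [n]-th approximation, increasing in [n], to the mass of the
    cell [[j * 2 ^ - m, (j + 1) * 2 ^ - m]]. *)
Definition content (C : nn -> nn -> nn -> mrat) :=
  [/\ DefQ (fun e : env M [:: N; N; N] => C e.1.1.2 e.1.2 e.2),
      forall m j n, C m j n = C (m + 1) (j + j) n + C (m + 1) (j + j + 1) n,
      forall m j n k, C m j n <= C m j (n + k)
    & forall m j n, 0 <= C m j n].

Definition alive (C : nn -> nn -> nn -> mrat) th (m j : nn) := forall n, C m j n <= th * p2 m.

(** Comprehension turns the definable [C] into an object, which can then be applied to any definable
    arguments. *)
Lemma DefQ_subst3 (C : nn -> nn -> nn -> mrat) G (A B D : env M G -> nn) :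
  DefQ (fun e : env M [:: N; N; N] => C e.1.1.2 e.1.2 e.2) ->
  DefN A -> DefN B -> DefN D -> DefQ (fun e => C (A e) (B e) (D e)).
Proof.
move=> /def_comp3Q[f hf] dA dB dD.
have -> : (fun e => C (A e) (B e) (D e)) = (fun e => qv (app (app (app f (A e)) (B e)) (D e))).
  by apply: funext => e; rewrite hf.
by apply: DefQ_qv; do 3 (apply: DefT_app => //); apply: DefT_const.
Qed.

(** If both halves overflow, at stages [n1] and [n2], then by monotonicity both do at stage
    [n1 + n2], and there their sum overflows the whole cell. *)
Lemma alive_half C th m j : content C -> alive C th m j ->
  alive C th (m + 1) (j + j) \/ alive C th (m + 1) (j + j + 1).
Proof.
move=> [_ hadd hmon _] hal; apply: contrapT => /not_orP[h1 h2].
have [n1 l1] : exists n, th * p2 (m + 1) < C (m + 1) (j + j) n.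
  by apply: contrapT => h; apply: h1 => n; rewrite leNgt; apply/negP => l; apply: h; exists n.
have [n2 l2] : exists n, th * p2 (m + 1) < C (m + 1) (j + j + 1) n.
  by apply: contrapT => h; apply: h2 => n; rewrite leNgt; apply/negP => l; apply: h; exists n.
have := hal (n1 + n2); rewrite hadd; have := hmon (m + 1) (j + j) n1 n2.
have := hmon (m + 1) (j + j + 1) n2 n1; rewrite [n2 + n1]addrC.
by move: l1 l2; rewrite p2S; lra.
Qed.

(** All starting cells are treated at once, so that the points form a single object [Y]. The
    recursion tests the left half and otherwise takes the right one, so a path and its limit exist
    for dead cells too; only survival needs a live start. *)
Lemma bisection C th (L : nn) : content C -> exists Y : M (N ⇒ R), exists G : nn -> nn -> nn,
  forall k : nn, [/\ G k 0 = k, isRe (app Y k),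
    (alive C th L k -> forall m, alive C th (L + m) (G k m)),
    (forall m, nq (G k m) * p2 (L + m) <= xq (app Y k) m /\
       xq (app Y k) m <= (nq (G k m) + 1) * p2 (L + m)) &
    forall m i, nq (G k m) * p2 (L + m) <= nq (G k (m + i)) * p2 (L + (m + i)) /\
       (nq (G k (m + i)) + 1) * p2 (L + (m + i)) <= (nq (G k m) + 1) * p2 (L + m)].
Proof.
move=> hC; have [dC _ _ _] := hC.
have [f hf] : exists f : M (N ⇒ N ⇒ N), forall m r : nn, app (app f m) r =
    if `[< alive C th (L + m + 1) (r + r) >] then r + r else r + r + 1 :> nn.
  apply: (def_comp2 (F := fun m r : nn =>
    if `[< alive C th (L + m + 1) (r + r) >] then r + r else r + r + 1 : M N)).
  apply: (@DefT_if _ _ (fun e : env M [:: N; N] => alive C th (L + (e.1.2 : nn) + 1) ((e.2 : nn) + e.2))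
    (fun e => (e.2 : nn) + e.2) (fun e => (e.2 : nn) + e.2 + 1)); try by def.
  rewrite /alive.
  apply: (@DefP_all _ _ (fun (e : env M [:: N; N]) n => C (L + (e.1.2 : nn) + 1) ((e.2 : nn) + e.2) n
     <= th * p2 (L + (e.1.2 : nn) + 1))).
  apply: DefP_qle; last by def.
  by apply: (@DefQ_subst3 C [:: N; N; N] (fun e => L + (e.1.1.2 : nn) + 1)
    (fun e => (e.1.2 : nn) + e.1.2) (fun e => e.2)); def.
pose G (k m : nn) : nn := app (app (app (cst M Rec) f) k) m.
have G0 k : G k 0 = k by exact: rec0.
have GS k m : G k (m + 1) = if `[< alive C th (L + m + 1) (G k m + G k m) >]
    then G k m + G k m else G k m + G k m + 1.
  by rewrite {1}/G recS hf.
have [Y hY] : exists Y : M (N ⇒ N ⇒ N), forall k m : nn, qv (app (app Y k) m) =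
    nq (G k m) * p2 (L + m).
  by apply: (def_comp2Q (F := fun k m : nn => nq (G k m) * p2 (L + m))); rewrite /G; def.
(* Left end-points taken one level deeper: later ones differ from the [m]-th by at most
   [p2 (L + (m + 1)) < p2 m], the rate required of a real. *)
have [Y' hY'] : exists Y : M (N ⇒ N ⇒ N), forall k m : nn, qv (app (app Y k) m) =
    nq (G k (m + 1)) * p2 (L + (m + 1)).
  by apply: (def_comp2Q (F := fun k m : nn => nq (G k (m + 1)) * p2 (L + (m + 1)))); rewrite /G; def.
have xY k m : xq (app Y' k) m = nq (G k (m + 1)) * p2 (L + (m + 1)) by exact: hY'.
have step k m : nq (G k m) * p2 (L + m) <= nq (G k (m + 1)) * p2 (L + (m + 1)) /\
    (nq (G k (m + 1)) + 1) * p2 (L + (m + 1)) <= (nq (G k m) + 1) * p2 (L + m).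
  rewrite GS addrA p2S; have := p2_gt0 (L + m).
  by case: asboolP => _; rewrite !nqD ?nq1; nra.
have nest k m i : nq (G k m) * p2 (L + m) <= nq (G k (m + i)) * p2 (L + (m + i)) /\
       (nq (G k (m + i)) + 1) * p2 (L + (m + i)) <= (nq (G k m) + 1) * p2 (L + m).
  move: i; apply: def_ind; first by rewrite /G; def.
    by rewrite addr0.
  by move=> i; have := step k (m + i); rewrite [m + (i + 1)]addrA; lra.
exists Y', G => k; split=> //.
- move=> m i; rewrite !xY; have := nest k (m + 1) i; have := p2_gt0 (L + (m + i + 1)).
  rewrite [m + 1 + i]addrAC.
  have : p2 (L + (m + 1)) < p2 m.
    rewrite addrCA p2D p2S; have := p2_le1 L; have := p2_gt0 L; have := p2_gt0 m.
    by nra.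
  lra.
- move=> al; apply: def_ind.
  + rewrite /alive /G.
    apply: (@DefP_all _ _ (fun (e : env M [:: N]) n => C (L + (e.2 : nn)) (G k e.2) n
     <= th * p2 (L + (e.2 : nn)))).
    apply: DefP_qle; last by def.
    by apply: (@DefQ_subst3 C [:: N; N] (fun e => L + (e.1.2 : nn)) (fun e => G k e.1.2)
      (fun e => e.2)); rewrite /G; def.
  + by rewrite addr0 G0.
  + move=> m hm; rewrite addrA GS; case: asboolP => // h.
    by have [] := alive_half hC hm.
- move=> m; rewrite xY; have := step k m; have := p2_gt0 (L + (m + 1)); lra.
Qed.

(** ** The content of an open set *)

(** Written as conditionals on propositions, the shape that [DefQ_if] accepts; [qmaxE] and [qminE]
    give back the lattice operations. *)
Definition qmax (x y : mrat) := if `[< x < y >] then y else x.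
Definition qmin (x y : mrat) := if `[< x < y >] then x else y.
Definition overlap (l r a b : mrat) :=
  if `[< qmax l a < qmin r b >] then qmin r b - qmax l a else 0.

Lemma qmaxE x y : qmax x y = Num.max x y.
Proof. by rewrite /qmax; case: asboolP => [h|/negP]; [rewrite max_r // ltW|rewrite -leNgt => h; rewrite max_l]. Qed.
Lemma qminE x y : qmin x y = Num.min x y.
Proof. by rewrite /qmin; case: asboolP => [h|/negP]; [rewrite min_l // ltW|rewrite -leNgt => h; rewrite min_r]. Qed.
Lemma overlapE l r a b : overlap l r a b = Num.max 0 (Num.min r b - Num.max l a).
Proof.
rewrite /overlap qmaxE qminE; case: asboolP => [h|/negP].
  have h0 : 0 <= Num.min r b - Num.max l a by rewrite subr_ge0 ltW.
  by rewrite (max_r h0).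
rewrite -leNgt -subr_le0 => h; by rewrite (max_l h).
Qed.

Lemma overlap_ge0 l r a b : 0 <= overlap l r a b.
Proof. by rewrite overlapE le_max lexx. Qed.

Lemma overlap_split l m r a b : l <= m -> m <= r -> a <= b ->
  overlap l r a b = overlap l m a b + overlap m r a b.
Proof.
move=> lm mr ab; rewrite !overlapE.
by case: (leP m a) => h1; case: (leP l a) => h2; case: (leP r b) => h3; case: (leP m b) => h4;
  repeat match goal with |- context [Num.max 0 ?y] => case: (leP 0 y) => ? end; lra.
Qed.

Lemma overlap_le l r a b : a <= b -> overlap l r a b <= b - a.
Proof.
move=> ab; rewrite overlapE ge_max subr_ge0 ab /=.
have : Num.min r b <= b by rewrite ge_min lexx orbT.
have : a <= Num.max l a by rewrite le_max lexx orbT.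
lra.
Qed.

Lemma overlap_full l r a b : a <= l -> l <= r -> r <= b -> overlap l r a b = r - l.
Proof. by move=> h1 h2 h3; rewrite overlapE (min_l h3) (max_l h1) max_r ?subr_ge0. Qed.

(** A cell inside the [i]-th interval is full at every stage beyond [i], hence dead for any
    threshold below 1. *)
Definition excludes (C : nn -> nn -> nn -> mrat) (a b : M R) :=
  forall m j i n, xq a i <= nq j * p2 m -> (nq j + 1) * p2 m <= xq b i -> i <| n -> p2 m <= C m j n.

(** The content sums the overlaps of a cell with the first [n] intervals. Points in several
    intervals are counted repeatedly; this keeps the content additive, and still bounded by the
    total length [s]. *)
Lemma open_content (a b : M R) s : (forall k, xq a k <= xq b k) ->
  (forall n, Sm b n - Sm a n <= s) -> exists C, [/\ content C, (forall n, C 0 0 n <= s) & excludes C a b].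
Proof.
move=> ab hs.
have [f hf] : exists f : M (N ⇒ N ⇒ N ⇒ N), forall m j i : nn, qv (app (app (app f m) j) i) =
    overlap (nq j * p2 m) ((nq j + 1) * p2 m) (xq a i) (xq b i).
  apply: (def_comp3Q (F := fun m j i : nn => overlap (nq j * p2 m) ((nq j + 1) * p2 m) (xq a i) (xq b i))).
  by rewrite /overlap /qmax /qmin /xq; def.
have hq m j i : xq (app (app f m) j) i = overlap (nq j * p2 m) ((nq j + 1) * p2 m) (xq a i) (xq b i).
  exact: hf.
have f0 m j i : 0 <= xq (app (app f m) j) i by rewrite hq overlap_ge0.
exists (fun m j n => Sm (app (app f m) j) n); split; first split.
- by def.
- move=> m j n; move: n; apply: def_ind; first by def.
    by rewrite !Sm0 addr0.
  move=> n e; rewrite !Sm_step e !hq p2S !nqD nq1; have := p2_gt0 m => h0.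
  rewrite (@overlap_split _ ((nq j + nq j + 1) * (p2 m / 2))) //; try lra.
  set u := _ * p2 m; set u' := _ * p2 m.
  have -> : (nq j + nq j) * (p2 m / 2) = u by rewrite /u; lra.
  have -> : (nq j + nq j + 1 + 1) * (p2 m / 2) = u' by rewrite /u'; lra.
  lra.
- by move=> m j n k; apply: Sm_le.
- by move=> m j n; apply: Sm_ge0.
- move=> n; apply: le_trans (hs n); move: n; apply: def_ind; first by def.
    by rewrite !Sm0 subr0.
  move=> n e; rewrite !Sm_step hq; have := overlap_le (nq 0 * p2 0) ((nq 0 + 1) * p2 0) (ab n); lra.
- move=> m j i n h1 h2 /nlt_ex[k ->].
  have := Sm_le (i + 1) k (f0 m j); rewrite Sm_step hq overlap_full //; last by have := p2_gt0 m; lra.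
  by have := Sm_ge0 i (f0 m j); rewrite [i + k + 1]addrAC; have := p2_gt0 m; lra.
Qed.

(** Were [x] in the interval of index [i], with gaps [g] and [g'] to its ends, a small cell of the
    path would lie inside that interval and be full at stage [i + 1], against [th < 1]. *)
Lemma alive_avoids (a b : M R) C th (L : nn) (x : M R) (G : nn -> nn) : excludes C a b -> th < 1 ->
  isRe x -> (forall m, alive C th (L + m) (G m)) ->
  (forall m, nq (G m) * p2 (L + m) <= xq x m /\ xq x m <= (nq (G m) + 1) * p2 (L + m)) ->
  avoids a b x.
Proof.
move=> hC th1 hx hal hc i [/(Above_gap hx)[g g0 hg] /(Below_gap hx)[g' g'0 hg']].
have [|m hm] := @p2_small M (Num.min g g' / 4); first by rewrite divr_gt0 // lt_min g0.
have [hm1 hm2] : 4 * p2 m < g /\ 4 * p2 m < g'.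
  have : Num.min g g' <= g by rewrite ge_min lexx.
  have : Num.min g g' <= g' by rewrite ge_min lexx orbT.
  lra.
have := hc m; have := hg m; have := hg' m; have := p2_gt0 (L + m).
have : p2 (L + m) <= p2 m by rewrite addrC p2_add.
move=> h1 h2 h3 h4 h5.
have := hC (L + m) (G m) i (i + 1) _ _ (nltSn i); have := hal m (i + 1).
have : th * p2 (L + m) < p2 (L + m) by nra.
move=> h6 h7 h8; have : p2 (L + m) <= C (L + m) (G m) (i + 1) by apply: h8; lra.
lra.
Qed.
End Bisection.

(** * The principles in a model *)

Section Principles.
Variable M : model.
Notation nn := (nn M).
Notation mrat := (mrat M).
Local Open Scope ring_scope.
Local Notation "a <| b" := (nltn a b) (at level 70).

Definition funR (P : M R -> Prop) (f : M (R ⇒ R)) :=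
  (forall x, P x -> isRe (app f x)) /\
  forall x y, P x -> P y -> eqRe x y -> eqRe (app f x) (app f y).

Definition measfunR (f : M (R ⇒ R)) :=
  forall t, isRe t -> measurableR (fun x => inIR x /\ LTR t (app f x)).

Definition lusinR (f : M (R ⇒ R)) (e : M R) (K : M (R ⇒ R)) :=
  funR (@isRe M) K /\ (forall x, isRe x -> memR x K -> inIR x) /\
  measurableR (fun x => memR x K) /\ measltR (fun x => inIR x /\ ~ memR x K) e /\
  exists m : M R, isRe m /\ forall x, isRe x -> memR x K ->
    (~ exists n, xq (app f x) n + 2 * p2 n < - xq m n) /\ ~ LTR m (app f x).

Definition closedR (K : M (R ⇒ R)) := exists a b : M R, forall x, isRe x ->
  (memR x K <-> inIR x /\ avoids a b x).

Definition LLPm := forall f, funR (@isRe M) f -> measfunR f ->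
  forall e, isRe e -> Above e 0 -> exists K, lusinR f e K.
Definition LLPRMm := forall f, funR (@isRe M) f -> measfunR f ->
  forall e, isRe e -> Above e 0 -> exists K, lusinR f e K /\ closedR K.

(** The formulas for [y - r < x] and [x < y + r], unfolded: sums of reals shift the
    index of the approximations. *)
Definition ballR (y r x : M R) :=
  (exists m : nn, xq y (m + 1) - xq r (m + 1) + 2 * p2 m < xq x m) /\
  (exists m : nn, xq x m + 2 * p2 m < xq y (m + 1) + xq r (m + 1)).

Definition WHBUm := forall psi, funR (@inIR M) psi -> (forall x, inIR x -> Above (app psi x) 0) ->
  measfunR psi -> forall e, isRe e -> Above e 0 -> exists (n : nn) (Y : M (N ⇒ R)),
  (forall i : nn, i <| n + 1 -> inIR (app Y i)) /\
  forall c : M R, (forall m : nn, xq c m = 1 - xq e (m + 1)) ->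
  measgeR (fun x => exists i : nn, i <| n + 1 /\ ballR (app Y i) (app psi (app Y i)) x) c.

Lemma sat_funOn (P : M R -> Prop) (Q : forall W, term W R -> form W) V (v : valuation V M) f :
  (forall W (w : valuation W M) x, sat w (Q W x) <-> P (ev w x)) ->
  sat v (funOn Q f) <-> funR P (ev v f).
Proof.
move=> hQ; apply: sat_andI => [|_].
  apply: sat_allI => x; apply: sat_impI; first exact: hQ.
  by move=> _; rewrite sat_isReal /= ev_ren.
apply: sat_allI => x; apply: sat_allI => y; apply: sat_impI; first exact: hQ.
move=> _; apply: sat_impI; first exact: hQ.
move=> _; apply: sat_impI; first exact: sat_eqR.
by move=> _; rewrite sat_eqR /= !ev_ren.
Qed.

Lemma sat_onR V (v : valuation V M) f : sat v (onR f) <-> funR (@isRe M) (ev v f).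
Proof. by apply: sat_funOn => W w x; apply: sat_isReal. Qed.
Lemma sat_onI V (v : valuation V M) f : sat v (onI f) <-> funR (@inIR M) (ev v f).
Proof. by apply: sat_funOn => W w x; apply: sat_inI. Qed.

Lemma measurableR_iff (E F : M R -> Prop) : (forall x, isRe x -> (E x <-> F x)) ->
  measurableR E <-> measurableR F.
Proof.
move=> h; split; apply: measurableR_ext => // x hx; split=> /(h _ hx) //.
Qed.

Lemma measltR_ext (E F : M R -> Prop) c : (forall x, isRe x -> (E x <-> F x)) ->
  measltR E c <-> measltR F c.
Proof.
move=> h; split=> -[a [b [h1 [h2 h3]]]]; exists a, b; split; [exact: h1| |exact: h1|];
  by split; [apply/(coversR_ext a b h)|exact: h3].
Qed.

Lemma measgeR_ext (E F : M R -> Prop) c : (forall x, isRe x -> (E x <-> F x)) ->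
  measgeR E c <-> measgeR F c.
Proof.
by move=> h; split=> k a b h1 h2; apply: (k a b h1); apply/(coversR_ext a b h).
Qed.

Lemma sat_measurable_fun V (v : valuation V M) f :
  sat v (measurable_fun f) <-> measfunR (ev v f).
Proof.
apply: sat_allI => t; apply: sat_impI; first exact: sat_isReal.
move=> _; rewrite sat_measurable; apply: measurableR_iff => x hx.
apply: sat_andI; first exact: sat_inI.
by move=> _; rewrite sat_ltR /= !ev_ren.
Qed.

Lemma sat_given_by V (v : valuation V M) K x : setR v (given_by K) x <-> memR x (ev v K).
Proof. by rewrite /setR -[sat _ _]/(sat (vcons v x) (mem (Var new) (ren weaken K))) sat_mem /= ev_ren. Qed.

Lemma sat_lusin V (v : valuation V M) f e K :
  sat v (lusin_set f e K) <-> lusinR (ev v f) (ev v e) (ev v K).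
Proof.
apply: sat_andI; first exact: sat_onR.
move=> _; apply: sat_andI.
  apply: sat_allI => x; apply: sat_impI; first exact: sat_isReal.
  move=> _; apply: sat_impI; first by rewrite sat_mem ev_ren.
  by move=> _; exact: sat_inI.
move=> _; apply: sat_andI.
  by rewrite sat_measurable; apply: measurableR_iff => x _; apply: sat_given_by.
move=> _; apply: sat_andI.
  by rewrite sat_measure_lt; apply: measltR_ext => x _; rewrite setR_complI sat_given_by.
move=> _; apply: sat_exI => m; apply: sat_andI; first exact: sat_isReal.
move=> _; apply: sat_allI => x; apply: sat_impI; first exact: sat_isReal.
move=> _; apply: sat_impI; first by rewrite sat_mem ev_ren.
move=> _; apply: sat_andI.
  rewrite sat_leR; apply: not_iff_compat; apply: iff_ex => n.
  by rewrite xq_ropp /= !ev_ren.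
by move=> _; rewrite sat_leR /= !ev_ren.
Qed.

Lemma sat_RM_closed V (v : valuation V M) K : sat v (RM_closed K) <-> closedR (ev v K).
Proof.
apply: sat_exI => a; apply: sat_exI => b; apply: sat_allI => x; apply: sat_impI.
  exact: sat_isReal.
move=> hx; apply: sat_iffI; first by rewrite sat_mem ev_ren.
apply: sat_andI; first exact: sat_inI.
move=> _; apply: sat_allI => n; apply: sat_notI; apply: sat_andI.
  by rewrite sat_ltR; apply: const_LTR => //; apply: is_const_rcst.
by move=> _; rewrite sat_ltR; apply: LTR_const => //; apply: is_const_rcst.
Qed.

Lemma sat_pos V (v : valuation V M) x : isRe (ev v x) -> sat v (ltR rzero x) <-> Above (ev v x) 0.
Proof. by move=> hx; rewrite sat_ltR; apply: const_LTR => //; apply: is_const_rzero. Qed.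

Lemma sat_LLP : sat (novar M) LLP <-> LLPm.
Proof.
apply: sat_allI => f; apply: sat_impI; first exact: sat_onR.
move=> _; apply: sat_impI; first exact: sat_measurable_fun.
move=> _; apply: sat_allI => e; apply: sat_impI; first exact: sat_isReal.
move=> he; apply: sat_impI; first exact: sat_pos.
by move=> _; apply: sat_exI => K; rewrite sat_lusin.
Qed.

Lemma sat_LLP_RM : sat (novar M) LLP_RM <-> LLPRMm.
Proof.
apply: sat_allI => f; apply: sat_impI; first exact: sat_onR.
move=> _; apply: sat_impI; first exact: sat_measurable_fun.
move=> _; apply: sat_allI => e; apply: sat_impI; first exact: sat_isReal.
move=> he; apply: sat_impI; first exact: sat_pos.
move=> _; apply: sat_exI => K; apply: sat_andI; first by rewrite sat_lusin.
by move=> _; apply: sat_RM_closed.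
Qed.

Lemma measgeR_c E (c c' : M R) : (forall m, xq c m = xq c' m) -> measgeR E c -> measgeR E c'.
Proof.
move=> h k a b h1 h2 d hd [n hn]; apply: (k a b h1 h2 d hd); exists n.
by rewrite h.
Qed.

Lemma sat_ltn V (v : valuation V M) (i n : term V N) :
  sat v (Lt i (n ⊕ 𝟏)) <-> (ev v i : nn) <| (ev v n : nn) + 1.
Proof. by []. Qed.

Lemma sat_WHBU : sat (novar M) WHBU_m <-> WHBUm.
Proof.
apply: sat_allI => psi; apply: sat_impI; first exact: sat_onI.
move=> h1; apply: sat_impI.
  apply: sat_allI => x; apply: sat_impI; first exact: sat_inI.
  by move=> hx; apply: sat_pos; apply: h1.1.
move=> _; apply: sat_impI; first exact: sat_measurable_fun.
move=> _; apply: sat_allI => e; apply: sat_impI; first exact: sat_isReal.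
move=> he; apply: sat_impI; first exact: sat_pos.
move=> _; apply: sat_exI => n; apply: sat_exI => Y; apply: sat_andI.
  apply: sat_allI => i; apply: sat_impI; first exact: sat_ltn.
  by move=> _; rewrite sat_inI.
move=> _; rewrite sat_measure_ge.
set E := setR _ _; set E' := (fun x => _); set c := ev _ _.
have hc m : xq c m = 1 - xq e (m + 1).
  by rewrite /c xq_rsub (@is_const_rone _ _ _ (m + 1)).
have hE : forall x, isRe x -> (E x <-> E' x).
  move=> x _; apply: sat_exI => i; apply: sat_andI; first exact: sat_ltn.
  move=> _; apply: sat_andI.
    by rewrite sat_ltR; apply: iff_ex => m; rewrite xq_rsub /= ?ev_ren.
  by move=> _; rewrite sat_ltR; apply: iff_ex => m; rewrite xq_radd /= ?ev_ren.
split.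
  move=> /(measgeR_ext _ hE) h c' hc'; apply: measgeR_c h => m.
  by rewrite hc hc'.
by move=> h; apply/(measgeR_ext _ hE); apply: h.
Qed.

Lemma LLPRM_LLP : LLPRMm -> LLPm.
Proof. by move=> h f h1 h2 e h3 h4; have [K [hK _]] := h f h1 h2 e h3 h4; exists K. Qed.

Lemma inIR_eqRe (x y : M R) : isRe x -> isRe y -> eqRe x y -> inIR x -> inIR y.
Proof.
move=> hx hy e [_ [h0 h1]]; split=> //; have e' := eqRe_sym e; split=> h.
  by apply: h0; apply: eqRe_Below h.
by apply: h1; apply: eqRe_Above h.
Qed.

Lemma avoids_eqRe (a b x y : M R) : isRe x -> isRe y -> eqRe x y -> avoids a b x -> avoids a b y.
Proof.
move=> hx hy e h k [h1 h2]; have e' := eqRe_sym e; apply: (h k); split.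
  exact: eqRe_Above h1.
exact: eqRe_Below h2.
Qed.

(** Both conditions quantify over numbers only, so they are decided uniformly in the argument [x] of
    type 1. *)
Lemma closed_set_ex (a b : M R) : exists K : M (R ⇒ R), forall x m,
  xq (app K x) m = if `[< inIR x /\ avoids a b x >] then 1 else 0.
Proof.
apply: (def_comp2Q (F := fun (x : M R) (m : M N) => if `[< inIR x /\ avoids a b x >] then 1 else 0)).
apply: DefQ_if; [|by def|by def].
by rewrite /inIR /avoids /isRe /Above /Below /xq; def.
Qed.

Lemma LLP_LLPRM : LLPm -> LLPRMm.
Proof.
move=> h f h1 h2 e he e0; have [K [kR [kI [_ [kl [m0 [rm0 hb]]]]]]] := h f h1 h2 e he e0.
have [s [es [a [b [ab [hs hcov]]]]]] := (measltR_rcov _ he).1 kl.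
have [K' hK'] := closed_set_ex a b.
have memK' x : memR x K' <-> inIR x /\ avoids a b x.
  split=> [[n]|hx].
    by rewrite hK'; case: asboolP => // _; have := p2_gt0 n; lra.
  (* Membership asks for [2 * p2 n] below the value 1. *)
  have [|n hn] := @p2_small M (1 / 2); first lra.
  by exists n; rewrite hK'; have -> : `[< inIR x /\ avoids a b x >] by [apply/asboolP]; lra.
exists K'; split; last by exists a, b => x _; exact: memK'.
split; first split.
- by move=> x _; apply: is_const_isRe (hK' x).
- move=> x y hx hy exy; apply: (eqRe_const (hK' x)) => m; rewrite hK'.
  have -> // : `[< inIR x /\ avoids a b x >] = `[< inIR y /\ avoids a b y >].
  apply/asbool_equiv_eq; split=> -[hi ha].
    by split; [apply: inIR_eqRe hi|apply: avoids_eqRe ha].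
  by have exy' := eqRe_sym exy; split; [apply: inIR_eqRe hi|apply: avoids_eqRe ha].
split; first by move=> x _ /memK' [].
split.
  apply: measurableR_ext (closed_measurable ab hs) => x _; exact: iff_sym (memK' x).
split.
  (* The cover of [I \ K] also covers [I \ K'], as a point of [I] outside all its intervals is in
     [K']. *)
  apply/(measltR_rcov _ he); exists s; split=> //; exists a, b; split=> //; split=> //.
  move=> x hx [hI hn]; apply: contrapT => hk; apply: hn; apply/memK'; split=> // k hk'.
  by apply: hk; exists k.
exists m0; split=> // x hx /memK'[hI hav]; apply: hb => //.
apply: contrapT => hn; have [k hk] := hcov x hx (conj hI hn).
exact: hav k hk.
Qed.
End Principles.

(** * From bounded functions to finite coverings *)

Section Covering.
Variable M : model.
Notation nn := (nn M).
Notation mrat := (mrat M).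
Local Open Scope ring_scope.
Local Notation "a <| b" := (nltn a b) (at level 70).

(** Here [mu] acts as a choice functional for arithmetical predicates with a parameter of any type
    [s], and it selects least witnesses. *)
Lemma def_least_fun s (P : M s -> nn -> Prop) : DefP (fun e : env M [:: N; s] => P e.1.2 e.2) ->
  (forall x, exists n, P x n) -> exists F : M (s ⇒ N), forall x,
    P x (app F x) /\ forall i, i <| app F x -> ~ P x i.
Proof.
move=> [f /DefT_lam[g dg hg] hf] hP; have [mu hmu] := mu_exists M.
have [F _ hF] : exists2 F : env M [::] -> M (s ⇒ N), DefT F &
    forall e a, app (F e) a = app mu (g (e, a)).
  apply: (@DefT_lam _ [::] s N (fun e => app mu (g e))).
  by apply: DefT_app => //; apply: DefT_const.
have h x k : app (g (tt, x)) k = 0 :> nn <-> P x k by rewrite hg (hf (tt, x, k)).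
exists (F tt) => x; rewrite hF; have [|h1 h2] := hmu (g (tt, x)).
  by have [n Pn] := hP x; exists n; apply/h.
by split; [apply/h|move=> i /h2 hi /h].
Qed.

Lemma ball_cell (y r x : M R) l h : isRe y -> isRe r -> isRe x ->
  (forall n, l - p2 n <= xq y n /\ xq y n <= l + h + p2 n) ->
  (forall n, l - p2 n <= xq x n /\ xq x n <= l + h + p2 n) ->
  Above r h -> ballR y r x.
Proof.
move=> ry rr rx hy hx /(Above_gap rr)[g g0 hg].
have [|m hm] := @p2_small M (g / 8); first lra.
have := hy (m + 1); have := hx m; have := hg (m + 1); have := p2_add m 1; have := p2_gt0 m.
by split; exists m; lra.
Qed.

(** The approximation of index [j + i] lies in a subcell of the cell of level [L + j]; comparing it
    with the [n]-th one, for arbitrarily large [i], leaves only the error [p2 n]. *)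
Lemma cell_bounds (x : M R) (L : nn) (G : nn -> nn) : isRe x ->
  (forall m, nq (G m) * p2 (L + m) <= xq x m /\ xq x m <= (nq (G m) + 1) * p2 (L + m)) ->
  (forall m i, nq (G m) * p2 (L + m) <= nq (G (m + i)) * p2 (L + (m + i)) /\
       (nq (G (m + i)) + 1) * p2 (L + (m + i)) <= (nq (G m) + 1) * p2 (L + m)) ->
  forall j n, nq (G j) * p2 (L + j) - p2 n <= xq x n /\
    xq x n <= nq (G j) * p2 (L + j) + p2 (L + j) + p2 n.
Proof.
move=> rx hc hn j n; have h0 := p2_gt0 n.
have key e : 0 < e -> nq (G j) * p2 (L + j) - p2 n - e <= xq x n /\
    xq x n <= nq (G j) * p2 (L + j) + p2 (L + j) + p2 n + e.
  move=> e0; have [i hi] := p2_small e0.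
  have := hc (j + i); have := hn j i; have := isRe_dist n (j + i) rx.
  have := isRe_dist (j + i) n rx; have : p2 (j + i) <= p2 i by rewrite addrC p2_add.
  lra.
split; rewrite leNgt; apply/negP => l.
  have [|h _] := key ((nq (G j) * p2 (L + j) - p2 n - xq x n) / 2); first lra.
  lra.
have [|_ h] := key ((xq x n - (nq (G j) * p2 (L + j) + p2 (L + j) + p2 n)) / 2); first lra.
lra.
Qed.

Lemma inIR_cell (x : M R) l h : isRe x -> 0 <= l -> l + h <= 1 ->
  (forall n, l - p2 n <= xq x n /\ xq x n <= l + h + p2 n) -> inIR x.
Proof.
move=> rx l0 l1 hx; split=> //; split=> -[n hn]; have := hx n; lra.
Qed.

Lemma cell_index (j L : nn) : nq j * p2 L + p2 L <= 1 <-> j <| pow2m1M L + 1.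
Proof.
rewrite n_ltS nq_pow2m1; have h0 := p2_gt0 L.
rewrite -[nq j <= _](ler_pM2r h0) mulrBl mulVf ?lt0r_neq0 // mul1r.
by split; lra.
Qed.

Lemma content_add (C C' : nn -> nn -> nn -> mrat) : content C -> content C' ->
  content (fun m j n => C m j n + C' m j n).
Proof.
move=> [d s i p] [d' s' i' p']; split.
- exact: DefQ_add.
- by move=> m j n; rewrite s s'; lra.
- by move=> m j n k; apply: lerD.
- by move=> m j n; apply: addr_ge0.
Qed.

Section FromPsi.
Variables (psi : M (R ⇒ R)) (psiR : funR (@inIR M) psi)
  (psi0 : forall x, inIR x -> Above (app psi x) 0) (psim : measfunR psi).

(** The function to which Lusin's principle is applied: roughly [- log2 psi] on
    the unit interval, and zero elsewhere. *)
Lemma log_function : exists F : M (R ⇒ N), forall x,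
  (inIR x -> Above (app psi x) (p2 (app F x))) /\
  forall i : nn, i <| app F x -> inIR x /\ ~ Above (app psi x) (p2 i).
Proof.
(* Outside the unit interval the condition is vacuous, so the least number there is 0. *)
have [||F hF] := @def_least_fun R (fun x n => inIR x -> Above (app psi x) (p2 n)).
- by rewrite /inIR /Above /Below /isRe /xq; def.
- move=> x; have [hx|hx] := pselect (inIR x); last by exists 0.
  have [q q0 hq] := Above_open (psi0 hx); have [n hn] := p2_small q0.
  by exists n => _; apply: Above_le hq (ltW hn).
exists F => x; have [h1 h2] := hF x; split=> // i /h2 h; split.
  by apply: contrapT => hx; apply: h.
by move=> h'; apply: h.
Qed.

Variables (F : M (R ⇒ N)) (hF : forall x,
  (inIR x -> Above (app psi x) (p2 (app F x))) /\
  forall i : nn, i <| app F x -> inIR x /\ ~ Above (app psi x) (p2 i)).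

Lemma p2_anti (i j : nn) : nq i <= nq j -> p2 j <= p2 i.
Proof. by move=> /nq_le/nle_ex[k ->]; apply: p2_add. Qed.

Lemma log_lt x (k : nn) : inIR x -> k <| app F x <-> ~ Above (app psi x) (p2 k).
Proof.
move=> hx; have [h1 h2] := hF x; split=> [/h2 [] //|h].
apply: contrapT => h'; apply: h; apply: Above_le (h1 hx) _; apply: p2_anti.
exact/nq_le.
Qed.

(** Equal reals have equal values under [psi], hence the same cuts, and [F] is determined by the cut
    of [psi x]. *)
Lemma log_eqRe x y : isRe x -> isRe y -> eqRe x y -> app F x = app F y.
Proof.
have half x' y' : isRe x' -> isRe y' -> eqRe x' y' -> ~ (app F x' : nn) <| app F y'.
  move=> hx hy e /((hF y').2) [iy]; apply.
  have ix : inIR x' by apply: inIR_eqRe iy => //; apply: eqRe_sym.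
  apply: eqRe_Above ((hF x').1 ix); [exact: psiR.1|exact: psiR.1|exact: psiR.2].
move=> hx hy e; have := half _ _ hx hy e; have := half _ _ hy hx (eqRe_sym e).
by have [|[]] := @nlt_total M (app F x) (app F y).
Qed.

Variables (f : M (R ⇒ R)) (hf : forall x, is_const (app f x) (nq (app F x : nn))).

Lemma log_funR : funR (@isRe M) f.
Proof.
split=> [x _|x y hx hy e]; first exact: is_const_isRe (hf x).
by apply: eqRe_const (hf x) _; rewrite (log_eqRe hx hy e); exact: hf.
Qed.

Lemma log_measfunR : measfunR f.
Proof.
move=> t rt.
have [q hq] : exists q, Below t q.
  by have [w [_ h]] := @real_approx M t 1 ltr01; exists (w + 1).
have [||n [hn hm]] := @def_least M (fun n => Below t (nq n)); first by rewrite /Below /xq; def.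
  by have [n hn] := mrat_archi q; exists n; apply: Below_le hq (ltW hn).
have lt x : LTR t (app f x) <-> ~ (app F x : nn) <| n.
  rewrite (LTR_const rt (hf x)); split=> [h /hm //|/nq_le h]; exact: Below_le hn h.
have C c : exists u : M R, is_const u c.
  by apply: (def_comp1Q (F := fun _ : M N => c)); def.
(* With [n] the least number above [t], the set consists of the points of [I] where [F] is at least
   [n]. For [n = 0] this is all of [I], obtained as the set where [psi > 0]; for [n = k + 1] it is
   the complement in [I] of the set where [psi > p2 k]. *)
have [n0|[k ek]] := n_case n.
  have [u hu] := C 0; apply: measurableR_ext (psim (is_const_isRe hu)) => x hx.
  split=> -[hi _]; split=> //; first by apply/lt; rewrite n0 => /nq_lt; have := nq_ge0 (app F x); rewrite nq0; lra.
  by apply/(const_LTR (psiR.1 _ hi) hu); apply: psi0.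
have [u hu] := C (p2 k); apply: measurableR_compl (psim (is_const_isRe hu)) => x hx.
  move=> [hi /lt h]; split=> // -[_ /(const_LTR (psiR.1 _ hi) hu) ha]; apply: h; rewrite ek.
  by apply/n_ltS/nq_le => /(log_lt _ hi); apply.
move=> [hi hn']; split=> //; apply/(const_LTR (psiR.1 _ hi) hu); apply: contrapT => ha.
apply: hn'; split=> //; apply/lt; rewrite ek => /n_ltS/nq_le; apply.
exact/(log_lt _ hi).
Qed.
End FromPsi.

Lemma LLP_WHBU : LLPm M -> WHBUm M.
Proof.
move=> hL psi psiR psi0 psim e re e0.
have [F hF] := log_function psi0.
have [f hf] : exists f : M (R ⇒ R), forall (x : M R) (m : M N), qv (app (app f x) m) = nq (app F x : nn).
  by apply: (def_comp2Q (F := fun (x : M R) (m : M N) => nq (app F x : nn))); def.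
have [eps heps ae] := Above_open e0.
have [e1 he1] : exists u : M R, forall k : M N, qv (app u k) = eps / 2.
  by apply: (def_comp1Q (F := fun _ : M N => eps / 2)); def.
have re1 : isRe e1 by exact: is_const_isRe he1.
have ae1 : Above e1 0 by apply/(is_const_Above _ he1); lra.
have [K [_ [KI [_ [kl [m0 [rm0 hb]]]]]]] :=
  hL f (log_funR psiR hF hf) (log_measfunR psiR psi0 psim hF hf) e1 re1 ae1.
have [s [/(is_const_Above _ he1) es [a [b [ab [hs hcov]]]]]] := (measltR_rcov _ re1).1 kl.
(* [w + 1] is a rational above the bound [m0] of [f] on [K]; a number [L] above it bounds the
   rounded logarithm there. *)
have [w [_ hw]] := @real_approx M m0 1 ltr01.
have [L hLw] := mrat_archi (w + 1).
have psiL x : isRe x -> memR x K -> Above (app psi x) (p2 L).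
  move=> rx xK; have [_ h] := hb x rx xK; apply: Above_le ((hF x).1 (KI x rx xK)) _.
  apply: p2_anti; rewrite leNgt; apply/negP => l; apply: h.
  apply/(LTR_const rm0 (hf x)); apply: Below_le hw _; apply: ltW; exact: lt_trans hLw l.
have [C1 [hC1 C1s C1x]] := open_content ab hs.
pose th : mrat := 1 - eps / 2; have th1 : th < 1 by rewrite /th; lra.
have [Y [G hG]] := bisection th L hC1.
(* There are [2 ^ L] centres, one per cell of level [L], numbered up to [2 ^ L - 1]. Centres of dead
   cells are kept: they lie in [I] as well. *)
exists (pow2m1M L), Y.
have YI k : k <| pow2m1M L + 1 -> inIR (app Y k).
  move=> /cell_index hk; have [G0 rY _ hc hn] := hG k.
  have := cell_bounds rY hc hn 0; rewrite G0 addr0 => hb'.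
  apply: inIR_cell rY _ hk hb'.
  by rewrite mulr_ge0 ?nq_ge0 // ltW // p2_gt0.
split=> // c hc; have rc : isRe c.
  move=> n i; rewrite !hc; have := isRe_dist (n + 1) (n + i + 1) re.
  have := isRe_dist (n + i + 1) (n + 1) re; have := p2_add (n + 1) i.
  by rewrite p2S [n + 1 + i]addrAC; lra.
apply: (measgeR_rcov rc) => s2 [a2 [b2 [ab2 [hs2 hcov2]]]] /(Above_gap rc)[g g0 hg].
have [C2 [hC2 C2s C2x]] := open_content ab2 hs2.
(* The supposed cover of the union is shorter than [c = 1 - e], and [eps < e]. *)
have s2e : s2 <= 1 - eps.
  have [g' g'0 hg'] := Above_gap re ae; have [|n hn] := @p2_small M (g / 2); first lra.
  by have := hg n; have := hg' (n + 1); rewrite hc p2S; have := p2_gt0 n; lra.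
have hC := content_add hC1 hC2.
have [X [H hH]] := bisection th 0 hC; have [H0 rX hal hc' hn] := hH 0.
set x := app X (0 : nn) in rX hc'.
have alive0 : alive (fun m j n => C1 m j n + C2 m j n) th 0 0.
  by move=> n; rewrite p2_0 mulr1 /th; have := C1s n; have := C2s n; lra.
have {}hal := hal alive0.
have [_ _ _ C1p] := hC1; have [_ _ _ C2p] := hC2.
pose j := H 0 L.
have xb := cell_bounds rX hc' hn L; rewrite add0r -/j in xb.
have jl : j <| pow2m1M L + 1.
  apply/cell_index; have [_] := hn 0 L; rewrite !add0r H0 nq0 p2_0 -/j; lra.
(* Dropping the nonnegative [C2] shows that the cell [j] of level [L] containing [x] was alive in
   the first bisection; hence its centre avoids the cover of [I \ K] and lies in [K]. *)
have al1 : alive C1 th L j.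
  by move=> n; have := hal L n; rewrite add0r -/j; have := C2p L j n; lra.
have [G0 rY alY cY nY] := hG j.
have avY := alive_avoids C1x th1 rY (alY al1) cY.
have YK : memR (app Y j) K.
  apply: contrapT => hn'; have [k hk] := hcov (app Y j) rY (conj (YI j jl) hn').
  exact: avY k hk.
have := cell_bounds rY cY nY 0; rewrite G0 addr0 => yb.
have xball : ballR (app Y j) (app psi (app Y j)) x.
  by apply: ball_cell rY (psiR.1 _ (YI j jl)) rX yb xb (psiL _ rY YK).
(* The ball around the centre puts [x] in the union and so in its cover, whereas dropping [C1] shows
   that [x] avoids this cover. *)
have [k hk] := hcov2 x rX (ex_intro _ j (conj jl xball)).
apply: (alive_avoids C2x th1 rX _ hc') hk.
move=> m n; have := hal m n; have := C1p (0 + m) (H 0 m) n; lra.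
Qed.
End Covering.

Theorem theorem3p20 :
  proves ACA0w (LLP ⟷ LLP_RM) /\ proves ACA0w (LLP ⟶ WHBU_m).
Proof.
split; apply: proves_ACA0w => D De Dm; set M := Model De Dm.
  split=> [/(sat_LLP M) h|/(sat_LLP_RM M) h].
    by apply/(sat_LLP_RM M); apply: LLP_LLPRM.
  by apply/(sat_LLP M); apply: LLPRM_LLP.
by move=> /(sat_LLP M) h; apply/(sat_WHBU M); apply: LLP_WHBU.
Qed.
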